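(* Let $n_1>\dots>n_m$ be integers and $s_1,\dots,s_m$ positive integers. The moduli space of affine bundles on $\mathbb{P}^1_{\mathbb{C}}$ with fixed linearisation type $[\bigoplus_{i=1}^m\mathcal{O}_{\mathbb{P}^1_{\mathbb{C}}}(n_i)^{\oplus s_i}]$ is naturally identified with the quotient $$\bigoplus_{i=1}^m\big(\mathbb{C}[X_0,X_1]^*_{-2-n_i}\big)^{\oplus s_i}\big/G,$$ where $G=\mathrm{Aut}(\bigoplus_{i=1}^m\mathcal{O}_{\mathbb{P}^1_{\mathbb{C}}}(n_i)^{\oplus s_i})$ is the affine algebraic group $$G=\big\{(A_{ij})_{1\le i,j\le m}\ \big|\ A_{ij}\in M_{s_is_j}(\mathbb{C}[X_0,X_1]_{n_i-n_j}),\ A_{ii}\in\mathrm{GL}(s_i,\mathbb{C})\text{ for }1\le i\le m\big\}$$ acting as follows: for $A=(A_{ij})_{1\le i,j\le m}\in G$ and $\Phi=(\Phi_i)_{1\le i\le m}\in\bigoplus_{i=1}^m(\mathbb{C}[X_0,X_1]^*_{-2-n_i})^{\oplus s_i}$, $$A\bullet\Phi=\Big(\sum_{j=1}^m{}^{\mathrm t}m_{A_{ij}}(\Phi_j)\Big)_{1\le i\le m}.$$ Here $m_{A_{ij}}:\mathbb{C}[X_0,X_1]_{-2-n_i}^{\oplus s_i}\to\mathbb{C}[X_0,X_1]_{-2-n_j}^{\oplus s_j}$ is the multiplication map by the matrix $A_{ij}$ (acting on row vectors, $v\mapsto vA_{ij}$), and ${}^{\mathrm t}m_{A_{ij}}$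 is its transpose.
   Context: $\mathbb{C}[X_0,X_1]_k$ is the space of homogeneous polynomials of degree $k$, with $\mathbb{C}[X_0,X_1]_k=0$ for $k<0$; $^*$ denotes the dual; $M_{s_is_j}(V)$ is the space of $s_i\times s_j$ matrices with entries in $V$. A holomorphic affine bundle of rank $r$ on a complex manifold $X$ is a holomorphic map $\pi:A\to X$ with a maximal atlas of local trivialisations $\pi^{-1}(U)\simeq U\times\mathbb{C}^r$ over $U$ whose fibrewise transition maps are affine transformations of $\mathbb{C}^r$; isomorphisms are biholomorphisms over $X$ that are affine on fibres. Its linearisation $L(A)$ is the vector bundle whose fibre at $x$ is the space of translations of $A_x$, with sheaf of sections $\mathcal{L}(A)$. The invariant $h_A\in H^1(X,\mathcal{L}(A))$ is the extension class $\delta(1)$ of the canonical extension $0\to\mathcal{L}(A)\to\tilde{\mathcal{L}}(A)\to\mathcal{O}_X\to0$ associated with $A$ (here $\tilde L(A)$ is the rank $r+1$ bundle associated with the affine frame bundle of $A$ via $(z\mapsto Mz+\zeta)\mapsto\begin{pmatrix}1&0\\ \zeta&M\end{pmatrix}$, and the epimorphism onto $\mathcal{O}_X$ is induced by the first coordinate on $\mathbb{C}^{r+1}$). The map $A\mapsto h_A$ identifies isomorphism classes of affine bundles with $L(A)\simeq E$ with $H^1(X,\mathcal{E})/\mathrm{Aut}(E)$ ($\mathcal{E}$ the sheaf of sections of $E$); by definition, the moduli space of affine bundles on $X$ with fixed linearisation type $[E]$ (or $[\mathcal{E}]$) is the topological quotient space $H^1(X,\mathcal{E})/\mathrm{Aut}(E)$.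 The identification in the claim is via Serre duality $H^1(\mathbb{P}^1_{\mathbb{C}},\mathcal{O}(n_i))\simeq H^0(\mathbb{P}^1_{\mathbb{C}},\mathcal{O}(-2-n_i))^*=\mathbb{C}[X_0,X_1]^*_{-2-n_i}$. *)

(* Defs.v *)
From HB Require Import structures.
(* the notations of mpoly and of mathcomp-analysis cannot be loaded together *)
From mathcomp Require Import -(notations) mpoly.
From mathcomp Require Import all_boot all_order all_algebra.
From mathcomp Require Import all_classical all_reals all_analysis.
From mathcomp Require Import complex.

Set Implicit Arguments.
Unset Strict Implicit.
Unset Printing Implicit Defensive.

Import Order.TTheory GRing.Theory Num.Theory.
Import numFieldNormedType.Exports.

Local Open Scope classical_set_scope.
Local Open Scope ring_scope.
Local Open Scope quotient_scope.

(* The finest topology on a complex vector space for which all linear maps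
   C^k -> V are continuous; for V of finite dimension this is the usual one. *)
Section FiniteTopology.
Variables (C : numClosedFieldType) (V : lmodType C).

Definition fintop : Type := V.

HB.instance Definition _ := GRing.Lmodule.on fintop.

Definition fintop_open (U : set fintop) :=
  forall (k : nat) (f : {linear 'rV[C]_k -> V}), open (f @^-1` U).

Let fintop_openT : fintop_open setT.
Proof. by move=> k f; rewrite preimage_setT; exact: openT. Qed.

Let fintop_openI : setI_closed fintop_open.
Proof. by move=> A B oA oB k f; rewrite preimage_setI; exact: openI. Qed.

Let fintop_open_bigU (I : Type) (F : I -> set fintop) :
  (forall i, fintop_open (F i)) -> fintop_open (\bigcup_i F i).
Proof.
move=> oF k f; rewrite preimage_bigcup.
by apply: bigcup_open => i _; exact: oF.
Qed.

HB.instance Definition _ := isOpenTopological.Build fintop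
  fintop_openT fintop_openI fintop_open_bigU.

End FiniteTopology.

(* For a group acting on V, having equal orbits is the orbit relation. *)
Section OrbitSpace.
Variables (C : numClosedFieldType) (V : lmodType C) (G : Type).
Variables (D : set G) (act : G -> V -> V).

Definition orbit_of (v : V) : set V := [set act g v | g in D].

Definition orbit_rel : rel (fintop V) :=
  fun u v => `[< orbit_of u = orbit_of v >].

Let orbit_rel_refl : reflexive orbit_rel.
Proof. by move=> u; exact/asboolP. Qed.

Let orbit_rel_sym : symmetric orbit_rel.
Proof. by move=> u v; apply/asboolP/asboolP. Qed.

Let orbit_rel_trans : transitive orbit_rel.
Proof. by move=> v u w /asboolP uv /asboolP vw; apply/asboolP; rewrite uv. Qed.

Canonical orbit_equiv :=
  EquivRel orbit_rel orbit_rel_refl orbit_rel_sym orbit_rel_trans.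

Definition orbit_space : topologicalType :=
  quotient_topology {eq_quot orbit_equiv}.

Definition orbit_proj (v : V) : orbit_space := \pi_{eq_quot orbit_equiv} v.

End OrbitSpace.

Section DependentProduct.
Variables (K : pzRingType) (I : Type) (V : I -> lmodType K).

Definition dprod : Type := forall i, V i.

HB.instance Definition _ := gen_eqMixin dprod.
HB.instance Definition _ := gen_choiceMixin dprod.

Let add (f g : dprod) : dprod := fun i => f i + g i.
Let opp (f : dprod) : dprod := fun i => - f i.
Let zero : dprod := fun i => 0.
Let scale (k : K) (f : dprod) : dprod := fun i => k *: f i.

Let addA : associative add.
Proof. by move=> f g h; apply: functional_extensionality_dep => i; exact: addrA. Qed.
Let addC : commutative add.
Proof. by move=> f g; apply: functional_extensionality_dep => i; exact: addrC. Qed.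
Let add0 : left_id zero add.
Proof. by move=> f; apply: functional_extensionality_dep => i; exact: add0r. Qed.
Let addN : left_inverse zero opp add.
Proof. by move=> f; apply: functional_extensionality_dep => i; exact: addNr. Qed.

HB.instance Definition _ := GRing.isZmodule.Build dprod addA addC add0 addN.

Let scaleA a b f : scale a (scale b f) = scale (a * b) f.
Proof. by apply: functional_extensionality_dep => i; exact: scalerA. Qed.
Let scale1 : left_id 1 scale.
Proof. by move=> f; apply: functional_extensionality_dep => i; exact: scale1r. Qed.
Let scaleDr : right_distributive scale +%R.
Proof. by move=> a f g; apply: functional_extensionality_dep => i; exact: scalerDr. Qed.
Let scaleDl f : {morph scale^~ f : a b / a + b}.
Proof. by move=> a b; apply: functional_extensionality_dep => i; exact: scalerDl. Qed.

HB.instance Definition _ :=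
  GRing.Zmodule_isLmodule.Build K dprod scaleA scale1 scaleDr scaleDl.

End DependentProduct.

Section AffineAlgebraicGroup.
Variables (C : fieldType) (T I : Type) (coord : I -> T -> C).
Variables (G : set T) (mul : T -> T -> T) (one : T).

Definition is_group (inv : T -> T) : Prop :=
  [/\ G one, forall a b, G a -> G b -> G (mul a b), forall a, G a -> G (inv a),
      forall a b c, G a -> G b -> G c -> mul a (mul b c) = mul (mul a b) c &
      forall a, G a -> [/\ mul one a = a, mul a one = a,
        mul (inv a) a = one & mul a (inv a) = one]].

(* In finitely many of the given coordinates (the others vanish on G), G is the
   locus Z = 0, delta != 0 of an affine space, and the group operations are
   given by polynomials divided by powers of delta. *)
Definition affine_algebraic_group : Prop :=
  exists (inv : T -> T) (N : nat) (e : 'I_N -> I)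
    (Z : set (mpoly N C)) (delta : mpoly N C),
  let phi (a : T) : 'I_N -> C := fun k => coord (e k) a in
  let dlt (a : T) : C := meval (phi a) delta in
  [/\ is_group inv,
    (forall a u, G a -> (forall k, e k <> u) -> coord u a = 0) /\
    (forall a b, G a -> G b -> phi a = phi b -> a = b),
    phi @` G = [set v | (forall f, Z f -> meval v f = 0) /\ meval v delta != 0],
    forall k, exists (d : nat) (f : mpoly (N + N) C), forall a b, G a -> G b ->
      (dlt a * dlt b) ^+ d * coord (e k) (mul a b) =
      meval (fun j => match fintype.split j with inl j => phi a j | inr j => phi b j end) f &
    forall k, exists (d : nat) (f : mpoly N C), forall a, G a ->
      dlt a ^+ d * coord (e k) (inv a) = meval (phi a) f].

End AffineAlgebraicGroup.

(* The complex projective line is handled through the cone C^2 \ {0}: an open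
   subset of P^1 is a C^*-stable open subset of the cone, and a section of a
   bundle (C^2 \ {0} x W) / C^* is an equivariant W-valued function. Functions
   are total on C^2; only their values on the relevant open sets matter. *)
Section ProjectiveLine.
Variable C : numClosedFieldType.
Local Notation X := 'rV[C]_2.

Definition p1_open (U : set X) :=
  [/\ open U, ~ U 0 & forall (x : X) (k : C), U x -> k != 0 -> U (k *: x)].

Definition p1_cover (U : X -> set X) :=
  (forall x, p1_open (U x)) /\ (forall x, x != 0 -> U x x).

Record fun_sheaf (W : lmodType C) := FunSheaf {
  sections :> set X -> set (X -> W);
  sections0 : forall U, sections U 0;
  sections_lin : forall U (k : C) f g,
    sections U f -> sections U g -> sections U (k *: f + g);
  sections_sub : forall U U' f, U' `<=` U -> sections U f -> sections U' f }.

(* Cech cohomology. Covers are indexed by the points of the cone: every open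
   cover of P^1 has such a refinement. A cochain is a cocycle (coboundary) if
   it restricts to a cocycle (coboundary) of some cover, so that cochains which
   agree on a finer cover differ by a coboundary and H1 is the direct limit
   over all open covers. *)
Section Cech.
Variables (W : lmodType C) (F : fun_sheaf W).

Definition cochain := X -> X -> X -> W.

Definition is_cocycle (c : cochain) :=
  exists U : X -> set X, [/\ p1_cover U,
    forall x y, F (U x `&` U y) (c x y) &
    forall x y z p, (U x `&` U y `&` U z) p ->
      c y z p - c x z p + c x y p = 0].

Definition is_coboundary (c : cochain) :=
  exists (U : X -> set X) (h : X -> X -> W), [/\ p1_cover U,
    forall x, F (U x) (h x) &
    forall x y p, (U x `&` U y) p -> c x y p = h y p - h x p].

Lemma p1_coverT : p1_cover (fun=> [set x | x != 0]).
Proof.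
split=> // _; split=> [| |x k /= x0 k0]; last by rewrite scaler_eq0 negb_or k0.
- rewrite (_ : [set x | _] = ~` [set (0 : X)]).
    apply: closed_openC; apply: accessible_closed_set1.
    by apply: hausdorff_accessible; exact: (@norm_hausdorff C X).
  by apply/seteqP; split=> x /eqP.
- by rewrite /= eqxx.
Qed.

Lemma p1_coverI U V : p1_cover U -> p1_cover V ->
  p1_cover (fun x => U x `&` V x).
Proof.
move=> [oU cU] [oV cV]; split=> x; last by move=> x0; split; [exact: cU|exact: cV].
have [oUx U0 Uk] := oU x; have [oVx V0 Vk] := oV x.
split; [exact: openI|by case|].
by move=> y k [Uy Vy] k0; split; [exact: Uk|exact: Vk].
Qed.

Definition cocycle_pred : {pred cochain} := [pred c | `[< is_cocycle c >]].

Lemma cocycle_submod : submod_closed cocycle_pred.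
Proof.
split=> [|k c d].
  apply/asboolP; exists (fun=> [set x | x != 0]); split; first exact: p1_coverT.
    by move=> x y; exact: sections0.
  by move=> *; rewrite /= subr0 addr0.
move=> /asboolP[U [cU sU zU]] /asboolP[V [cV sV zV]]; apply/asboolP.
exists (fun x => U x `&` V x); split; first exact: p1_coverI.
  move=> x y; apply: sections_lin.
    by apply: (sections_sub _ (sU x y)) => p [[? _] [? _]].
  by apply: (sections_sub _ (sV x y)) => p [[_ ?] [_ ?]].
move=> x y z p [[[Ux Vx] [Uy Vy]] [Uz Vz]].
have {}zU := zU x y z p (conj (conj Ux Uy) Uz).
have {}zV := zV x y z p (conj (conj Vx Vy) Vz).
rewrite !fctE -[RHS](addr0 0) -{2}zV -(scaler0 _ k) -zU scalerDr scalerBr.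
by rewrite [RHS]addrACA [X in _ = X + _]addrACA opprD.
Qed.

HB.instance Definition _ :=
  GRing.isSubmodClosed.Build C cochain cocycle_pred cocycle_submod.

Record cocycles := Cocycle {
  cocycle_val :> cochain; cocycle_valP : cocycle_val \in cocycle_pred }.

HB.instance Definition _ := [isSub for cocycle_val].
HB.instance Definition _ := [Choice of cocycles by <:].
HB.instance Definition _ := [SubChoice_isSubLmodule of cocycles by <:].

Definition coboundary_pred : {pred cocycles} :=
  [pred c : cocycles | `[< is_coboundary c >]].

Lemma coboundary_submod : submod_closed coboundary_pred.
Proof.
split=> [|k c d].
  apply/asboolP; exists (fun=> [set x | x != 0]), (fun=> 0).
  split; [exact: p1_coverT|by move=> x; exact: sections0|].
  by move=> *; rewrite /= subr0.
move=> /asboolP[U [g [cU sU zU]]] /asboolP[V [h [cV sV zV]]]; apply/asboolP.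
exists (fun x => U x `&` V x), (fun x => k *: g x + h x).
split; first exact: p1_coverI.
  move=> x; apply: sections_lin.
    by apply: (sections_sub _ (sU x)) => p [].
  by apply: (sections_sub _ (sV x)) => p [].
move=> x y p [[Ux Vx] [Uy Vy]].
have {}zU := zU x y p (conj Ux Uy).
have {}zV := zV x y p (conj Vx Vy).
rewrite -[LHS]/(k *: cocycle_val c x y p + cocycle_val d x y p).
by rewrite zU zV !fctE opprD addrACA scalerBr.
Qed.

HB.instance Definition _ :=
  GRing.isSubmodClosed.Build C cocycles coboundary_pred coboundary_submod.

Definition H1 : Type := Quotient.quot coboundary_pred.

HB.instance Definition _ := GRing.Zmodule.on H1.
HB.instance Definition _ := Quotient.on H1.

(* the class of a cochain; it is 0 if the cochain is not a cocycle *)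
Definition H1_class (c : cochain) : H1 := \pi_H1 (insubd (0 : cocycles) c).

Definition H1_repr (h : H1) : cochain := repr h : cocycles.

Definition H1_scale (k : C) (h : H1) : H1 := \pi_H1 (k *: repr h).

Lemma H1_scale_pi k (c : cocycles) : H1_scale k (\pi_H1 c) = \pi_H1 (k *: c).
Proof.
apply/eqP; rewrite /H1_scale -Quotient.idealrBE -scalerBr rpredZ //.
by rewrite Quotient.idealrBE reprK.
Qed.

Lemma H1_pi_add (c d : cocycles) : \pi_H1 (c + d) = \pi_H1 c + \pi_H1 d.
Proof. exact: Quotient.pi_add. Qed.

Lemma H1_scaleA a b h : H1_scale a (H1_scale b h) = H1_scale (a * b) h.
Proof. by rewrite [H1_scale b h]/H1_scale H1_scale_pi scalerA. Qed.

Lemma H1_scale1 : left_id 1 H1_scale.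
Proof. by move=> h; rewrite /H1_scale scale1r reprK. Qed.

Lemma H1_scaleDr : right_distributive H1_scale +%R.
Proof.
move=> a g h; rewrite -[g]reprK -[h]reprK -H1_pi_add !H1_scale_pi.
by rewrite scalerDr H1_pi_add.
Qed.

Lemma H1_scaleDl h : {morph H1_scale^~ h : a b / a + b}.
Proof.
by move=> a b; rewrite -[h]reprK !H1_scale_pi scalerDl H1_pi_add.
Qed.

HB.instance Definition _ := GRing.Zmodule_isLmodule.Build C H1
  H1_scaleA H1_scale1 H1_scaleDr H1_scaleDl.

End Cech.

Definition O_sections (k : int) (U : set X) : set (X -> C^o) :=
  [set f | (forall x, U x -> differentiable f x) /\
    forall x (a : C), U x -> a != 0 -> f (a *: x) = a ^ k * f x].

Lemma O_sections0 k U : O_sections k U 0.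
Proof.
split=> [x _|x a _ _]; first exact: (differentiable_cst (0 : C^o)).
by rewrite mulr0.
Qed.

Lemma O_sections_lin k U (a : C) f g :
  O_sections k U f -> O_sections k U g -> O_sections k U (a *: f + g).
Proof.
move=> [df hf] [dg hg]; split=> [x Ux|x b Ux b0].
  by apply: differentiableD; [exact: differentiableZ (df _ Ux)|exact: dg].
rewrite !fctE hf // hg // mulrDr; congr (_ + _).
by rewrite /GRing.scale /= mulrCA.
Qed.

Lemma O_sections_sub k U V f :
  V `<=` U -> O_sections k U f -> O_sections k V f.
Proof.
move=> VU [df hf]; split=> [x /VU|x a /VU Ux a0]; [exact: df|exact: hf].
Qed.

Definition OP1 (k : int) : fun_sheaf C^o :=
  FunSheaf (@O_sections0 k) (@O_sections_lin k) (@O_sections_sub k).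

(* 1 / (X_0 X_1) on {X_0 != 0} meet {X_1 != 0}, written on the cover which assigns
   to a point x the set {X_0 != 0} if it contains x, and {X_1 != 0} otherwise *)
Definition standard_cocycle : cochain C^o :=
  fun x y p => ((x 0 0 != 0)%:R - (y 0 0 != 0)%:R) / (p 0 0 * p 0 1).

(* The trace H^1(P^1, K) -> C of Serre duality, where K is identified with O(-2)
   through X_0 dX_1 - X_1 dX_0; the normalisation makes it unique. *)
Definition is_trace (t : {linear H1 (OP1 (-2)) -> C^o}) : Prop :=
  bijective t /\ t (H1_class (OP1 (-2)) standard_cocycle) = 1.

(* C[X_0, X_1]_k, with its elements seen as polynomials, and back (polynomials
   that are not homogeneous of degree k are sent to 0) *)
Local Notation poly2 := (mpoly 2 C).

Definition homog (k : int) : vectType C :=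
  match k with Posz d => dhomog 2 C d | Negz _ => 'rV[C]_0 end.

Definition homog_poly (k : int) : homog k -> poly2 :=
  match k with Posz d => fun p => mpoly_of_dhomog p | Negz _ => fun=> 0 end.

Definition to_homog (k : int) (p : poly2) : homog k :=
  match k with Posz d => indhomog d p | Negz _ => 0 end.

Definition is_homog (k : int) (p : poly2) : Prop := exists v, p = @homog_poly k v.

Definition eval_at (x : X) (p : poly2) : C := meval (fun i => x 0 i) p.

(* m_B : v |-> v B from C[X_0, X_1]_k^s to C[X_0, X_1]_l^t *)
Definition mulmap (k l : int) s t (B : 'M[poly2]_(s, t))
    (v : {ffun 'I_s -> homog k}) : {ffun 'I_t -> homog l} :=
  [ffun b => to_homog l (\sum_a homog_poly (v a) * B a b)].

Definition homog_dual (k : int) : vectType C := 'Hom(homog k, C^o).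

Definition dual_apply (k : int) s (Phi : {ffun 'I_s -> homog_dual k})
    (v : {ffun 'I_s -> homog k}) : C^o :=
  \sum_a (Phi a : 'Hom(homog k, C^o)) (v a).

(* the transpose of m_B, under the identification of (V^s)^* with (V^* )^s *)
Definition tr_mulmap (k l : int) s t (B : 'M[poly2]_(s, t))
    (Phi : {ffun 'I_t -> homog_dual l}) : {ffun 'I_s -> homog_dual k} :=
  [ffun a => linfun (fun p : homog k =>
     dual_apply Phi (mulmap l B [ffun a' => if a' == a then p else 0]))].

Section LinearisationType.
Variables (m : nat) (n : 'I_m -> int) (s : 'I_m -> nat).
Local Notation r := (\sum_i s i)%N.

(* sections of E = \bigoplus_i O(n_i)^{s_i} *)
Definition sum_O_sections (U : set X) : set (X -> 'cV[C]_r) :=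
  [set f | forall i (a : 'I_(s i)),
    O_sections (n i) U (fun x => submxcol (f x) i a 0)].

Lemma sum_O_sections0 U : sum_O_sections U 0.
Proof.
move=> i a; rewrite (_ : (fun x => _) = 0); first exact: O_sections0.
by apply/funext => x; rewrite submxcol0 mxE.
Qed.

Lemma sum_O_sections_lin U (k : C) f g :
  sum_O_sections U f -> sum_O_sections U g -> sum_O_sections U (k *: f + g).
Proof.
move=> sf sg i a; rewrite (_ : (fun x => _) = k *: (fun x => submxcol (f x) i a 0 : C^o)
  + (fun x => submxcol (g x) i a 0 : C^o)); first exact: O_sections_lin.
by apply/funext => x; rewrite !fctE !mxE.
Qed.

Lemma sum_O_sections_sub U V f : V `<=` U -> sum_O_sections U f -> sum_O_sections V f.
Proof. by move=> VU sf i a; exact: O_sections_sub VU (sf i a). Qed.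

Definition sum_O : fun_sheaf 'cV[C]_r :=
  FunSheaf sum_O_sections0 sum_O_sections_lin sum_O_sections_sub.

(* Automorphisms of the bundle: linear automorphisms of the fibres which, together with their inverses,
   carry holomorphic sections to holomorphic sections. The value at 0, which is
   not a point of the cone, is normalised to the identity. *)
Definition Aut_E : set (X -> 'M[C]_r) :=
  [set g | [/\ g 0 = 1%:M, forall x, g x \in unitmx &
    forall U f, p1_open U -> sum_O U f ->
      sum_O U (fun x => g x *m f x) /\
      sum_O U (fun x => invmx (g x) *m f x)]].

Definition H1_act (g : X -> 'M[C]_r) (h : H1 sum_O) : H1 sum_O :=
  H1_class sum_O (fun x y p => g p *m H1_repr h x y p).

Definition moduli_space : topologicalType := orbit_space Aut_E H1_act.
Definition moduli_proj : H1 sum_O -> moduli_space := orbit_proj Aut_E H1_act.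

Definition G_E : set 'M[poly2]_r :=
  [set A | (forall i j a b, is_homog (n i - n j) (submxblock A i j a b)) /\
    forall i, exists2 B : 'M[C]_(s i),
      B \in unitmx & submxblock A i i = map_mx (@mpolyC 2 C) B].

Definition G_to_Aut (A : 'M[poly2]_r) : X -> 'M[C]_r :=
  fun x => if x == 0 then 1%:M else map_mx (eval_at x) A.

Definition G_coord (u : 'I_r * 'I_r * multinom 2) (A : 'M[poly2]_r) : C :=
  mcoeff u.2 (A u.1.1 u.1.2).

Definition dual_sum : lmodType C :=
  dprod (fun i : 'I_m => {ffun 'I_(s i) -> homog_dual (-2 - n i)} : lmodType C).

Definition G_act (A : 'M[poly2]_r) (Phi : dual_sum) : dual_sum :=
  fun i => \sum_j tr_mulmap (-2 - n i) (submxblock A i j) (Phi j).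

Definition quotient_space : topologicalType := orbit_space G_E G_act.
Definition quotient_proj : dual_sum -> quotient_space := orbit_proj G_E G_act.

(* h |-> (v |-> t (v h)), for t : H^1(P^1, O(-2)) -> C *)
Definition serre_map (t : H1 (OP1 (-2)) -> C) (h : H1 sum_O) : dual_sum :=
  fun i => [ffun a => linfun (fun v : homog (-2 - n i) =>
    t (H1_class (OP1 (-2)) (fun x y p =>
         eval_at p (homog_poly v) * submxcol (H1_repr h x y p) i a 0)) : C^o)].

End LinearisationType.
End ProjectiveLine.

Arguments Aut_E C {m} n s.
Arguments G_E C {m} n s.
Arguments G_coord C {m} s u A.
Arguments G_to_Aut C {m} s A x.
Arguments G_act {C m} n s A Phi.
Arguments H1_act {C m} n s g h.
Arguments serre_map {C m} n s t h.
Arguments moduli_space C {m} n s.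
Arguments quotient_space C {m} n s.
Arguments moduli_proj {C m} n s h.
Arguments quotient_proj {C m} n s Phi.

(* Main.v *)
Require Import Defs.
From HB Require Import structures.
From mathcomp Require Import -(notations) mpoly.
From mathcomp Require Import all_boot all_order all_algebra.
From mathcomp Require Import all_classical all_reals all_analysis.
From mathcomp Require Import complex.
From mathcomp Require Import ring lra zify.
Set Implicit Arguments.
Unset Strict Implicit.
Unset Printing Implicit Defensive.
Import Order.TTheory GRing.Theory Num.Theory.
Import numFieldNormedType.Exports.
Local Open Scope classical_set_scope.
Local Open Scope ring_scope.

(** The heart of the matter is H^1(P^1, O(k)) and its pairing with C[X_0, X_1]_(-2-k).
   A cocycle on an arbitrary cover has a primitive on each of the two standard
   discs |x_1| < 8 |x_0| and |x_0| < 8 |x_1|. By bisection it suffices to merge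
   primitives on adjacent rectangles, and Cauchy's formula on a small rectangle
   around the common edge writes their difference as a difference of functions
   that are holomorphic on either side. Comparing the primitives of the two discs on
   an annulus and splitting off a finite Laurent tail shows that H^1 is spanned
   by the classes of the monomials X_0^a X_1^b with a, b < 0 and a + b = k. The monomials
   X_0^i X_1^j pair with them to the Kronecker delta, and 1 / (X_0 X_1) is not
   a coboundary since sections of O are constant; hence the Serre pairing is perfect.

   H^1 commutes with the finite sum E, and the Serre map is equivariant because
   multiplying a cocycle by A and then by a row of polynomials v is multiplying
   it by v A. A bundle automorphism has entries that are global sections of
   O(n_i - n_j), that is, homogeneous polynomials; its determinant is homogeneous of
   degree 0, so that it is invertible exactly when its constant, block diagonal
   part is. *)

(** [H1] is a limit over all covers, so a cocycle may live on an arbitrarily fine cover and cannot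
    simply be evaluated on the two charts: H^1 of a disc has to be shown to vanish for every cover.
    This is why the analysis uses rectangles, which can be bisected and glued edge to edge, and
    integrals along single edges. Infinite series are avoided: the geometric series of the inner
    Cauchy integral is cut off at order max(0, -k-1), where its remainder is already holomorphic in
    the other chart. The radii leave room for this: primitives on the discs of radius 8 give a
    function on 1/8 < |z| < 8, squares of half side 1/4 and 3 split it on 1/2 < |z| < 2, and the
    discs of radius 2 still cover P^1. On the algebraic side, multiplication by polynomials, by
    matrices, projections and inclusions are all fibrewise linear maps, whose action on H^1 is
    treated once. *)

(* the topology of R[i] is otherwise only found for an abstract numFieldType *)
HB.instance Definition _ (R : realType) := NormedModule.copy R[i] ((R[i] : numFieldType)^o).

(** * Contour integrals *)

Section ComplexModulus.
Variable R : realType.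
Local Notation C := R[i].
Implicit Types (z w : C) (r : R).

Definition modc (z : C) : R := complex.Re `|z|.

Lemma rcD (x y : R) : (x + y)%:C%C = x%:C%C + y%:C%C.
Proof. by congr Complex; rewrite addr0. Qed.

Lemma rcN (x : R) : (- x)%:C%C = - x%:C%C.
Proof. by congr Complex; rewrite oppr0. Qed.

Lemma rcB (x y : R) : (x - y)%:C%C = x%:C%C - y%:C%C.
Proof. by rewrite rcD rcN. Qed.

Lemma rcM (x y : R) : (x * y)%:C%C = x%:C%C * y%:C%C.
Proof. by apply/eqP; rewrite eq_complex /= !(mul0r, mulr0) subr0 addr0 !eqxx. Qed.

Lemma normE z : `|z| = (modc z)%:C%C.
Proof. by rewrite /modc; case: z => a b; rewrite normc_def. Qed.

Lemma modc_ge0 z : 0 <= modc z.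
Proof. by rewrite -lecR -normE normr_ge0. Qed.

Lemma modc0 : modc 0 = 0. Proof. by rewrite /modc normr0. Qed.
Lemma modc1 : modc 1 = 1. Proof. by rewrite /modc normr1. Qed.

Lemma modc_eq0 z : (modc z == 0) = (z == 0).
Proof. by rewrite -[RHS]normr_eq0 normE -(inj_eq (@complexI R)). Qed.

Lemma modc_gt0 z : (0 < modc z) = (z != 0).
Proof. by rewrite lt0r modc_eq0 modc_ge0 andbT. Qed.

Lemma modcM z w : modc (z * w) = modc z * modc w.
Proof. by apply: (@complexI R); rewrite rmorphM /= -!normE normrM. Qed.

Lemma modcV z : modc z^-1 = (modc z)^-1.
Proof. by apply: (@complexI R); rewrite fmorphV /= -!normE normfV. Qed.

Lemma modcX z n : modc (z ^+ n) = modc z ^+ n.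
Proof. by apply: (@complexI R); rewrite rmorphXn /= -!normE normrX. Qed.

Lemma modcN z : modc (- z) = modc z. Proof. by rewrite /modc normrN. Qed.

Lemma modcB z w : modc (z - w) = modc (w - z). Proof. by rewrite /modc distrC. Qed.

Lemma modcD z w : modc (z + w) <= modc z + modc w.
Proof. by rewrite -lecR rmorphD /= -!normE ler_normD. Qed.

Lemma modc_real r : modc r%:C%C = `|r|.
Proof. by rewrite /modc normc_def /= expr0n /= addr0 sqrtr_sqr. Qed.

Lemma Re_le_modc z : `|complex.Re z| <= modc z.
Proof. by rewrite -lecR -normE normc_ge_Re. Qed.

Lemma modcMi z : modc ('i%C * z) = modc z.
Proof. by rewrite modcM /modc normc_def /= expr0n add0r expr1n sqrtr1 mul1r. Qed.

Lemma Im_le_modc z : `|complex.Im z| <= modc z.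
Proof. by rewrite -modcMi; apply: le_trans (Re_le_modc _); case: z => a b /=; rewrite !(mul0r,mul1r) sub0r normrN. Qed.

Lemma modc_le z : modc z <= `|complex.Re z| + `|complex.Im z|.
Proof.
rewrite {1}[z]complexE; apply: le_trans (modcD _ _) _.
by rewrite modcMi !modc_real.
Qed.

(** A positive element of [R[i]] is real, so every radius may be taken in [R]. *)
Lemma nearC z (P : set C) :
  (\forall w \near z, P w) <-> exists2 d : R, 0 < d & forall w, modc (w - z) < d -> P w.
Proof.
split.
  move=> /nbhs_ballP[e /= e0 eP]; have [er ee] : 0 < complex.Re e /\ e = (complex.Re e)%:C%C.
    by move: e0; case: e {eP} => a b; rewrite ltcE /= => /andP[/eqP-> a0].
  exists (complex.Re e) => // w wz; apply: eP; rewrite -ball_normE /= distrC ee normE.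
  by rewrite ltcR.
move=> [d d0 dP]; apply/nbhs_ballP; exists d%:C%C => /=; first by rewrite ltcR.
by move=> w; rewrite -ball_normE /= distrC normE ltcR; exact: dP.
Qed.

Lemma contCP (f : C -> C) z : {for z, continuous f} <->
  forall e : R, 0 < e -> exists2 d : R, 0 < d &
    forall w, modc (w - z) < d -> modc (f w - f z) < e.
Proof.
split.
  move=> /cvgrPdist_lt fz e e0.
  have /nearC[d d0 dP] := fz e%:C%C ltac:(by rewrite ltcR).
  by exists d => // w /dP; rewrite distrC normE ltcR.
move=> fz; apply/(cvgrPdist_lt (F := nbhs z)) => e e0.
have [er ee] : 0 < complex.Re e /\ e = (complex.Re e)%:C%C.
  by move: e0; case: e => a b; rewrite ltcE /= => /andP[/eqP-> a0].
apply/nearC; have [d d0 dP] := fz _ er.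
by exists d => // w /dP; rewrite distrC normE ee ltcR.
Qed.

(** Bounding the remainder by e |w - z| instead of a difference quotient by e makes w = z
    harmless. *)
Lemma cdiffP (f : C -> C) z : differentiable f z <->
  exists l : C, forall e : R, 0 < e -> exists2 d : R, 0 < d &
    forall w, modc (w - z) < d -> modc (f w - f z - l * (w - z)) <= e * modc (w - z).
Proof.
split.
  move=> /derivable1_diffP/cvg_ex[l /cvgrPdist_le fl]; exists l => e e0.
  have := fl e%:C%C ltac:(by rewrite ltcR).
  rewrite near_withinE => /nearC[d d0 dP]; exists d => // w wz.
  have [->|wz0] := eqVneq w z; first by rewrite !subrr mulr0 subrr modc0 mulr0.
  have nz : w - z != 0 by rewrite subr_eq0.
  have := dP (w - z); rewrite subr0 => /(_ wz nz).
  rewrite /GRing.scale /= mulr1 subrK distrC normE lecR => H.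
  apply: le_trans (ler_wpM2r (modc_ge0 _) H).
  rewrite -modcM mulrBl (mulrC _^-1) mulfVK //.
move=> [l fl]; apply/derivable1_diffP/cvg_ex; exists l; apply/cvgrPdist_le => e e0.
have [er ee] : 0 < complex.Re e /\ e = (complex.Re e)%:C%C.
  by move: e0; case: e => a b; rewrite ltcE /= => /andP[/eqP-> a0].
have [d d0 dP] := fl _ er.
rewrite near_withinE; apply/nearC; exists d => // h; rewrite subr0 => hd h0.
have := dP (h + z); rewrite addrK => /(_ hd) H.
rewrite /GRing.scale /= mulr1 distrC ee normE lecR.
by rewrite -(ler_pM2r (_ : 0 < modc h)) ?modc_gt0 // -modcM mulrBl (mulrC _^-1) mulfVK.
Qed.

End ComplexModulus.

Section SegmentIntegral.
Variable R : realType.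
Local Notation C := R[i].
Local Notation mu := (@lebesgue_measure R).
Implicit Types (a b c t : R) (f g : R -> C) (u : C).

(** Continuity is two-sided even at the end points, so sums and products are handled without
    subspace topologies. *)
Definition seg_cont a b f := forall t, a <= t <= b -> {for t, continuous f}.

Definition cint a b f : C :=
  Complex (\int[mu]_(t in `[a, b]) complex.Re (f t))
          (\int[mu]_(t in `[a, b]) complex.Im (f t)).

Lemma ReD (u v : C) : complex.Re (u + v) = complex.Re u + complex.Re v.
Proof. by case: u; case: v. Qed.

Lemma ImD (u v : C) : complex.Im (u + v) = complex.Im u + complex.Im v.
Proof. by case: u; case: v. Qed.

Lemma contRCP f t : {for t, continuous f} <->
  forall e : R, 0 < e -> exists2 d : R, 0 < d &
    forall s, `|s - t| < d -> modc (f s - f t) < e.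
Proof.
split.
  move=> /cvgrPdist_lt ft e e0.
  have /nbhs_ballP[d /= d0 dP] := ft e%:C%C ltac:(by rewrite ltcR).
  exists d => // s st; have := dP s; rewrite -ball_normE /= distrC => /(_ st).
  by rewrite distrC normE ltcR.
move=> ft; apply/(cvgrPdist_lt (F := nbhs t)) => e e0.
have [er ee] : 0 < complex.Re e /\ e = (complex.Re e)%:C%C.
  by move: e0; case: e => x y; rewrite ltcE /= => /andP[/eqP-> x0].
have [d d0 dP] := ft _ er; apply/nbhs_ballP; exists d => //= s.
by rewrite -ball_normE /= distrC => /dP; rewrite distrC normE ee ltcR.
Qed.

Lemma continuous_Re f t : {for t, continuous f} -> {for t, continuous (fun s => complex.Re (f s))}.
Proof.
move=> /contRCP ft; apply/(cvgrPdist_lt (F := nbhs t)) => e e0; have [d d0 dP] := ft e e0.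
apply/nbhs_ballP; exists d => //= s; rewrite -ball_normE /= distrC => /dP.
by apply: le_lt_trans; rewrite distrC -raddfB Re_le_modc.
Qed.

Lemma continuous_Im f t : {for t, continuous f} -> {for t, continuous (fun s => complex.Im (f s))}.
Proof.
move=> /contRCP ft; apply/(cvgrPdist_lt (F := nbhs t)) => e e0; have [d d0 dP] := ft e e0.
apply/nbhs_ballP; exists d => //= s; rewrite -ball_normE /= distrC => /dP.
by apply: le_lt_trans; rewrite distrC -raddfB Im_le_modc.
Qed.

Lemma seg_within (h : R -> R) a b : (forall t, a <= t <= b -> {for t, continuous h}) ->
  {within `[a, b], continuous h}.
Proof.
by move=> hc; apply: continuous_in_subspaceT => t; rewrite inE /= in_itv /=; exact: hc.
Qed.

Lemma seg_integrable (h : R -> R) a b : (forall t, a <= t <= b -> {for t, continuous h}) ->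
  mu.-integrable `[a, b] (EFin \o h).
Proof.
move=> hc; apply: continuous_compact_integrable; first exact: segment_compact.
exact: seg_within.
Qed.

Lemma seg_integrable_Re f a b : seg_cont a b f ->
  mu.-integrable `[a, b] (EFin \o (fun t => complex.Re (f t))).
Proof. by move=> fc; apply: seg_integrable => t /fc; exact: continuous_Re. Qed.

Lemma seg_integrable_Im f a b : seg_cont a b f ->
  mu.-integrable `[a, b] (EFin \o (fun t => complex.Im (f t))).
Proof. by move=> fc; apply: seg_integrable => t /fc; exact: continuous_Im. Qed.

Lemma eq_cint a b f g : (forall t, a <= t <= b -> f t = g t) -> cint a b f = cint a b g.
Proof.
move=> fg; rewrite /cint; congr Complex; apply: eq_Rintegral => t;
  by rewrite inE /= in_itv /= => /fg ->.
Qed.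

Lemma cintD a b f g : seg_cont a b f -> seg_cont a b g ->
  cint a b (fun t => f t + g t) = cint a b f + cint a b g.
Proof.
move=> fc gc; rewrite /cint; apply/eqP; rewrite eq_complex /=; apply/andP; split; apply/eqP.
  under eq_Rintegral do rewrite ReD.
  by rewrite RintegralD //; exact: seg_integrable_Re.
under eq_Rintegral do rewrite ImD.
by rewrite RintegralD //; exact: seg_integrable_Im.
Qed.

Lemma cintZ a b f u : seg_cont a b f -> cint a b (fun t => u * f t) = u * cint a b f.
Proof.
move=> fc; rewrite /cint.
have iR := seg_integrable_Re fc; have iI := seg_integrable_Im fc.
have ZR r : mu.-integrable `[a, b] (EFin \o (fun t => r * complex.Re (f t))).
  by apply: seg_integrable => t /fc/continuous_Re; apply: continuousM; exact: cst_continuous.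
have ZI r : mu.-integrable `[a, b] (EFin \o (fun t => r * complex.Im (f t))).
  by apply: seg_integrable => t /fc/continuous_Im; apply: continuousM; exact: cst_continuous.
case: u => x y.
have eR t : complex.Re ((x +i* y)%C * f t) = x * complex.Re (f t) - y * complex.Im (f t).
  by case: (f t).
have eI t : complex.Im ((x +i* y)%C * f t) = x * complex.Im (f t) + y * complex.Re (f t).
  by case: (f t).
apply/eqP; rewrite eq_complex /=; apply/andP; split; apply/eqP.
  under eq_Rintegral do rewrite eR.
  by rewrite RintegralB ?RintegralZl.
under eq_Rintegral do rewrite eI.
by rewrite RintegralD ?RintegralZl.
Qed.

Lemma cintN a b f : seg_cont a b f -> cint a b (fun t => - f t) = - cint a b f.
Proof.
move=> fc; rewrite -mulN1r -cintZ //; apply: eq_cint => t _; by rewrite mulN1r.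
Qed.

Lemma cint_cat a b c f : a <= b -> b <= c -> seg_cont a c f ->
  cint a c f = cint a b f + cint b c f.
Proof.
move=> ab bc fc; have iR := seg_integrable_Re fc; have iI := seg_integrable_Im fc.
have cat (h : R -> R) : mu.-integrable `[a, c] (EFin \o h) ->
    \int[mu]_(t in `[a, c]) h t = \int[mu]_(t in `[a, b]) h t + \int[mu]_(t in `[b, c]) h t.
  move=> hi; have := Rintegral_itvB (x := b) hi.
  rewrite !bnd_simp => /(_ ab bc) hB.
  rewrite -(Rintegral_itv_obnd_cbnd (r := b)); last first.
    apply: integrableS hi => //= x /=; rewrite !in_itv /= => /andP[x1 ->].
    by rewrite andbT (le_trans ab) // ltW.
  by rewrite -hB addrC subrK.
by rewrite /cint (cat _ iR) (cat _ iI).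
Qed.

Lemma Rint_cst a b r : a <= b -> \int[mu]_(t in `[a, b]) r = r * (b - a).
Proof.
move=> ab; rewrite Rintegral_cst //; congr (_ * _).
apply: etrans (congr1 fine (lebesgue_measure_itv `[a, b])) _; rewrite /= lte_fin.
by case: ltP => //= ba; rewrite (le_anti (introT andP (conj ab ba))) subrr.
Qed.

(** The factor 2 is the price of estimating real and imaginary parts separately. *)
Lemma cint_bound a b f (M : R) : a <= b -> seg_cont a b f ->
  (forall t, a <= t <= b -> modc (f t) <= M) -> modc (cint a b f) <= 2 * M * (b - a).
Proof.
move=> ab fc fM.
have bnd (h : R -> R) : mu.-integrable `[a, b] (EFin \o h) ->
    (forall t, a <= t <= b -> `|h t| <= M) -> `|\int[mu]_(t in `[a, b]) h t| <= M * (b - a).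
  move=> hi hM; apply: le_trans (le_normr_Rintegral _ hi) _ => //.
  rewrite -Rint_cst //.
  apply: le_Rintegral => //.
    exact: (integrable_norm hi).
  by apply: seg_integrable => t _; exact: cst_continuous.
apply: le_trans (modc_le _) _; rewrite -mulrA mulr_natl mulr2n; apply: lerD.
  by apply: bnd; [exact: seg_integrable_Re|move=> t /fM; apply: le_trans; exact: Re_le_modc].
by apply: bnd; [exact: seg_integrable_Im|move=> t /fM; apply: le_trans; exact: Im_le_modc].
Qed.

Lemma cint_cst a b u : a <= b -> cint a b (fun=> u) = (b - a)%:C%C * u.
Proof.
move=> ab; rewrite /cint !Rint_cst //; case: u => x y; apply/eqP; rewrite eq_complex /=.
by rewrite !mul0r addr0 subr0 ![_ * (b - a)]mulrC !eqxx.
Qed.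

Lemma cint_FTC a b f (F : R -> R) (G : R -> R) : a < b -> seg_cont a b f ->
  (forall t, a <= t <= b -> is_derive t 1 F (complex.Re (f t))) ->
  (forall t, a <= t <= b -> is_derive t 1 G (complex.Im (f t))) ->
  cint a b f = Complex (F b - F a) (G b - G a).
Proof.
move=> ab fc FD GD.
have ftc (h H : R -> R) : (forall t, a <= t <= b -> {for t, continuous h}) ->
    (forall t, a <= t <= b -> is_derive t 1 H (h t)) ->
    \int[mu]_(t in `[a, b]) h t = H b - H a.
  move=> hc HD; rewrite /Rintegral (continuous_FTC2 ab (seg_within hc) (F := H)) //.
    have Hc t : a <= t <= b -> {for t, continuous H}.
      by move=> /HD [Hd _]; apply: differentiable_continuous; exact/derivable1_diffP.
    split.
    - by move=> t; rewrite in_itv /= => /andP[t1 t2]; have [] := HD t; rewrite ?ltW.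
    - by apply: cvg_at_right_filter; apply: Hc; rewrite lexx ltW.
    - by apply: cvg_at_left_filter; apply: Hc; rewrite lexx ltW.
  move=> t; rewrite in_itv /= => /andP[t1 t2]; rewrite derive1E.
  by have [] := HD t; rewrite ?ltW.
by rewrite /cint (ftc _ _ _ FD) ?(ftc _ _ _ GD) // => t /fc; [exact: continuous_Im|exact: continuous_Re].
Qed.

Lemma cint_id a b : a <= b -> cint a b (fun t => t%:C%C) = ((b ^+ 2 - a ^+ 2) / 2)%:C%C.
Proof.
rewrite le_eqVlt => /orP[/eqP->|ab].
  rewrite subrr mul0r; apply/eqP; rewrite eq_complex /cint /=.
  by rewrite set_itv1 !Rintegral_set1 !eqxx.
have D t : is_derive t 1 (fun t : R => t ^+ 2 / 2) t.
  rewrite (_ : (fun _ => _) = 2^-1 *: (@id R) ^+ 2); last first.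
    by apply/funext => x; rewrite fctE /GRing.scale /= mulrC.
  apply: is_derive_eq; rewrite /GRing.scale /= mulr1 expr1 -mulr_natl; lra.
have D0 t : is_derive t 1 (fun=> 0 : R) 0 by exact: is_derive_cst.
have c t : {for t, continuous (fun t : R => t%:C%C)}.
  by apply/contRCP => e e0; exists e => // s; rewrite -raddfB modc_real.
rewrite (@cint_FTC _ _ _ _ _ ab (fun t _ => c t) (fun t _ => D t) (fun t _ => D0 t)).
by rewrite subrr; congr (_ +i* _)%C; lra.
Qed.

Lemma cint_shift a b (r : R) f : a <= b -> seg_cont (a + r) (b + r) f ->
  cint (a + r) (b + r) f = cint a b (fun t => f (t + r)).
Proof.
move=> ab fc.
have D t : is_derive t 1 (fun t : R => t + r) 1.
  by apply: is_derive_eq; rewrite addr0.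
have dE : (fun t : R => t + r)^`()%classic = cst 1.
  by apply/funext => t; rewrite derive1E; have [_ ->] := D t.
have sub (h : R -> R) : (forall t, a + r <= t <= b + r -> {for t, continuous h}) ->
    \int[mu]_(t in `[a + r, b + r]) h t = \int[mu]_(t in `[a, b]) h (t + r).
  move=> hc; rewrite /Rintegral.
  rewrite (@integration_by_substitution_increasing R (fun t => t + r) h a b ab).
  - congr fine; apply: eq_integral => t _ /=.
    by rewrite dE fctE mulr1.
  - by move=> x y _ _; rewrite ltrD2r.
  - by rewrite dE => t _; exact: cst_continuous.
  - by rewrite dE; exact: is_cvg_cst.
  - by rewrite dE; exact: is_cvg_cst.
  - have Hc t : {for t, continuous (fun t : R => t + r)}.
      by apply: differentiable_continuous; apply/derivable1_diffP; have [] := D t.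
    split.
    + by move=> t _; have [] := D t.
    + by apply: cvg_at_right_filter; exact: Hc.
    + by apply: cvg_at_left_filter; exact: Hc.
  - exact: seg_within.
by rewrite /cint !sub // => t /fc; [exact: continuous_Im|exact: continuous_Re].
Qed.

Lemma cint_Im_gt0 a b (m : R) f : a < b -> seg_cont a b f -> 0 < m ->
  (forall t, a <= t <= b -> m <= complex.Im (f t)) -> 0 < complex.Im (cint a b f).
Proof.
move=> ab fc m0 fm; apply: (@lt_le_trans _ _ (\int[mu]_(t in `[a, b]) m)).
  by rewrite Rint_cst ?ltW // mulr_gt0 // subr_gt0.
apply: le_Rintegral => //; last exact: seg_integrable_Im.
by apply: seg_integrable => t _; exact: cst_continuous.
Qed.

End SegmentIntegral.

Section RectangleIntegral.
Variable R : realType.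
Local Notation C := R[i].
Implicit Types (a b c d x y t : R) (f g : C -> C) (u z w : C).

Definition rcont a b c d f :=
  forall x y, a <= x <= b -> c <= y <= d -> {for (x +i* y)%C, continuous f}.

(** Only the boundary is constrained, because Cauchy kernels have their pole inside the
    rectangle. *)
Definition bcont a b c d f := forall x y, a <= x <= b -> c <= y <= d ->
  [|| x == a, x == b, y == c | y == d] -> {for (x +i* y)%C, continuous f}.

Lemma rcont_b a b c d f : rcont a b c d f -> bcont a b c d f.
Proof. by move=> fc x y xab ycd _; exact: fc. Qed.

(** The counterclockwise integral of f(w) dw along the boundary; the factor i is dw/dt on the
    vertical edges. *)
Definition rint a b c d f : C :=
  (cint a b (fun t => f (t +i* c)%C) - cint a b (fun t => f (t +i* d)%C)) +
  'i%C * (cint c d (fun t => f (b +i* t)%C) - cint c d (fun t => f (a +i* t)%C)).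

Lemma seg_cont_h a b y f : (forall x, a <= x <= b -> {for (x +i* y)%C, continuous f}) ->
  seg_cont a b (fun t => f (t +i* y)%C).
Proof.
move=> fc t /fc/contCP ft; apply/contRCP => e /ft[d d0 dP]; exists d => // s st.
by apply: dP; rewrite (_ : _ - _ = (s - t)%:C%C) ?modc_real //; congr Complex; rewrite subrr.
Qed.

Lemma modci x : modc (0 +i* x)%C = `|x|.
Proof. by rewrite -[RHS]modc_real -[RHS]modcMi; congr modc; rewrite /GRing.mul /=; congr Complex; ring. Qed.

Lemma seg_cont_v a b x f : (forall y, a <= y <= b -> {for (x +i* y)%C, continuous f}) ->
  seg_cont a b (fun t => f (x +i* t)%C).
Proof.
move=> fc t /fc/contCP ft; apply/contRCP => e /ft[d d0 dP]; exists d => // s st.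
by apply: dP; rewrite (_ : _ - _ = (0 +i* (s - t))%C) ?modci //; congr Complex; rewrite subrr.
Qed.

Lemma rcontS a b c d a' b' c' d' f : a <= a' -> b' <= b -> c <= c' -> d' <= d ->
  rcont a b c d f -> rcont a' b' c' d' f.
Proof.
move=> aa bb cc dd fc x y /andP[x1 x2] /andP[y1 y2].
by apply: fc; apply/andP; split; lra.
Qed.

Section Edges.
Variables (a b c d : R) (ab : a <= b) (cd : c <= d) (f : C -> C) (fc : bcont a b c d f).
Lemma bcont_bot : seg_cont a b (fun t => f (t +i* c)%C).
Proof. by apply: seg_cont_h => x xab; apply: fc; rewrite ?lexx ?eqxx ?orbT. Qed.
Lemma bcont_top : seg_cont a b (fun t => f (t +i* d)%C).
Proof. by apply: seg_cont_h => x xab; apply: fc; rewrite ?lexx ?andbT ?eqxx ?orbT. Qed.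
Lemma bcont_left : seg_cont c d (fun t => f (a +i* t)%C).
Proof. by apply: seg_cont_v => x xab; apply: fc; rewrite ?lexx ?eqxx ?orbT. Qed.
Lemma bcont_right : seg_cont c d (fun t => f (b +i* t)%C).
Proof. by apply: seg_cont_v => x xab; apply: fc; rewrite ?lexx ?andbT ?eqxx ?orbT. Qed.
End Edges.

Lemma rint_bound a b c d f (M : R) : a <= b -> c <= d -> bcont a b c d f ->
  (forall x y, a <= x <= b -> c <= y <= d -> [|| x == a, x == b, y == c | y == d] ->
     modc (f (x +i* y)%C) <= M) ->
  modc (rint a b c d f) <= 4 * M * ((b - a) + (d - c)).
Proof.
move=> ab cd fc fM; rewrite /rint.
have H1 := cint_bound ab (bcont_bot cd fc) (fun t tab => fM t c tab ltac:(by rewrite lexx) ltac:(by rewrite eqxx ?orbT)).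
have H2 := cint_bound ab (bcont_top cd fc) (fun t tab => fM t d tab ltac:(by rewrite lexx andbT) ltac:(by rewrite eqxx ?orbT)).
have H3 := cint_bound cd (bcont_right ab fc) (fun t tab => fM b t ltac:(by rewrite lexx andbT) tab ltac:(by rewrite eqxx ?orbT)).
have H4 := cint_bound cd (bcont_left ab fc) (fun t tab => fM a t ltac:(by rewrite lexx) tab ltac:(by rewrite eqxx ?orbT)).
apply: le_trans (modcD _ _) _; rewrite modcMi.
have := modcD (cint a b (fun t => f (t +i* c)%C)) (- cint a b (fun t => f (t +i* d)%C)).
have := modcD (cint c d (fun t => f (b +i* t)%C)) (- cint c d (fun t => f (a +i* t)%C)).
rewrite !modcN; lra.
Qed.

(** The two integrals along the common edge cancel as terms, so continuity is asked for on the outer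
    boundary alone. *)
Lemma rint_catH a m b c d f : a <= m -> m <= b -> c <= d -> bcont a b c d f ->
  rint a b c d f = rint a m c d f + rint m b c d f.
Proof.
move=> am mb cd fc; have ab := le_trans am mb.
rewrite /rint (cint_cat am mb (bcont_bot cd fc)) (cint_cat am mb (bcont_top cd fc)).
ring.
Qed.

Lemma rint_catV a b c m d f : a <= b -> c <= m -> m <= d -> bcont a b c d f ->
  rint a b c d f = rint a b c m f + rint a b m d f.
Proof.
move=> ab cm md fc; have cd := le_trans cm md.
rewrite /rint (cint_cat cm md (bcont_left ab fc)) (cint_cat cm md (bcont_right ab fc)).
ring.
Qed.

Lemma rintD a b c d f g : a <= b -> c <= d -> bcont a b c d f -> bcont a b c d g ->
  rint a b c d (fun w => f w + g w) = rint a b c d f + rint a b c d g.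
Proof.
move=> ab cd fc gc; rewrite /rint.
rewrite (cintD (bcont_bot cd fc) (bcont_bot cd gc)) (cintD (bcont_top cd fc) (bcont_top cd gc)).
rewrite (cintD (bcont_left ab fc) (bcont_left ab gc)) (cintD (bcont_right ab fc) (bcont_right ab gc)).
ring.
Qed.

Lemma rintZ a b c d f u : a <= b -> c <= d -> bcont a b c d f ->
  rint a b c d (fun w => u * f w) = u * rint a b c d f.
Proof.
move=> ab cd fc; rewrite /rint.
rewrite (cintZ _ (bcont_bot cd fc)) (cintZ _ (bcont_top cd fc)).
rewrite (cintZ _ (bcont_left ab fc)) (cintZ _ (bcont_right ab fc)).
ring.
Qed.

Lemma eq_rint a b c d f g : a <= b -> c <= d ->
  (forall x y, a <= x <= b -> c <= y <= d ->
     [|| x == a, x == b, y == c | y == d] -> f (x +i* y)%C = g (x +i* y)%C) ->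
  rint a b c d f = rint a b c d g.
Proof.
move=> ab cd fg; rewrite /rint; congr (_ - _ + _ * (_ - _)); apply: eq_cint => t tt; apply: fg;
  by rewrite ?lexx ?andbT ?eqxx ?orbT.
Qed.

(** In [goursat] this removes the first order expansion of f from the integral. *)
Lemma rint_affine a b c d u z : a <= b -> c <= d ->
  rint a b c d (fun w => u + z * w) = 0.
Proof.
move=> ab cd.
have cc r s v : seg_cont r s (fun=> v : C) by move=> t _; exact: cst_continuous.
have ci r s v : seg_cont r s (fun t => v * t%:C%C : C).
  move=> t _; apply/contRCP => e e0; have v0 : 0 < modc v + 1 by rewrite ltr_wpDl ?modc_ge0.
  exists (e / (modc v + 1)); first by rewrite divr_gt0.
  move=> w wt; rewrite -mulrBr modcM -raddfB modc_real.
  apply: (@le_lt_trans _ _ ((modc v + 1) * `|w - t|)); first by rewrite ler_wpM2r // lerDl.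
  by rewrite mulrC -ltr_pdivlMr.
have c1 r s : seg_cont r s (fun t => t%:C%C : C).
  by rewrite (_ : (fun t => _) = (fun t => 1 * t%:C%C : C)) //; apply/funext => t; rewrite mul1r.
have h r s y : r <= s -> cint r s (fun t => u + z * (t +i* y)%C) =
    (s - r)%:C%C * (u + z * (0 +i* y)%C) + z * ((s ^+ 2 - r ^+ 2) / 2)%:C%C.
  move=> rs; rewrite -(cint_cst _ rs) -(cint_id rs) -(cintZ _ (c1 _ _)) -cintD //.
  apply: eq_cint => t _; rewrite -addrA -mulrDr; congr (_ + _ * _).
  by rewrite /GRing.add /=; congr Complex; ring.
have v r s x : r <= s -> cint r s (fun t => u + z * (x +i* t)%C) =
    (s - r)%:C%C * (u + z * x%:C%C) + z * 'i%C * ((s ^+ 2 - r ^+ 2) / 2)%:C%C.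
  move=> rs; rewrite -(cint_cst _ rs) -(cint_id rs) -(cintZ _ (c1 _ _)) -cintD //.
  apply: eq_cint => t _; rewrite -addrA -mulrA -mulrDr; congr (_ + _ * _).
  by rewrite /GRing.add /GRing.mul /=; congr Complex; ring.
rewrite /rint !h // !v //.
have e y : (0 +i* y)%C = 'i%C * y%:C%C by rewrite /GRing.mul /=; congr Complex; ring.
have sq (r s : R) : ((s ^+ 2 - r ^+ 2) / 2)%:C%C = (s%:C%C ^+ 2 - r%:C%C ^+ 2) * (2^-1)%:C%C.
  by rewrite !expr2 rcM rcB !rcM.
have i2 : 'i%C * 'i%C = -1 :> C 
  by apply/eqP; rewrite eq_complex /= !(mul0r, mulr0, mul1r, mulr1) sub0r addr0 oppr0 !eqxx.
rewrite (e c) (e d) !sq !rcB.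
move: (a%:C%C) (b%:C%C) (c%:C%C) (d%:C%C) (2^-1)%:C%C i2 => A B D E h2.
move: 'i%C => I I2.
ring: I2.
Qed.

End RectangleIntegral.

(** * Cauchy's theorem and formula *)

Section Goursat.
Variable R : realType.
Local Notation C := R[i].
Implicit Types (a b c d x y t : R) (f g : C -> C).

Local Notation lam n := ((2^-1 : R) ^+ n).

Lemma lam_gt0 n : 0 < lam n. Proof. by rewrite exprn_gt0 // invr_gt0. Qed.

Lemma lam_small (e : R) : 0 < e -> exists n, lam n < e.
Proof.
move=> e0; have [n ne] : exists n : nat, e^-1 < n%:R.
  by exists (Num.truncn e^-1).+1; rewrite truncnS_gt.
exists n; rewrite exprVn -ltf_pV2 ?posrE ?invr_gt0 ?exprn_gt0 // invrK.
by apply: lt_trans ne _; rewrite -natrX ltr_nat ltn_expl.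
Qed.

(** The supremum of the left ends lies below every right end. *)
Lemma nested_intervals (L : nat -> R) (D : R) :
  (forall n, L n <= L n.+1 /\ L n.+1 + lam n.+1 * D <= L n + lam n * D) -> 0 <= D ->
  exists x, forall n, L n <= x <= L n + lam n * D.
Proof.
move=> Ls D0; have lD n : 0 <= lam n * D by rewrite mulr_ge0 // ltW // lam_gt0.
have up m k : L m <= L (m + k)%N /\ L (m + k)%N + lam (m + k)%N * D <= L m + lam m * D.
  elim: k => [|k [IH1 IH2]]; first by rewrite addn0.
  have [h1 h2] := Ls (m + k)%N; rewrite addnS; split; first exact: le_trans h1.
  exact: le_trans IH2.
have mn m n : L m <= L n + lam n * D.
  have [/subnKC <-|/ltnW/subnKC <-] := leqP m n.
    by have [h _] := up m (n - m)%N; have := lD (m + (n - m))%N; lra.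
  by have [_ h] := up n (m - n)%N; have := lD (n + (m - n))%N; lra.
have sL : has_sup (range L).
  by split; [exists (L 0%N); exists 0%N|exists (L 0%N + lam 0%N * D) => _ [m _ <-]].
exists (sup (range L)) => n; apply/andP; split.
  by apply: sup_upper_bound => //; exists n.
by apply: ge_sup; [case: sL|move=> _ [m _ <-]].
Qed.

(* Only rectangles similar to the given one are used in the local hypothesis,
   so that their diameter squared is controlled by their area. *)
Lemma rect_cousin (P : R -> R -> R -> R -> Prop) a b c d : a < b -> c < d ->
  (forall x y z c' d', a <= x -> x < y -> y < z -> z <= b -> c <= c' -> c' < d' -> d' <= d ->
     P x y c' d' -> P y z c' d' -> P x z c' d') ->
  (forall a' b' x y z, a <= a' -> a' < b' -> b' <= b -> c <= x -> x < y -> y < z -> z <= d ->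
     P a' b' x y -> P a' b' y z -> P a' b' x z) ->
  (forall x y, a <= x <= b -> c <= y <= d -> exists2 e : R, 0 < e &
     forall l a' c', 0 < l -> l < e -> a <= a' -> a' + l * (b - a) <= b ->
       c <= c' -> c' + l * (d - c) <= d ->
       a' <= x <= a' + l * (b - a) -> c' <= y <= c' + l * (d - c) ->
       P a' (a' + l * (b - a)) c' (c' + l * (d - c))) ->
  P a b c d.
Proof.
move=> ab cd mH mV loc; apply: contrapT => nP.
set D1 := b - a; set D2 := d - c.
have D1p : 0 < D1 by rewrite subr_gt0.
have D2p : 0 < D2 by rewrite subr_gt0.
(* [p] is the lower left corner of a rectangle of generation n on which P fails; n alone determines
   its size. *)
pose bad n (p : R * R) := [/\ a <= p.1, p.1 + lam n * D1 <= b, c <= p.2, p.2 + lam n * D2 <= d &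
  ~ P p.1 (p.1 + lam n * D1) p.2 (p.2 + lam n * D2)].
pose sub n (p q : R * R) := [/\ p.1 <= q.1, q.1 + lam n.+1 * D1 <= p.1 + lam n * D1,
   p.2 <= q.2 & q.2 + lam n.+1 * D2 <= p.2 + lam n * D2].
have step (np : nat * (R * R)) : exists q, bad np.1 np.2 -> bad np.1.+1 q /\ sub np.1 np.2 q.
  case: np => n [p1 p2] /=; have [B|] := pselect (bad n (p1, p2)); last by exists (0, 0).
  case: B => /= A1 A2 A3 A4 nQ.
  have l0 := lam_gt0 n; have l1 := lam_gt0 n.+1.
  have lE : lam n = lam n.+1 + lam n.+1 by rewrite exprS; lra.
  have h1 : 0 < lam n.+1 * D1 by rewrite mulr_gt0.
  have h2 : 0 < lam n.+1 * D2 by rewrite mulr_gt0.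
  move: A2 A4 nQ; rewrite lE !mulrDl !addrA => A2 A4 nQ.
  (* If no quarter is bad, P holds on all four: [mH] joins them into two horizontal strips, and [mV]
     joins the strips. *)
  apply: contrapT => /forallNP nex; apply: nQ.
  have good q1 q2 : (p1, p2).1 <= q1 -> q1 + lam n.+1 * D1 <= p1 + lam n.+1 * D1 + lam n.+1 * D1 ->
     p2 <= q2 -> q2 + lam n.+1 * D2 <= p2 + lam n.+1 * D2 + lam n.+1 * D2 ->
     P q1 (q1 + lam n.+1 * D1) q2 (q2 + lam n.+1 * D2).
    move=> /= B1 B2 B3 B4; apply: contrapT => nPq; apply: (nex (q1, q2)) => _; split.
      split => //=; [exact: le_trans A1 B1|exact: le_trans B2 A2|exact: le_trans A3 B3|exact: le_trans B4 A4].
    by split => //=; rewrite lE mulrDl addrA.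
  have [k1 k2] : p1 < p1 + lam n.+1 * D1 /\ p2 < p2 + lam n.+1 * D2 by rewrite !ltrDl.
  have [k3 k4] : p1 + lam n.+1 * D1 < p1 + lam n.+1 * D1 + lam n.+1 * D1 /\
    p2 + lam n.+1 * D2 < p2 + lam n.+1 * D2 + lam n.+1 * D2 by rewrite !ltrDl.
  have strip q2 : p2 <= q2 -> q2 + lam n.+1 * D2 <= p2 + lam n.+1 * D2 + lam n.+1 * D2 ->
      P p1 (p1 + lam n.+1 * D1 + lam n.+1 * D1) q2 (q2 + lam n.+1 * D2).
    move=> B1 B2; have k5 : q2 < q2 + lam n.+1 * D2 by rewrite ltrDl.
    apply: (mH _ _ _ _ _ A1 k1 k3 A2 (le_trans A3 B1) k5 (le_trans B2 A4)).
      by apply: good => //; exact: ltW.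
    by apply: good => //; exact: ltW.
  apply: (mV _ _ _ _ _ A1 (lt_trans k1 k3) A2 A3 k2 k4 A4).
    by apply: strip => //; exact: ltW.
  by apply: strip => //; exact: ltW.
have [F FP] := choice step.
pose u := fix u n := if n is k.+1 then F (k, u k) else (a, c).
have uB n : bad n (u n).
  elim: n => [|n IH]; last by have [] := FP (n, u n) IH.
  have ea : a + D1 = b by rewrite /D1; lra.
  have ec : c + D2 = d by rewrite /D2; lra.
  by rewrite /bad /= expr0 !mul1r ea ec; split.
have uS n : sub n (u n) (u n.+1) by have [] := FP (n, u n) (uB n).
have [x xP] : exists x, forall n, (u n).1 <= x <= (u n).1 + lam n * D1.
  by apply: nested_intervals => [n|]; [case: (uS n)|exact: ltW].
have [y yP] : exists y, forall n, (u n).2 <= y <= (u n).2 + lam n * D2.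
  by apply: nested_intervals => [n|]; [case: (uS n)|exact: ltW].
have xab : a <= x <= b.
  by have /andP[h1 h2] := xP 0%N; case: (uB 0%N) => *; apply/andP; split; lra.
have ycd : c <= y <= d.
  by have /andP[h1 h2] := yP 0%N; case: (uB 0%N) => *; apply/andP; split; lra.
have [e e0 eP] := loc x y xab ycd.
have [n ne] := lam_small e0.
by case: (uB n) => B1 B2 B3 B4; apply; apply: eP => //; rewrite lam_gt0.
Qed.

(** The exceptional point [z0], where f is only continuous, lets the theorem be applied to
    difference quotients, from which Cauchy's formula follows at once. *)
Lemma goursat (z0 : C) a b c d f : a < b -> c < d -> rcont a b c d f ->
  (forall x y, a <= x <= b -> c <= y <= d -> (x +i* y)%C != z0 -> differentiable f (x +i* y)%C) ->
  rint a b c d f = 0.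
Proof.
move=> ab cd fc fd; apply/eqP; rewrite -modc_eq0; apply/negPn/negP => r0.
have {}r0 : 0 < modc (rint a b c d f) by rewrite lt0r r0 modc_ge0.
case: z0 fd => x0 y0 fd.
set D1 := b - a; set D2 := d - c.
have D1p : 0 < D1 by rewrite subr_gt0.
have D2p : 0 < D2 by rewrite subr_gt0.
pose s x := Num.sg (x - x0); pose r y := Num.sg (y - y0).
have sg_le x y : x <= y -> Num.sg x <= Num.sg y :> R.
  by case: (sgrP x); case: (sgrP y) => //=; lra.
have sg1 x y : x <= 0 -> 0 <= y -> x < y -> 1 <= Num.sg y - Num.sg x :> R.
  by case: (sgrP x); case: (sgrP y) => //=; lra.
(* Additive in the rectangle and at least 1 on each rectangle around z0: it
   absorbs the integral of the bounded f near z0. *)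
pose wt a' b' c' d' : R := (b' - a') * (d' - c') + (s b' - s a') * (r d' - r c').
have s_le x y : x <= y -> 0 <= s y - s x by move=> xy; rewrite subr_ge0 sg_le //; lra.
have r_le x y : x <= y -> 0 <= r y - r x by move=> xy; rewrite subr_ge0 sg_le //; lra.
have wt0 a' b' c' d' : a' <= b' -> c' <= d' -> (b' - a') * (d' - c') <= wt a' b' c' d'.
  by move=> h1 h2; rewrite lerDl mulr_ge0 ?s_le ?r_le.
have wt_gt0 : 0 < wt a b c d.
  by apply: lt_le_trans (wt0 _ _ _ _ (ltW ab) (ltW cd)); rewrite mulr_gt0.
pose ep := modc (rint a b c d f) / (2 * wt a b c d).
have ep0 : 0 < ep by rewrite divr_gt0 // mulr_gt0.
have epE : ep * wt a b c d < modc (rint a b c d f).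
  by rewrite /ep invfM mulrA mulfVK ?gt_eqF //; lra.
clearbody ep.
pose P a' b' c' d' := modc (rint a' b' c' d' f) <= ep * wt a' b' c' d'.
suff : P a b c d.
  by rewrite /P leNgt epE.
apply: (rect_cousin (P := P) ab cd).
- move=> x y z c' d' ax xy yz zb cc cd' dd; rewrite /P => H1 H2.
  rewrite (rint_catH (ltW xy) (ltW yz) (ltW cd')); last by apply/rcont_b; apply: rcontS fc.
  apply: le_trans (modcD _ _) _; apply: le_trans (lerD H1 H2) _.
  by rewrite -mulrDr /wt le_eqVlt; apply/orP; left; apply/eqP; congr (_ * _); ring.
- move=> a' b' x y z aa ab' bb cx xy yz zd; rewrite /P => H1 H2.
  rewrite (rint_catV (ltW ab') (ltW xy) (ltW yz)); last by apply/rcont_b; apply: rcontS fc.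
  apply: le_trans (modcD _ _) _; apply: le_trans (lerD H1 H2) _.
  by rewrite -mulrDr /wt le_eqVlt; apply/orP; left; apply/eqP; congr (_ * _); ring.
move=> x y xab ycd.
have dist l a' c' t v : 0 < l -> a' <= x <= a' + l * D1 -> c' <= y <= c' + l * D2 ->
   a' <= t <= a' + l * D1 -> c' <= v <= c' + l * D2 ->
   modc ((t +i* v)%C - (x +i* y)%C) <= l * (D1 + D2).
  move=> l0 /andP[h1 h2] /andP[h3 h4] /andP[h5 h6] /andP[h7 h8].
  apply: le_trans (modc_le _) _ => /=; rewrite mulrDr.
  by apply: lerD; rewrite ler_norml; apply/andP; split; lra.
have DD : 0 < D1 + D2 by rewrite addr_gt0.
(* At [z0] only a bound M for f is available: the integral is at most 4 M l (D1 + D2), which is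
   below [ep] for small l, while the weight is at least 1. *)
have [e1|ne] := eqVneq (x +i* y)%C (x0 +i* y0)%C.
  have [ex ey] : x = x0 /\ y = y0 by case: e1.
  have [e e0 eP] := (contCP f (x +i* y)%C).1 (fc _ _ xab ycd) 1 ltr01.
  pose M := modc (f (x +i* y)%C) + 1.
  have M0 : 0 < M by rewrite ltr_wpDl ?modc_ge0.
  exists (Num.min (e / (D1 + D2)) (ep / (4 * M * (D1 + D2)))).
    by rewrite lt_min !divr_gt0 ?mulr_gt0.
  move=> l a' c' l0; rewrite lt_min !(ltr_pdivlMr l) ?mulr_gt0 // => /andP[l1 l2] aa bb cc dd xa yc.
  rewrite -/D1 -/D2 in bb dd xa yc *.
  have l3 : a' < a' + l * D1 by rewrite ltrDl mulr_gt0.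
  have l4 : c' < c' + l * D2 by rewrite ltrDl mulr_gt0.
  apply: le_trans (rint_bound (M := M) (ltW l3) (ltW l4) _ _) _.
  - by apply/rcont_b; apply: rcontS fc.
  - move=> t v ta vc _; have := eP (t +i* v)%C (le_lt_trans (dist _ _ _ _ _ l0 xa yc ta vc) l1).
    by move=> h; rewrite -[f _](subrK (f (x +i* y)%C)) /M; apply: le_trans (modcD _ _) _; lra.
  - have : 1 <= wt a' (a' + l * D1) c' (c' + l * D2).
      have h1 : 1 <= s (a' + l * D1) - s a' by case/andP: xa => xa1 xa2; apply: sg1; rewrite ?subr_le0 ?subr_ge0 ?ltrD2r -?ex.
      have h2 : 1 <= r (c' + l * D2) - r c' by case/andP: yc => yc1 yc2; apply: sg1; rewrite ?subr_le0 ?subr_ge0 ?ltrD2r -?ey.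
      have h3 : 0 < l * D1 * (l * D2) by rewrite !mulr_gt0.
      by rewrite /wt; nra.
    have -> : 4 * M * (a' + l * D1 - a' + (c' + l * D2 - c')) = l * (4 * M * (D1 + D2)) by ring.
    by nra.
have [L LP] := (cdiffP f (x +i* y)%C).1 (fd _ _ xab ycd ne).
(* Chosen so that the bound 4 eta (l (D1 + D2))^2 for the integral of the remainder equals [ep]
   times the area l^2 D1 D2. *)
pose eta := ep * (D1 * D2) / (4 * (D1 + D2) ^+ 2).
have eta0 : 0 < eta by rewrite divr_gt0 ?mulr_gt0 // exprn_gt0.
have [e e0 eP] := LP _ eta0.
exists (e / (D1 + D2)); first by rewrite divr_gt0.
move=> l a' c' l0; rewrite ltr_pdivlMr // => l1 aa bb cc dd xa yc.
rewrite -/D1 -/D2 in bb dd xa yc *; rewrite /P.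
have l3 : a' < a' + l * D1 by rewrite ltrDl mulr_gt0.
have l4 : c' < c' + l * D2 by rewrite ltrDl mulr_gt0.
set p := (x +i* y)%C in LP eP *.
pose g w := f w + ((L * p - f p) + (- L) * w).
have ac : rcont a' (a' + l * D1) c' (c' + l * D2) (fun w => (L * p - f p) + (- L) * w).
  move=> t v _ _; apply: continuousD; first exact: cst_continuous.
  by apply: continuousM; [exact: cst_continuous|exact: cvg_id].
have fc' : rcont a' (a' + l * D1) c' (c' + l * D2) f by apply: rcontS fc.
have gc : rcont a' (a' + l * D1) c' (c' + l * D2) g.
  by move=> t v h1 h2; apply: continuousD; [exact: fc'|exact: ac].
have -> : rint a' (a' + l * D1) c' (c' + l * D2) f = rint a' (a' + l * D1) c' (c' + l * D2) g.
  by rewrite (rintD (ltW l3) (ltW l4) (rcont_b fc') (rcont_b ac)) (rint_affine _ _ (ltW l3) (ltW l4)) addr0.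
apply: le_trans (rint_bound (M := eta * (l * (D1 + D2))) (ltW l3) (ltW l4) (rcont_b gc) _) _.
  move=> t v ta vc _; have h := dist _ _ _ _ _ l0 xa yc ta vc.
  have -> : g (t +i* v)%C = f (t +i* v)%C - f p - L * ((t +i* v)%C - p) by rewrite /g; ring.
  by apply: le_trans (eP _ (le_lt_trans h l1)) _; rewrite ler_pM2l.
apply: le_trans (ler_wpM2l (ltW ep0) (wt0 _ _ _ _ (ltW l3) (ltW l4))).
rewrite le_eqVlt; apply/orP; left; apply/eqP; rewrite /eta.
have h : D1 + D2 != 0 by rewrite gt_eqF.
by field.
Qed.

End Goursat.

Section NearDifferentiable.
Variables (K : numFieldType) (V W : normedModType K).

(** The difference g - f vanishes near x, hence has differential 0 there, and g = f + (g - f). *)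
Lemma near_eq_differentiable (f g : V -> W) (x : V) :
  {near x, f =1 g} -> differentiable f x -> differentiable g x.
Proof.
move=> fg fd.
have h0 : differentiable (g - f) x.
  have e0 : (g - f) \o shift x = cst ((g - f) x) + (\0 : V -> W) +o_ (0 : V) id.
    apply/eqaddoP => e e0.
    have gfx : g x - f x = 0 by rewrite (nbhs_singleton fg) subrr.
    near=> h; rewrite -[X in `|X|]/(g (h + x) - f (h + x) - (g x - f x + 0)) gfx addr0 subr0.
    suff -> : f (h + x) = g (h + x) by rewrite subrr normr0 mulr_ge0 // ltW.
    near: h; have := fg; rewrite (near_shift 0) subr0.
    by apply: filterS => h /=.
  have c0 : continuous (\0 : {linear V -> W}) by move=> z; exact: cst_continuous.
  have dE := diff_unique c0 e0.
  by apply/diff_locallyP; rewrite dE; split.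
rewrite (_ : g = f + (g - f)); first exact: differentiableD.
by rewrite addrC subrK.
Unshelve. all: by end_near. Qed.

End NearDifferentiable.

Section Cauchy.
Variable R : realType.
Local Notation C := R[i].
Implicit Types (a b c d x y t : R) (f g : C -> C).

Lemma modc_near_eq (f g : C -> C) z (e : R) : 0 < e ->
  (forall w, modc (w - z) < e -> f w = g w) -> differentiable f z -> differentiable g z.
Proof.
by move=> e0 fg; apply: near_eq_differentiable; apply/nearC; exists e.
Qed.

Lemma seg_bounded a b (f : R -> C) : a <= b -> seg_cont a b f ->
  exists2 M : R, 0 < M & forall t, a <= t <= b -> modc (f t) <= M.
Proof.
move=> ab fc; have mc : forall t, a <= t <= b -> {for t, continuous (fun t => modc (f t))}.
  move=> t /fc/contRCP ft; apply/(cvgrPdist_lt (F := nbhs t)) => e e0.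
  have [d d0 dP] := ft e e0; apply/nbhs_ballP; exists d => //= s.
  rewrite -ball_normE /= distrC => /dP; apply: le_lt_trans.
  have := modcD (f s - f t) (f t); have := modcD (f t - f s) (f s).
  by rewrite !subrK (modcB (f t)) ler_norml => h1 h2; apply/andP; split; lra.
have [c cab cP] := EVT_max ab (seg_within mc).
exists (modc (f c) + 1); first by rewrite ltr_wpDl ?modc_ge0.
by move=> t tab; have := cP t; rewrite in_itv /= => /(_ tab); lra.
Qed.

(** Differentiation under the integral sign. The path [q] is arbitrary so that kernels in u^-1,
    which describe the behaviour near infinity, are covered too. *)
Lemma cint_kernel_diff a b (p q : R -> C) z : a <= b -> seg_cont a b p -> seg_cont a b q ->
  (forall t, a <= t <= b -> q t != z) ->
  differentiable (fun z => cint a b (fun t => p t * (q t - z)^-1)) z.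
Proof.
move=> ab pc qc qz.
have qzc w : seg_cont a b (fun t => q t - w).
  by move=> t /qc h; apply: continuousB; [exact: h|exact: cst_continuous].
have ic w : (forall t, a <= t <= b -> q t != w) -> seg_cont a b (fun t => (q t - w)^-1).
  by move=> qw t tab; apply: continuousV; [rewrite subr_eq0 qw|exact: qzc].
have cM (f g : R -> C) : seg_cont a b f -> seg_cont a b g -> seg_cont a b (fun t => f t * g t).
  by move=> fc gc t tab; apply: continuousM; [exact: fc|exact: gc].
have [M M0 MP] := seg_bounded ab pc.
have [N N0 NP] := seg_bounded ab (ic _ qz).
have Nq t : a <= t <= b -> N^-1 <= modc (q t - z).
  move=> tab; have := NP t tab; rewrite modcV => h.
  by rewrite -[leRHS]invrK lef_pV2 ?posrE // invr_gt0 modc_gt0 subr_eq0 qz.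
apply/cdiffP; exists (cint a b (fun t => p t * (q t - z)^-1 * (q t - z)^-1)) => e e0.
(* M bounds p and N bounds 1/(q - z); for |w - z| < 1/(2N) the factor 1/(q - w) is at most 2N. *)
pose K := 2 * (M * N * N * (2 * N)) * (b - a).
have K0 : 0 <= K by rewrite /K !mulr_ge0 ?subr_ge0 // ltW.
exists (Num.min (N^-1 / 2) (e / (K + 1))).
  by rewrite lt_min !divr_gt0 ?invr_gt0 ?ltr_wpDl.
move=> w; rewrite lt_min => /andP[w1 w2].
have Nw t : a <= t <= b -> N^-1 / 2 <= modc (q t - w).
  move=> tab; have := modcD (q t - w) (w - z); rewrite addrA subrK.
  by have := Nq t tab; lra.
have iN0 : 0 < N^-1 / 2 by rewrite divr_gt0 ?invr_gt0.
have qw t : a <= t <= b -> q t != w.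
  by move=> tab; rewrite -subr_eq0 -modc_gt0; apply: lt_le_trans (Nw t tab).
(* The remainder is of second order: 1/(q-w) - 1/(q-z) - (w-z)/(q-z)^2 = (w-z)^2 / ((q-z)^2
   (q-w)). *)
have -> : cint a b (fun t => p t * (q t - w)^-1) - cint a b (fun t => p t * (q t - z)^-1)
    - cint a b (fun t => p t * (q t - z)^-1 * (q t - z)^-1) * (w - z)
  = (w - z) ^+ 2 * cint a b (fun t => p t * (q t - z)^-1 * (q t - z)^-1 * (q t - w)^-1).
  have c1 := cM _ _ pc (ic _ qw); have c2 := cM _ _ pc (ic _ qz).
  have c3 := cM _ _ c2 (ic _ qz); have c4 := cM _ _ c3 (ic _ qw).
  have cZ u (f : R -> C) : seg_cont a b f -> seg_cont a b (fun t => u * f t).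
    by move=> fc; apply: cM; [move=> t _; exact: cst_continuous|exact: fc].
  rewrite [_ * (w - z)]mulrC -(cintN c2) -(cintZ _ c3) -(cintN (cZ _ _ c3)) -(cintZ _ c4).
  have cN (f : R -> C) : seg_cont a b f -> seg_cont a b (fun t => - f t).
    by move=> fc t tab; apply: continuousN; exact: fc.
  rewrite -(cintD c1 (cN _ c2)) -cintD; last exact/cN/cZ.
    apply: eq_cint => t tab; have h1 : q t - w != 0 by rewrite subr_eq0 qw.
    by have h2 : q t - z != 0 by [rewrite subr_eq0 qz]; field; rewrite h1 h2.
  by move=> t tab; apply: continuousD; [exact: c1|exact/cN].
rewrite modcM modcX expr2 -mulrA [leLHS]mulrC; apply: ler_wpM2r; first exact: modc_ge0.
have h : modc (cint a b (fun t => p t * (q t - z)^-1 * (q t - z)^-1 * (q t - w)^-1)) <= K.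
  apply: cint_bound; [exact: ab|exact: cM (cM _ _ (cM _ _ pc (ic _ qz)) (ic _ qz)) (ic _ qw)|].
  move=> t tab; rewrite !modcM.
  have h1 : modc (q t - w)^-1 <= 2 * N.
    rewrite modcV -[leRHS]invrK lef_pV2 ?posrE ?invr_gt0 ?mulr_gt0 //; last first.
      by rewrite modc_gt0 subr_eq0 qw.
    by rewrite invfM mulrC; exact: Nw.
  by rewrite !ler_pM ?mulr_ge0 ?modc_ge0 ?MP ?NP.
move: w2; rewrite ltr_pdivlMr ?ltr_wpDl // => w2.
apply: le_trans (ltW w2); apply: ler_wpM2l; first exact: modc_ge0.
by apply: le_trans h _; rewrite lerDl.
Qed.

End Cauchy.

Section CauchyFormula.
Variable R : realType.
Local Notation C := R[i].
Implicit Types (a b c d x y t : R) (f g : C -> C).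

(* 2 pi i; only its being nonzero matters *)
Definition tau : C := rint (-1) 1 (-1) 1 (fun w : C => w^-1).

Lemma continuous_subC z w : {for w, continuous (fun w : C => w - z)}.
Proof. by apply: continuousB; [exact: cvg_id|exact: cst_continuous]. Qed.

Lemma continuous_invB z w : w != z -> {for w, continuous (fun w : C => (w - z)^-1)}.
Proof.
by move=> wz; apply: continuousV; [rewrite subr_eq0|exact: continuous_subC].
Qed.

Lemma hol_id w : differentiable (fun w : C => w) w.
Proof. by apply/derivable1_diffP; exact: derivable_id. Qed.

Lemma differentiable_invB z w : w != z -> differentiable (fun w : C => (w - z)^-1) w.
Proof.
move=> wz; apply: differentiableV; last by rewrite subr_eq0.
by apply: differentiableB; [exact: hol_id|exact: differentiable_cst].
Qed.

Lemma ReV x y : complex.Re ((x +i* y)%C^-1) = x / (x ^+ 2 + y ^+ 2).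
Proof. by []. Qed.

Lemma ImV x y : complex.Im ((x +i* y)%C^-1) = - y / (x ^+ 2 + y ^+ 2).
Proof. by rewrite mulNr. Qed.

Lemma inv_cont0 w : w != 0 -> {for w, continuous (fun w : C => w^-1)}.
Proof. by move=> w0; apply: continuousV => //; exact: cvg_id. Qed.

Lemma bcont_inv a b c d : a < 0 < b -> c < 0 < d -> bcont a b c d (fun w : C => w^-1).
Proof.
move=> /andP[a0 b0] /andP[c0 d0] x y xab ycd bd; apply: inv_cont0.
apply: contraTneq bd => -[-> ->].
by rewrite !negb_or; apply/and4P; split; rewrite ?(lt_eqF b0) ?(lt_eqF d0) ?(gt_eqF a0) ?(gt_eqF c0).
Qed.

(** On each side of the square the imaginary part of dw/w, traversed counterclockwise, is dt/(1 +
    t^2), which is at least dt/2. So the imaginary part of [tau] is positive. *)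
Lemma tau_neq0 : tau != 0.
Proof.
have bc := @bcont_inv (-1) 1 (-1) 1 ltac:(apply/andP; split; lra) ltac:(apply/andP; split; lra).
have h : (-1 : R) <= 1 by lra.
have lt11 : (-1 : R) < 1 by lra.
have i0 : 0 < 2^-1 :> R by lra.
have cZ u (f : R -> C) : seg_cont (-1) 1 f -> seg_cont (-1) 1 (fun t => u * f t).
  by move=> fc t tab; apply: continuousM; [exact: cst_continuous|exact: fc].
have tt (t : R) : -1 <= t <= 1 -> 0 < 1 + t ^+ 2 <= 2.
  by move=> /andP[t1 t2]; apply/andP; split; nra.
have inv2 (t : R) : -1 <= t <= 1 -> 2^-1 <= (1 + t ^+ 2)^-1.
  by move=> /tt/andP[t1 t2]; rewrite lef_pV2 ?posrE.
have pos (u : C) (f : R -> C) : seg_cont (-1) 1 f ->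
   (forall t, -1 <= t <= 1 -> complex.Im (u * f t) = (1 + t ^+ 2)^-1) ->
   0 < complex.Im (u * cint (-1) 1 f).
  move=> fc fi; rewrite -cintZ //; apply: (cint_Im_gt0 lt11 (cZ _ _ fc) i0) => t tab.
  by rewrite fi // inv2.
have I1 := pos 1 _ (bcont_bot h bc); have I2 := pos (-1) _ (bcont_top h bc).
have I3 := pos 'i%C _ (bcont_right h bc); have I4 := pos (- 'i%C) _ (bcont_left h bc).
suff : 0 < complex.Im tau by apply: contraTneq => ->; rewrite ltxx.
have -> : tau = 1 * cint (-1) 1 (fun t => (t +i* (-1))%C^-1) + (-1) * cint (-1) 1 (fun t => (t +i* 1)%C^-1)
  + ('i%C * cint (-1) 1 (fun t => (1 +i* t)%C^-1) + - 'i%C * cint (-1) 1 (fun t => ((-1) +i* t)%C^-1)).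
  by rewrite /tau /rint; ring.
have ImM1 (z : C) : complex.Im (-1 * z) = - complex.Im z by rewrite mulN1r; case: z.
have ImiM (z : C) : complex.Im ('i%C * z) = complex.Re z by case: z => p q /=; ring.
have ImNiM (z : C) : complex.Im (- 'i%C * z) = - complex.Re z by rewrite mulNr; case: z => p q /=; ring.
rewrite !ImD; apply: addr_gt0; apply: addr_gt0.
- by apply: I1 => t _; rewrite mul1r ImV opprK mul1r sqrrN expr1n addrC.
- by apply: I2 => t _; rewrite ImM1 ImV mulNr opprK mul1r expr1n addrC.
- by apply: I3 => t _; rewrite ImiM ReV expr1n mul1r.
- by apply: I4 => t _; rewrite ImNiM ReV sqrrN expr1n mulNr opprK mul1r.
Qed.

Lemma rint_inv0 a b c d : a < b -> c < d -> ~~ ((a <= 0 <= b) && (c <= 0 <= d)) ->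
  rint a b c d (fun w : C => w^-1) = 0.
Proof.
move=> ab cd n0.
have nz x y : a <= x <= b -> c <= y <= d -> (x +i* y)%C != 0.
  by move=> xab ycd; apply: contraNneq n0 => -[ex ey]; rewrite ex in xab; rewrite ey in ycd; rewrite xab ycd.
apply: (@goursat _ 0); [exact: ab|exact: cd|by move=> x y xab ycd; exact/inv_cont0/nz|].
move=> x y xab ycd w0; by apply: differentiableV; [exact: hol_id|].
Qed.

(** The sides are moved outwards one at a time; the strip gained avoids 0 and contributes nothing by
    [rint_inv0]. *)
Lemma rint_inv_grow a b c d a' b' c' d' : a < 0 < b -> c < 0 < d ->
  a' <= a -> b <= b' -> c' <= c -> d <= d' ->
  rint a' b' c' d' (fun w : C => w^-1) = rint a b c d (fun w : C => w^-1).
Proof.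
move=> /andP[a0 b0] /andP[c0 d0] aa bb cc dd.
have bc p q r s : p < 0 -> 0 < q -> r < 0 -> 0 < s -> bcont p q r s (fun w : C => w^-1).
  by move=> *; apply: bcont_inv; apply/andP.
have z p q r s : p < q -> r < s -> 0 < p \/ q < 0 \/ 0 < r \/ s < 0 ->
    rint p q r s (fun w : C => w^-1) = 0.
  move=> pq rs h; apply: rint_inv0 => //; apply/negP => /andP[/andP[? ?] /andP[? ?]].
  by case: h => [|[|[|]]]; lra.
have -> : rint a' b' c' d' (fun w : C => w^-1) = rint a b' c' d' (fun w : C => w^-1).
  move: aa; rewrite le_eqVlt => /orP[/eqP->//|aa].
  rewrite (rint_catH (ltW aa)); [|lra|lra|apply: bc; lra].
  by rewrite (z a' a); [rewrite add0r|lra|lra|right; left; lra].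
have -> : rint a b' c' d' (fun w : C => w^-1) = rint a b c' d' (fun w : C => w^-1).
  move: bb; rewrite le_eqVlt => /orP[/eqP->//|bb].
  rewrite (@rint_catH _ a b); [|lra|lra|lra|apply: bc; lra].
  by rewrite (z b b'); [rewrite addr0|lra|lra|left; lra].
have -> : rint a b c' d' (fun w : C => w^-1) = rint a b c d' (fun w : C => w^-1).
  move: cc; rewrite le_eqVlt => /orP[/eqP->//|cc].
  rewrite (@rint_catV _ a b c' c); [|lra|lra|lra|apply: bc; lra].
  by rewrite (z a b c'); [rewrite add0r|lra|lra|do 3!right; lra].
move: dd; rewrite le_eqVlt => /orP[/eqP->//|dd].
rewrite (@rint_catV _ a b c d); [|lra|lra|lra|apply: bc; lra].
by rewrite (z a b d); [rewrite addr0|lra|lra|right; right; left; lra].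
Qed.

(** The given rectangle and the square defining [tau] both grow to the smallest rectangle containing
    them. *)
Lemma rint_inv a b c d : a < 0 < b -> c < 0 < d -> rint a b c d (fun w : C => w^-1) = tau.
Proof.
move=> /andP[a0 b0] /andP[c0 d0].
have h : (-1 < 0 :> R) && (0 < 1 :> R) by apply/andP; split; lra.
rewrite /tau -(@rint_inv_grow a b c d (Num.min a (-1)) (Num.max b 1) (Num.min c (-1)) (Num.max d 1))
  ?a0 ?c0 ?ge_min ?le_max ?lexx //.
by apply: rint_inv_grow => //; rewrite ?ge_min ?le_max ?lexx ?orbT.
Qed.

Lemma rint_shift a b c d x y f : a <= b -> c <= d -> bcont (a + x) (b + x) (c + y) (d + y) f ->
  rint (a + x) (b + x) (c + y) (d + y) f = rint a b c d (fun w => f (w + (x +i* y)%C)).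
Proof.
move=> ab cd fc.
have ab' : a + x <= b + x by rewrite lerD2r.
have cd' : c + y <= d + y by rewrite lerD2r.
rewrite /rint (cint_shift ab (bcont_bot cd' fc)) (cint_shift ab (bcont_top cd' fc)).
by rewrite (cint_shift cd (bcont_left ab' fc)) (cint_shift cd (bcont_right ab' fc)).
Qed.

Lemma bcont_invB a b c d x y : a < x < b -> c < y < d ->
  bcont a b c d (fun w => (w - (x +i* y)%C)^-1).
Proof.
move=> /andP[a0 b0] /andP[c0 d0] u v uab vcd bd; apply: continuous_invB.
apply: contraTneq bd => -[-> ->].
by rewrite !negb_or; apply/and4P; split; rewrite ?(lt_eqF b0) ?(lt_eqF d0) ?(gt_eqF a0) ?(gt_eqF c0).
Qed.

Lemma rint_invB a b c d x y : a < x < b -> c < y < d ->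
  rint a b c d (fun w => (w - (x +i* y)%C)^-1) = tau.
Proof.
move=> h1 h2; have := bcont_invB h1 h2; case/andP: h1 => ax xb; case/andP: h2 => cy yd bc.
have e u v : u = (u - v) + v :> R by rewrite subrK.
have := @rint_shift (a - x) (b - x) (c - y) (d - y) x y (fun w => (w - (x +i* y)%C)^-1).
rewrite !subrK => ->; [|by rewrite lerD2r; lra|by rewrite lerD2r; lra|exact: bc].
rewrite -(@rint_inv (a - x) (b - x) (c - y) (d - y)); try by apply/andP; split; lra.
by apply: eq_rint; [lra|lra|move=> u v _ _ _; rewrite addrK].
Qed.

(** The quotient, completed by the derivative at z, is continuous at z and differentiable elsewhere
    as far as f is: exactly what [goursat] accepts. *)
Lemma difference_quotient f z : differentiable f z -> exists g : C -> C,
  [/\ forall w, w != z -> g w = (f w - f z) * (w - z)^-1,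
      forall w, w != z -> differentiable f w -> differentiable g w &
      {for z, continuous g}].
Proof.
move=> /cdiffP[l lP].
pose g w := if w == z then l else (f w - f z) * (w - z)^-1.
exists g; split.
- by move=> w wz; rewrite /g ifN.
- move=> w wz wd; have e0 : 0 < modc (w - z) by rewrite modc_gt0 subr_eq0.
  apply: (@modc_near_eq _ (fun w => (f w - f z) * (w - z)^-1) _ _ _ e0).
    move=> v vw; rewrite /g; case: eqP => // vz.
    by move: vw; rewrite vz modcB ltxx.
  apply: differentiableM; last exact: differentiable_invB.
  by apply: differentiableB; [exact: wd|exact: differentiable_cst].
apply/contCP => ep ep0.
have [dl dl0 dP] := lP (ep / 2) ltac:(by rewrite divr_gt0).
exists dl => // w wz; rewrite /g eqxx; case: eqP => [_|/eqP ne]; first by rewrite subrr modc0.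
have wz0 : w - z != 0 by rewrite subr_eq0.
have -> : (f w - f z) * (w - z)^-1 - l = (f w - f z - l * (w - z)) * (w - z)^-1.
  by rewrite [RHS]mulrBl mulfK.
rewrite modcM modcV ltr_pdivrMr ?modc_gt0 //.
apply: le_lt_trans (dP w wz) _; rewrite ltr_pM2r ?modc_gt0 //; lra.
Qed.

Lemma bcont_div a b c d z f : bcont a b c d f ->
  (forall x y, a <= x <= b -> c <= y <= d -> [|| x == a, x == b, y == c | y == d] -> (x +i* y)%C != z) ->
  bcont a b c d (fun w => f w * (w - z)^-1).
Proof.
move=> fc zb u v uab vcd bd; apply: continuousM; first exact: fc.
by apply: continuous_invB; exact: zb.
Qed.

Lemma rint_quotient a b c d z f g : a <= b -> c <= d -> bcont a b c d f ->
  (forall x y, a <= x <= b -> c <= y <= d -> [|| x == a, x == b, y == c | y == d] -> (x +i* y)%C != z) ->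
  (forall w, w != z -> g w = (f w - f z) * (w - z)^-1) ->
  rint a b c d g = rint a b c d (fun w => f w * (w - z)^-1) - f z * rint a b c d (fun w => (w - z)^-1).
Proof.
move=> ab cd fc zb gE.
have bc : bcont a b c d (fun w => (w - z)^-1).
  by move=> u v uab vcd bd; apply: continuous_invB; exact: zb.
have zbc : bcont a b c d (fun w => - f z * (w - z)^-1).
  by move=> u v uab vcd bd; apply: continuousM; [exact: cst_continuous|exact: bc].
rewrite -mulNr -(rintZ _ ab cd bc) -(rintD ab cd (bcont_div fc zb) zbc).
by apply: eq_rint => // u v uab vcd bd; rewrite gE ?zb // mulrDl.
Qed.

Lemma bnd_neq a b c d x y u v : a < x < b -> c < y < d ->
  [|| u == a, u == b, v == c | v == d] -> (u +i* v)%C != (x +i* y)%C.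
Proof.
move=> /andP[ax xb] /andP[cy yd]; apply: contraTneq => -[-> ->]; rewrite !negb_or.
by apply/and4P; split; rewrite ?(lt_eqF xb) ?(lt_eqF yd) ?(gt_eqF ax) ?(gt_eqF cy).
Qed.

(** The integral of the difference quotient vanishes by [goursat]; what remains is f(z) times the
    integral of 1/(w - z), which is [tau]. *)
Lemma cauchy_formula a b c d x y f : a < x < b -> c < y < d ->
  (forall u v, a <= u <= b -> c <= v <= d -> differentiable f (u +i* v)%C) ->
  rint a b c d (fun w => f w * (w - (x +i* y)%C)^-1) = tau * f (x +i* y)%C.
Proof.
move=> xab ycd fd; set z := (x +i* y)%C.
have [ax xb] := andP xab; have [cy yd] := andP ycd.
have zd : differentiable f z by apply: fd; apply/andP; split; lra.
have [g [gE gd gz]] := difference_quotient zd.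
have gc : rcont a b c d g.
  move=> u v uab vcd; have [->|ne] := eqVneq (u +i* v)%C z; first exact: gz.
  by apply: differentiable_continuous; apply: gd; [exact: ne|exact: fd].
have g0 : rint a b c d g = 0.
  apply: (@goursat _ z); [lra|lra|exact: gc|].
  by move=> u v uab vcd ne; apply: gd; [exact: ne|exact: fd].
have fc : bcont a b c d f.
  by move=> u v uab vcd _; apply: differentiable_continuous; exact: fd.
have := @rint_quotient a b c d z f g _ _ fc _ gE.
rewrite g0 (rint_invB xab ycd) => /(_ ltac:(lra) ltac:(lra)) h.
have /eqP := h (fun u v _ _ => bnd_neq xab ycd).
by rewrite eq_sym subr_eq0 => /eqP ->; rewrite mulrC.
Qed.

(** As for [cauchy_formula], with the two boundary squares compared through the difference quotient;
    the point lies outside the inner square, where 1/(w - z) therefore integrates to 0. *)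
Lemma cauchy_annulus (r T : R) x y f : 0 < r -> r < T -> - T < x < T -> - T < y < T ->
  ~~ ((- r <= x <= r) && (- r <= y <= r)) ->
  (forall u v, - T <= u <= T -> - T <= v <= T -> ~~ ((- r < u < r) && (- r < v < r)) ->
    differentiable f (u +i* v)%C) ->
  rint (- T) T (- T) T (fun w => f w * (w - (x +i* y)%C)^-1)
  - rint (- r) r (- r) r (fun w => f w * (w - (x +i* y)%C)^-1) = tau * f (x +i* y)%C.
Proof.
move=> r0 rT xT yT nr fd; set z := (x +i* y)%C.
have [Tx xT'] := andP xT; have [Ty yT'] := andP yT.
have zd : differentiable f z.
  by apply: fd; [lra|lra|apply: contra nr => /andP[/andP[? ?] /andP[? ?]]; lra].
have [g [gE gd gz]] := difference_quotient zd.
have gc u v : - T <= u <= T -> - T <= v <= T -> ~~ ((- r < u < r) && (- r < v < r)) ->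
    {for (u +i* v)%C, continuous g}.
  move=> uT vT uv; have [->|ne] := eqVneq (u +i* v)%C z; first exact: gz.
  by apply: differentiable_continuous; apply: gd; [exact: ne|exact: fd].
have rr : - r < r by lra.
have TT : - T < T by lra.
have nTr : - T < - r by lra.
have nrT : - r < T by lra.
have Tr : - T < r by lra.
have out (u v : R) : u <= - r \/ r <= u \/ v <= - r \/ r <= v -> ~~ ((- r < u < r) && (- r < v < r)).
  by case=> [h|[h|[h|h]]]; apply/negP => /andP[/andP[h1 h2] /andP[h3 h4]];
    rewrite ?(le_gtF h) // in h1 h2 h3 h4.
have sub0 a b c d : - T <= a -> a < b -> b <= T -> - T <= c -> c < d -> d <= T ->
    b <= - r \/ r <= a \/ d <= - r \/ r <= c -> rint a b c d g = 0.
  move=> h1 h2 h3 h4 h5 h6 bd.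
  have uT u : a <= u <= b -> - T <= u <= T.
    by move=> /andP[au ub]; rewrite (le_trans h1 au) (le_trans ub h3).
  have vT v : c <= v <= d -> - T <= v <= T.
    by move=> /andP[cv vd]; rewrite (le_trans h4 cv) (le_trans vd h6).
  have o u v : a <= u <= b -> c <= v <= d -> ~~ ((- r < u < r) && (- r < v < r)).
    move=> /andP[au ub] /andP[cv vd]; apply: out.
    case: bd => [h|[h|[h|h]]]; [left|right; left|right; right; left|right; right; right].
    - exact: le_trans ub h.
    - exact: le_trans h au.
    - exact: le_trans vd h.
    - exact: le_trans h cv.
  apply: (goursat (z0 := z) h2 h5).
    by move=> u v uab vcd; apply: gc; [exact: uT|exact: vT|exact: o].
  move=> u v uab vcd ne; apply: gd; first exact: ne.
  by apply: fd; [exact: uT|exact: vT|exact: o].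
have bc a b c d : - T <= a -> b <= T -> - T <= c -> d <= T ->
    a <= - r -> r <= b -> c <= - r -> r <= d -> bcont a b c d g.
  move=> h1 h2 h3 h4 h5 h6 h7 h8 u v /andP[au ub] /andP[cv vd] bd; apply: gc.
  - by rewrite (le_trans h1 au) (le_trans ub h2).
  - by rewrite (le_trans h3 cv) (le_trans vd h4).
  apply: out; case/or4P: bd => /eqP ->;
    [by left|by right; left|by right; right; left|by right; right; right].
(* The square annulus is cut into four rectangles: the left and right strips of full height, then
   the bottom and top pieces between them. *)
have g0 : rint (- T) T (- T) T g = rint (- r) r (- r) r g.
  have := (ltW nTr, ltW nrT, ltW TT, ltW rr, ltW rT, ltW Tr) => le.
  rewrite (@rint_catH _ (- T) (- r) T); try by rewrite le.
    rewrite (sub0 (- T) (- r)) ?le ?lexx //; last by left.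
    rewrite add0r (@rint_catH _ (- r) r T); try by rewrite le.
      rewrite (sub0 r T) ?le ?lexx //; last by right; left.
      rewrite addr0 (@rint_catV _ _ _ (- T) (- r) T); try by rewrite le.
        rewrite (sub0 _ _ (- T) (- r)) ?le ?lexx //; last by right; right; left.
        rewrite add0r (@rint_catV _ _ _ (- r) r T); try by rewrite le.
          by rewrite (sub0 _ _ r T) ?le ?lexx ?addr0 //; right; right; right.
        by apply: bc; rewrite ?le ?lexx.
      by apply: bc; rewrite ?le ?lexx.
    by apply: bc; rewrite ?le ?lexx.
  by apply: bc; rewrite ?le ?lexx.
have fc a : r <= a <= T -> bcont (- a) a (- a) a f.
  move=> /andP[ra aT] u v /andP[au ua] /andP[av va] bd; apply: differentiable_continuous.
  have na : - T <= - a by rewrite lerN2.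
  apply: fd.
  - by rewrite (le_trans na au) (le_trans ua aT).
  - by rewrite (le_trans na av) (le_trans va aT).
  by apply: out; case/or4P: bd => /eqP ->; rewrite ?lerN2;
    [left|right; left|right; right; left|right; right; right].
have zr u v : - r <= u <= r -> - r <= v <= r -> (u +i* v)%C != z.
  by move=> h1 h2; apply: contraNneq nr => -[<- <-]; rewrite h1 h2.
have Tq := rint_quotient (ltW TT) (ltW TT) (fc T _) _ gE.
have rq := rint_quotient (ltW rr) (ltW rr) (fc r _) _ gE.
move: g0; rewrite Tq ?lexx ?ltW //; last by move=> u v _ _; exact: bnd_neq.
rewrite rq ?lexx ?ltW //; last by move=> u v h1 h2 _; exact: zr.
have -> : rint (- r) r (- r) r (fun w => (w - z)^-1) = 0.
  apply: (goursat (z0 := z) rr rr).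
    by move=> u v h1 h2; apply: continuous_invB; exact: zr.
  by move=> u v h1 h2 _; apply: differentiable_invB; exact: zr.
rewrite (rint_invB xT yT : rint _ _ _ _ (fun w => (w - z)^-1) = _) mulr0 [X in _ = X]subr0 => <-.
by rewrite opprB addrC subrK mulrC.
Qed.

End CauchyFormula.

(** * The additive Cousin problem on a rectangle *)

Section PlaneCousin.
Variable R : realType.
Local Notation C := R[i].
Implicit Types (a b c d x y t e : R).

Lemma subr_swap (V : zmodType) (u v w z : V) : u - v = w - z -> u - w = v - z.
Proof. by move=> /eqP; rewrite subr_eq => /eqP ->; rewrite addrAC [w - z - w]addrAC subrr sub0r addrC. Qed.

Definition orect a b c d (z : C) : Prop :=
  [/\ a < complex.Re z, complex.Re z < b, c < complex.Im z & complex.Im z < d].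

Lemma orect_open a b c d z : orect a b c d z ->
  exists2 e : R, 0 < e & forall w, modc (w - z) < e -> orect a b c d w.
Proof.
move=> [h1 h2 h3 h4].
pose e := Num.min (Num.min (complex.Re z - a) (b - complex.Re z))
                  (Num.min (complex.Im z - c) (d - complex.Im z)).
exists e; first by rewrite /e !lt_min !subr_gt0 h1 h2 h3 h4.
move=> w; rewrite /e !lt_min => /andP[/andP[w1 w2] /andP[w3 w4]].
have /ler_normlP[r1 r2] := Re_le_modc (w - z).
have /ler_normlP[i1 i2] := Im_le_modc (w - z).
have rE : complex.Re (w - z) = complex.Re w - complex.Re z by case: w {w1 w2 w3 w4 r1 r2 i1 i2}; case: z {h1 h2 h3 h4 e}.
have iE : complex.Im (w - z) = complex.Im w - complex.Im z by case: w {w1 w2 w3 w4 r1 r2 i1 i2 rE}; case: z {h1 h2 h3 h4 e}.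
rewrite rE in r1 r2; rewrite iE in i1 i2; split; lra.
Qed.

(** [eH] and [eV] are the Cauchy integrals of f along one horizontal or vertical edge. Each is
    holomorphic off the whole line through its edge, and Cauchy's formula is a signed sum of four of
    them. *)
Definition eH (f : C -> C) a b y z := cint a b (fun t => f (t +i* y)%C * ((t +i* y)%C - z)^-1).
Definition eV (f : C -> C) c d x z := cint c d (fun t => f (x +i* t)%C * ((x +i* t)%C - z)^-1).

Lemma rint_edges (f : C -> C) a b c d z : rint a b c d (fun w => f w * (w - z)^-1) =
  (eH f a b c z - eH f a b d z) + 'i%C * (eV f c d b z - eV f c d a z).
Proof. by []. Qed.

Lemma segH_cst a b y : seg_cont a b (fun t => (t +i* y)%C : C).
Proof. by apply: (@seg_cont_h _ a b y (fun w => w)) => x _; exact: cvg_id. Qed.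

Lemma segV_cst a b x : seg_cont a b (fun t => (x +i* t)%C : C).
Proof. by apply: (@seg_cont_v _ a b x (fun w => w)) => y _; exact: cvg_id. Qed.

Lemma eH_diff f a b y z : a <= b -> (forall x, a <= x <= b -> {for (x +i* y)%C, continuous f}) ->
  complex.Im z != y -> differentiable (eH f a b y) z.
Proof.
move=> ab fc zy; apply: (cint_kernel_diff ab (seg_cont_h fc)); first exact: segH_cst.
by move=> t _; apply: contraNneq zy => <-.
Qed.

Lemma eV_diff f c d x z : c <= d -> (forall y, c <= y <= d -> {for (x +i* y)%C, continuous f}) ->
  complex.Re z != x -> differentiable (eV f c d x) z.
Proof.
move=> ab fc zy; apply: (cint_kernel_diff ab (seg_cont_v fc)); first exact: segV_cst.
by move=> t _; apply: contraNneq zy => <-.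
Qed.

Lemma holD (f g : C -> C) z : differentiable f z -> differentiable g z ->
  differentiable (fun w => f w + g w) z.
Proof. exact: differentiableD. Qed.

Lemma holB (f g : C -> C) z : differentiable f z -> differentiable g z ->
  differentiable (fun w => f w - g w) z.
Proof. exact: differentiableB. Qed.

Lemma holM (f g : C -> C) z : differentiable f z -> differentiable g z ->
  differentiable (fun w => f w * g w) z.
Proof. exact: differentiableM. Qed.

Lemma hol_cst (u : C) z : differentiable (fun _ : C => u) z.
Proof. exact: differentiable_cst. Qed.

Lemma holZ (u : C) (f : C -> C) z : differentiable f z -> differentiable (fun w => u * f w) z.
Proof. by move=> fd; apply: holM; [exact: hol_cst|exact: fd]. Qed.

(* Cauchy's formula on a small rectangle around the common edge, its four
   edges being shared out between the two sides. *)
Lemma splitH m c d e (f : C -> C) : 0 < e -> c <= d ->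
  (forall z, orect (m - e) (m + e) (c - e) (d + e) z -> differentiable f z) ->
  exists f1 f2 : C -> C, [/\
    forall z, complex.Re z < m + e / 2 -> c - e / 2 < complex.Im z < d + e / 2 -> differentiable f1 z,
    forall z, m - e / 2 < complex.Re z -> c - e / 2 < complex.Im z < d + e / 2 -> differentiable f2 z &
    forall z, orect (m - e / 2) (m + e / 2) (c - e / 2) (d + e / 2) z -> f z = f1 z - f2 z].
Proof.
move=> e0 cd fd; set h := e / 2; have h0 : 0 < h by rewrite divr_gt0.
have he : h < e by rewrite /h; lra.
have fd' x y : m - h <= x <= m + h -> c - h <= y <= d + h -> differentiable f (x +i* y)%C.
  by move=> /andP[? ?] /andP[? ?]; apply: fd; split => /=; lra.
have fc x y : m - h <= x <= m + h -> c - h <= y <= d + h -> {for (x +i* y)%C, continuous f}.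
  by move=> ? ?; apply: differentiable_continuous; exact: fd'.
exists (fun z => (tau R)^-1 * ((eH f (m - h) (m + h) (c - h) z - eH f (m - h) (m + h) (d + h) z) +
                         'i%C * eV f (c - h) (d + h) (m + h) z)).
exists (fun z => (tau R)^-1 * ('i%C * eV f (c - h) (d + h) (m - h) z)); split.
- move=> z z1 /andP[z2 z3]; apply: holZ; apply: holD; first apply: holB.
  + apply: eH_diff; [lra|by move=> x xm; apply: fc; lra|by rewrite gt_eqF].
  + apply: eH_diff; [lra|by move=> x xm; apply: fc; lra|by rewrite lt_eqF].
  + apply: holZ; apply: eV_diff; [lra|by move=> y ym; apply: fc; lra|by rewrite lt_eqF].
- move=> z z1 /andP[z2 z3]; apply: holZ; apply: holZ.
  by apply: eV_diff; [lra|by move=> y ym; apply: fc; lra|by rewrite gt_eqF].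
move=> [x y] [/= z1 z2 z3 z4].
have := @cauchy_formula R (m - h) (m + h) (c - h) (d + h) x y f ltac:(lra) ltac:(lra) fd'.
rewrite rint_edges => fE; rewrite -mulrBr; apply: (mulfI (tau_neq0 R)).
rewrite -fE mulrA divff ?tau_neq0 // mul1r; ring.
Qed.

Lemma splitV m a b e (f : C -> C) : 0 < e -> a <= b ->
  (forall z, orect (a - e) (b + e) (m - e) (m + e) z -> differentiable f z) ->
  exists f1 f2 : C -> C, [/\
    forall z, complex.Im z < m + e / 2 -> a - e / 2 < complex.Re z < b + e / 2 -> differentiable f1 z,
    forall z, m - e / 2 < complex.Im z -> a - e / 2 < complex.Re z < b + e / 2 -> differentiable f2 z &
    forall z, orect (a - e / 2) (b + e / 2) (m - e / 2) (m + e / 2) z -> f z = f1 z - f2 z].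
Proof.
move=> e0 cd fd; set h := e / 2; have h0 : 0 < h by rewrite divr_gt0.
have he : h < e by rewrite /h; lra.
have fd' x y : a - h <= x <= b + h -> m - h <= y <= m + h -> differentiable f (x +i* y)%C.
  by move=> /andP[? ?] /andP[? ?]; apply: fd; split => /=; lra.
have fc x y : a - h <= x <= b + h -> m - h <= y <= m + h -> {for (x +i* y)%C, continuous f}.
  by move=> ? ?; apply: differentiable_continuous; exact: fd'.
(* The two vertical edges bound the strip in which both functions are considered, so either could
   take them; the top edge must go to the lower function and the bottom edge to the upper one. *)
exists (fun z => (tau R)^-1 * ('i%C * (eV f (m - h) (m + h) (b + h) z - eV f (m - h) (m + h) (a - h) z)
                         - eH f (a - h) (b + h) (m + h) z)).
exists (fun z => (tau R)^-1 * (-1 * eH f (a - h) (b + h) (m - h) z)); split.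
- move=> z z1 /andP[z2 z3]; apply: holZ; apply: holB; first (apply: holZ; apply: holB).
  + apply: eV_diff; [lra|by move=> x xm; apply: fc; lra|by rewrite lt_eqF].
  + apply: eV_diff; [lra|by move=> x xm; apply: fc; lra|by rewrite gt_eqF].
  + apply: eH_diff; [lra|by move=> y ym; apply: fc; lra|by rewrite lt_eqF].
- move=> z z1 /andP[z2 z3]; apply: holZ; apply: holZ.
  by apply: eH_diff; [lra|by move=> y ym; apply: fc; lra|by rewrite gt_eqF].
move=> [x y] [/= z1 z2 z3 z4].
have := @cauchy_formula R (a - h) (b + h) (m - h) (m + h) x y f ltac:(lra) ltac:(lra) fd'.
rewrite rint_edges => fE; rewrite -mulrBr; apply: (mulfI (tau_neq0 R)).
rewrite -fE mulrA divff ?tau_neq0 // mul1r; ring.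
Qed.

Section Cousin.
Variables (I : Type) (V : I -> C -> Prop) (cc : I -> I -> C -> C).
Hypothesis V_open : forall i z, V i z -> exists2 e : R, 0 < e & forall w, modc (w - z) < e -> V i w.
Hypothesis V_cover : forall z, exists i, V i z.
Hypothesis cc_diff : forall i j z, V i z -> V j z -> differentiable (cc i j) z.
Hypothesis cc_cocycle : forall i j k z, V i z -> V j z -> V k z ->
  cc j k z - cc i k z + cc i j z = 0.

Definition primitive (S : C -> Prop) (h : I -> C -> C) :=
  (forall i z, V i z -> S z -> differentiable (h i) z) /\
  (forall i j z, V i z -> V j z -> S z -> cc i j z = h j z - h i z).

(** The margin e makes adjacent rectangles overlap in a neighbourhood of their common edge, which
    gives Cauchy's formula room there. *)
Let solvable a b c d :=
  exists2 e : R, 0 < e & exists h, primitive (orect (a - e) (b + e) (c - e) (d + e)) h.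

Let near_diff2 i z (S : C -> Prop) (f g : C -> C) : V i z -> S z ->
  (forall w, S w -> exists2 e : R, 0 < e & forall v, modc (v - w) < e -> S v) ->
  (forall w, V i w -> S w -> f w = g w) -> differentiable f z -> differentiable g z.
Proof.
move=> Vz Sz So fg; have [e1 e10 e1P] := V_open Vz; have [e2 e20 e2P] := So _ Sz.
apply: (@modc_near_eq _ _ _ _ (Num.min e1 e2)); first by rewrite lt_min e10.
by move=> w; rewrite lt_min => /andP[w1 w2]; apply: fg; [exact: e1P|exact: e2P].
Qed.

(** Two primitives of the same cocycle differ by a function independent of the index. An index is
    chosen at each point; near the point any fixed index gives the same values, whence
    differentiability. *)
Let difference (S : C -> Prop) (h1 h2 : I -> C -> C) :
  (forall w, S w -> exists2 e : R, 0 < e & forall v, modc (v - w) < e -> S v) ->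
  (forall i z, V i z -> S z -> differentiable (h1 i) z /\ differentiable (h2 i) z) ->
  (forall i j z, V i z -> V j z -> S z -> h1 j z - h1 i z = h2 j z - h2 i z) ->
  exists2 f : C -> C, (forall z, S z -> differentiable f z) &
    forall i z, V i z -> S z -> f z = h1 i z - h2 i z.
Proof.
move=> So hd hE; have [ix ixP] := choice V_cover.
have fE i z : V i z -> S z -> h1 i z - h2 i z = h1 (ix z) z - h2 (ix z) z.
  move=> Vz Sz; exact/subr_swap/(hE _ _ _ (ixP z) Vz Sz).
exists (fun z => h1 (ix z) z - h2 (ix z) z); last by move=> i z Vz Sz; rewrite -(fE i).
move=> z Sz; have [d1 d2] := hd _ _ (ixP z) Sz.
by apply: (near_diff2 (ixP z) Sz So) (holB d1 d2) => w Vw Sw; exact: fE.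
Qed.

Let orectS a b c d a' b' c' d' z : a' <= a -> b <= b' -> c' <= c -> d <= d' ->
  orect a b c d z -> orect a' b' c' d' z.
Proof. by move=> ? ? ? ? [? ? ? ?]; split; lra. Qed.

Let primitiveS (S S' : C -> Prop) h : (forall z, S z -> S' z) -> primitive S' h -> primitive S h.
Proof.
by move=> SS [p1 p2]; split=> [i z Vz|i j z Vi Vj] /SS Sz; [exact: p1|exact: p2].
Qed.

(** Corrected by [f1] and [f2], the two primitives agree on the overlap, so a case distinction
    defines the common one. *)
Let glue (S1 S2 : C -> Prop) (h1 h2 : I -> C -> C) (f1 f2 : C -> C) :
  (forall w, S1 w -> exists2 e : R, 0 < e & forall v, modc (v - w) < e -> S1 v) ->
  (forall w, S2 w -> exists2 e : R, 0 < e & forall v, modc (v - w) < e -> S2 v) ->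
  primitive S1 h1 -> primitive S2 h2 ->
  (forall z, S1 z -> differentiable f1 z) -> (forall z, S2 z -> differentiable f2 z) ->
  (forall i z, V i z -> S1 z -> S2 z -> h1 i z - h2 i z = f1 z - f2 z) ->
  exists h, primitive (fun z => S1 z \/ S2 z) h.
Proof.
move=> o1 o2 [h1d h1E] [h2d h2E] f1d f2d hf.
pose h i z := if `[< S1 z >] then h1 i z - f1 z else h2 i z - f2 z.
have hE1 i z : S1 z -> h i z = h1 i z - f1 z by move=> s1; rewrite /h asboolT.
have hE2 i z : V i z -> S2 z -> h i z = h2 i z - f2 z.
  by move=> Vz s2; rewrite /h; case: asboolP => [s1|//]; apply: subr_swap; exact: hf.
exists h; split=> [i z Vz [s|s]|i j z Vi Vj [s|s]].
- apply: (near_diff2 Vz s o1) (holB (h1d _ _ Vz s) (f1d _ s)) => w _ s'.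
  by rewrite hE1.
- apply: (near_diff2 Vz s o2) (holB (h2d _ _ Vz s) (f2d _ s)) => w Vw s'.
  by rewrite hE2.
- by rewrite !hE1 // (h1E _ _ _ Vi Vj s) opprB addrA subrK.
- by rewrite !hE2 // (h2E _ _ _ Vi Vj s) opprB addrA subrK.
Qed.

Let mergeH a m b c d : a < m -> m < b -> c < d -> solvable a m c d -> solvable m b c d -> solvable a b c d.
Proof.
move=> am mb cd [e1 e10 [h1 p1]] [e2 e20 [h2 p2]].
pose e := Num.min e1 e2; have e0 : 0 < e by rewrite lt_min e10.
have ee1 : e <= e1 by rewrite ge_min lexx.
have ee2 : e <= e2 by rewrite ge_min lexx orbT.
have {}p1 : primitive (orect (a - e) (m + e) (c - e) (d + e)) h1.
  by apply: primitiveS p1 => z; apply: orectS; lra.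
have {}p2 : primitive (orect (m - e) (b + e) (c - e) (d + e)) h2.
  by apply: primitiveS p2 => z; apply: orectS; lra.
have s1 z : orect (m - e) (m + e) (c - e) (d + e) z -> orect (a - e) (m + e) (c - e) (d + e) z.
  by apply: orectS; lra.
have s2 z : orect (m - e) (m + e) (c - e) (d + e) z -> orect (m - e) (b + e) (c - e) (d + e) z.
  by apply: orectS; lra.
have [f fd fE] := difference (@orect_open _ _ _ _)
  (fun i z Vz oz => conj (p1.1 i z Vz (s1 z oz)) (p2.1 i z Vz (s2 z oz)))
  (fun i j z Vi Vj oz => etrans (esym (p1.2 i j z Vi Vj (s1 z oz))) (p2.2 i j z Vi Vj (s2 z oz))).
have [f1 [f2 [f1d f2d f12]]] := splitH e0 (ltW cd) fd.
(* The splitting is valid on half the margin, so the merged rectangle keeps the margin e/2. *)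
move: f1d f2d f12; set u := e / 2 => f1d f2d f12; have u0 : 0 < u by rewrite divr_gt0.
have ue : u <= e by rewrite ger_pMr // invf_le1 // ler1n.
have ouE a' b' z : orect (a' - u) (b' + u) (c - u) (d + u) z -> orect (a' - e) (b' + e) (c - e) (d + e) z.
  by apply: orectS; rewrite ?lerD2l ?lerN2.
have [h hp] : exists h, primitive (fun z => orect (a - u) (m + u) (c - u) (d + u) z \/
    orect (m - u) (b + u) (c - u) (d + u) z) h.
  apply: (glue (h1 := h1) (h2 := h2) (f1 := f1) (f2 := f2) (@orect_open _ _ _ _) (@orect_open _ _ _ _)).
  - exact: primitiveS (ouE a m) p1.
  - exact: primitiveS (ouE m b) p2.
  - by move=> z [_ z2 z3 z4]; apply: f1d; rewrite ?z3.
  - by move=> z [z1 _ z3 z4]; apply: f2d; rewrite ?z3.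
  move=> i z Vz [z1 z2 z3 z4] [z5 z6 _ _].
  have oz : orect (m - u) (m + u) (c - u) (d + u) z by split.
  by rewrite -(f12 _ oz) (fE i z Vz) //; exact: ouE.
exists u => //; exists h; apply: primitiveS hp => z [z1 z2 z3 z4].
have [zm|mz] := ltP (complex.Re z) m; [left|right]; split=> //.
  by rewrite (lt_trans zm) // ltrDl.
by rewrite (lt_le_trans _ mz) // gtrBl.
Qed.

Let mergeV a b c m d : a < b -> c < m -> m < d -> solvable a b c m -> solvable a b m d -> solvable a b c d.
Proof.
move=> ab cm md [e1 e10 [h1 p1]] [e2 e20 [h2 p2]].
pose e := Num.min e1 e2; have e0 : 0 < e by rewrite lt_min e10.
have ee1 : e <= e1 by rewrite ge_min lexx.
have ee2 : e <= e2 by rewrite ge_min lexx orbT.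
have {}p1 : primitive (orect (a - e) (b + e) (c - e) (m + e)) h1.
  by apply: primitiveS p1 => z; apply: orectS; lra.
have {}p2 : primitive (orect (a - e) (b + e) (m - e) (d + e)) h2.
  by apply: primitiveS p2 => z; apply: orectS; lra.
have s1 z : orect (a - e) (b + e) (m - e) (m + e) z -> orect (a - e) (b + e) (c - e) (m + e) z.
  by apply: orectS; lra.
have s2 z : orect (a - e) (b + e) (m - e) (m + e) z -> orect (a - e) (b + e) (m - e) (d + e) z.
  by apply: orectS; lra.
have [f fd fE] := difference (@orect_open _ _ _ _)
  (fun i z Vz oz => conj (p1.1 i z Vz (s1 z oz)) (p2.1 i z Vz (s2 z oz)))
  (fun i j z Vi Vj oz => etrans (esym (p1.2 i j z Vi Vj (s1 z oz))) (p2.2 i j z Vi Vj (s2 z oz))).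
have [f1 [f2 [f1d f2d f12]]] := splitV e0 (ltW ab) fd.
move: f1d f2d f12; set u := e / 2 => f1d f2d f12; have u0 : 0 < u by rewrite divr_gt0.
have ue : u <= e by rewrite ger_pMr // invf_le1 // ler1n.
have ouE c' d' z : orect (a - u) (b + u) (c' - u) (d' + u) z -> orect (a - e) (b + e) (c' - e) (d' + e) z.
  by apply: orectS; rewrite ?lerD2l ?lerN2.
have [h hp] : exists h, primitive (fun z => orect (a - u) (b + u) (c - u) (m + u) z \/
    orect (a - u) (b + u) (m - u) (d + u) z) h.
  apply: (glue (h1 := h1) (h2 := h2) (f1 := f1) (f2 := f2) (@orect_open _ _ _ _) (@orect_open _ _ _ _)).
  - exact: primitiveS (ouE c m) p1.
  - exact: primitiveS (ouE m d) p2.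
  - by move=> z [z1 z2 _ z4]; apply: f1d; rewrite ?z1.
  - by move=> z [z1 z2 z3 _]; apply: f2d; rewrite ?z1.
  move=> i z Vz [z1 z2 z3 z4] [_ _ z5 z6].
  have oz : orect (a - u) (b + u) (m - u) (m + u) z by split.
  by rewrite -(f12 _ oz) (fE i z Vz) //; exact: ouE.
exists u => //; exists h; apply: primitiveS hp => z [z1 z2 z3 z4].
have [zm|mz] := ltP (complex.Im z) m; [left|right]; split=> //.
  by rewrite (lt_trans zm) // ltrDl.
by rewrite (lt_le_trans _ mz) // gtrBl.
Qed.

Lemma cousin_plane a b c d : a < b -> c < d -> exists h, primitive (orect a b c d) h.
Proof.
move=> ab cd; suff [e e0 [h hp]] : solvable a b c d.
  by exists h; apply: primitiveS hp => z; apply: orectS; lra.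
apply: (rect_cousin (P := solvable) ab cd).
- by move=> *; apply: mergeH; eassumption.
- by move=> *; apply: mergeV; eassumption.
move=> x y xab ycd; have [i Vi] := V_cover (x +i* y)%C; have [e e0 eP] := V_open Vi.
set D1 := b - a; set D2 := d - c.
have DD : 0 < D1 + D2 by rewrite /D1 /D2; lra.
(* The rectangle has sides of total length below e/4; with a margin e/4 in both directions it stays
   within distance 3e/4 of the point, hence in [V i]. *)
exists (e / 4 / (D1 + D2)); first by rewrite !divr_gt0.
move=> l a' c' l0; rewrite ltr_pdivlMr // => l1 aa bb cc0 dd xa yc.
rewrite -/D1 -/D2 in bb dd xa yc *.
have inV z : orect (a' - e / 4) (a' + l * D1 + e / 4) (c' - e / 4) (c' + l * D2 + e / 4) z -> V i z.
  case: z => u v [/= z1 z2 z3 z4]; apply: eP; apply: le_lt_trans (modc_le _) _ => /=.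
  rewrite mulrDr in l1; have d1 : `|u - x| <= l * D1 + e / 4 by rewrite ler_norml; lra.
  have d2 : `|v - y| <= l * D2 + e / 4 by rewrite ler_norml; lra.
  lra.
exists (e / 4); first by rewrite divr_gt0.
(* Inside a single [V i] the cocycle relation says that [cc i] is itself a primitive. *)
exists (cc i); split => [j z Vj /inV Vz|j k z Vj Vk /inV Vz]; first exact: cc_diff.
by have /eqP := cc_cocycle Vz Vj Vk; rewrite addrAC subr_eq0 => /eqP <-; rewrite addrK.
Qed.

End Cousin.
End PlaneCousin.

(** * Laurent splitting and entire functions *)

Section EntireLaurent.
Variable R : realType.
Local Notation C := R[i].
Implicit Types (a b c d x y t e : R).

Lemma rint_kernel_diff a b c d (p q : C -> C) z : a <= b -> c <= d ->
  bcont a b c d p -> bcont a b c d q ->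
  (forall x y, a <= x <= b -> c <= y <= d -> [|| x == a, x == b, y == c | y == d] -> q (x +i* y)%C != z) ->
  differentiable (fun z : C => rint a b c d (fun w => p w * (q w - z)^-1)) (z : C).
Proof.
move=> ab cd pc qc qz; rewrite /rint; apply: holD; first apply: holB.
- apply: (cint_kernel_diff ab (bcont_bot cd pc) (bcont_bot cd qc)) => t tab.
  by apply: qz; rewrite ?lexx ?cd ?eqxx ?orbT.
- apply: (cint_kernel_diff ab (bcont_top cd pc) (bcont_top cd qc)) => t tab.
  by apply: qz; rewrite ?lexx ?cd ?eqxx ?orbT.
apply: holZ; apply: holB.
- apply: (cint_kernel_diff cd (bcont_right ab pc) (bcont_right ab qc)) => t tab.
  by apply: qz; rewrite ?lexx ?ab ?eqxx ?orbT.
- apply: (cint_kernel_diff cd (bcont_left ab pc) (bcont_left ab qc)) => t tab.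
  by apply: qz; rewrite ?lexx ?ab ?eqxx ?orbT.
Qed.

Lemma bcont_id a b c d : bcont a b c d (fun w : C => w).
Proof. by move=> x y _ _ _; exact: cvg_id. Qed.

Lemma bcontM a b c d (f g : C -> C) : bcont a b c d f -> bcont a b c d g ->
  bcont a b c d (fun w => f w * g w).
Proof. by move=> fc gc x y h1 h2 h3; apply: continuousM; [exact: fc|exact: gc]. Qed.

Lemma bcontX a b c d n : bcont a b c d (fun w : C => w ^+ n).
Proof.
elim: n => [|n IH]; first by move=> x y _ _ _; exact: cst_continuous.
rewrite (_ : (fun w => _) = (fun w => w * w ^+ n)); last by apply/funext => w; rewrite exprS.
by apply: bcontM; [exact: bcont_id|exact: IH].
Qed.

Lemma bcontZ a b c d u (f : C -> C) : bcont a b c d f -> bcont a b c d (fun w => u * f w).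
Proof. by move=> fc x y h1 h2 h3; apply: continuousM; [exact: cst_continuous|exact: fc]. Qed.

(** By [cauchy_annulus], f is an outer integral, holomorphic inside, minus an inner one. The latter
    is expanded in powers of z^-1 by N steps of the geometric series; its remainder is still an
    integral depending holomorphically on z^-1. *)
Lemma laurent_split (f : C -> C) (N : nat) :
  (forall z, 8^-1 < modc z -> modc z < 8 -> differentiable f z) ->
  exists (f1 g : C -> C) (s : nat -> C), [/\
    forall z, modc z < 2 -> differentiable f1 z,
    forall w, modc w < 2 -> differentiable g w &
    forall z, 2^-1 < modc z -> modc z < 2 ->
      f z = f1 z + \sum_(j < N) s j * z^-1 ^+ j.+1 + z^-1 ^+ N.+1 * g z^-1].
Proof.
(* The square of half side 3 has its boundary outside |z| < 2 and lies in |z| <= 6; that of half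
   side 1/4 lies in |z| <= 1/2 and has its boundary in |z| >= 1/4. Both boundaries stay inside the
   annulus. *)
move=> fd; pose r : R := 4^-1; pose T : R := 3.
have r0 : 0 < r by rewrite /r; lra.
have rT : r < T by rewrite /r /T; lra.
have ReM x y : `|x| <= modc (x +i* y)%C by exact: (Re_le_modc (x +i* y)%C).
have ImM x y : `|y| <= modc (x +i* y)%C by exact: (Im_le_modc (x +i* y)%C).
have fd' u v : - T <= u <= T -> - T <= v <= T -> ~~ ((- r < u < r) && (- r < v < r)) ->
    differentiable f (u +i* v)%C.
  move=> uT vT n; apply: fd; last first.
    apply: le_lt_trans (modc_le _) _ => /=.
    move: uT vT; rewrite -!ler_norml /T; lra.
  have rr : 8^-1 < r by rewrite /r; lra.
  move: n; rewrite -!ltr_norml negb_and -!leNgt => /orP[h|h]; apply: lt_le_trans rr _.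
    exact: le_trans h (ReM _ _).
  exact: le_trans h (ImM _ _).
have fcT : bcont (- T) T (- T) T f.
  move=> u v uT vT bd; apply: differentiable_continuous; apply: fd' => //.
  apply/negP => /andP[/andP[? ?] /andP[? ?]].
  by case/or4P: bd => /eqP; lra.
have fcr : bcont (- r) r (- r) r f.
  move=> u v /andP[? ?] /andP[? ?] bd; apply: differentiable_continuous; apply: fd'; [lra|lra|].
  apply/negP => /andP[/andP[? ?] /andP[? ?]].
  by case/or4P: bd => /eqP; lra.
have nzr u v : [|| u == - r, u == r, v == - r | v == r] -> (u +i* v)%C != 0.
  by move=> bd; apply/eqP => -[eu ev]; case/or4P: bd => /eqP; lra.
have invr : bcont (- r) r (- r) r (fun w : C => w^-1).
  by move=> u v _ _ bd; apply: continuousV; [exact: nzr|exact: cvg_id].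
have small u v : - r <= u <= r -> - r <= v <= r -> modc (u +i* v)%C <= 2^-1.
  by rewrite -!ler_norml => h1 h2; apply: le_trans (modc_le _) _ => /=; rewrite /r in h1 h2; lra.
have sep w u v : modc w < 2 -> - r <= u <= r -> - r <= v <= r ->
    [|| u == - r, u == r, v == - r | v == r] -> (u +i* v)%C^-1 != w.
  move=> w2 ur vr bd; apply/eqP => e; move: w2; rewrite -e modcV ltNge => /negP; apply.
  rewrite -[leLHS]invrK lef_pV2 ?posrE ?invr_gt0 //; last by rewrite modc_gt0 nzr.
  exact: small.
(* This is f(u) u^N / (1 - w u), written with u^-1 so that it has the shape p / (q - w) of
   [rint_kernel_diff]. *)
pose ker N w u : C := f u * u ^+ N * u^-1 * (u^-1 - w)^-1.
have kc0 n : bcont (- r) r (- r) r (fun u => f u * u ^+ n).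
  by apply: bcontM; [exact: fcr|exact: bcontX].
have kc n w : modc w < 2 -> bcont (- r) r (- r) r (ker n w).
  move=> w2; apply: bcontM; first by apply: bcontM; [exact: kc0|exact: invr].
  move=> u v ur vr bd; apply: continuousV; first by rewrite subr_eq0 sep.
  by apply: continuousB; [exact: invr|exact: cst_continuous].
have rr : - r <= r by lra.
pose smallI z := rint (- r) r (- r) r (fun u => f u * (u - z)^-1).
have expand z n : 2^-1 < modc z -> - smallI z =
    \sum_(j < n) rint (- r) r (- r) r (fun u => f u * u ^+ j) * z^-1 ^+ j.+1
    + z^-1 ^+ n.+1 * rint (- r) r (- r) r (ker n z^-1).
  move=> z2; have z0 : z != 0 by rewrite -modc_gt0; lra.
  have iz : modc z^-1 < 2 by rewrite modcV -[ltRHS]invrK ltf_pV2 ?posrE ?invr_gt0 // modc_gt0.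
  elim: n => [|n IH].
    have fk : bcont (- r) r (- r) r (fun u => f u * (u - z)^-1).
      apply: bcontM; first exact: fcr.
      move=> u v ur vr bd; apply: continuous_invB; apply: contraTneq z2 => <-.
      by rewrite -leNgt small.
    rewrite big_ord0 add0r expr1 -(rintZ _ rr rr (kc 0%N _ iz)) -mulN1r -(rintZ _ rr rr fk).
    apply: (eq_rint rr rr) => u v ur vr bd; rewrite /ker expr0 mulr1.
    have u0 := nzr u v bd; have uz : (u +i* v)%C^-1 != z^-1 by exact: sep.
    have uz' : (u +i* v)%C - z != 0 by rewrite subr_eq0; apply: contraNneq uz => ->.
    move: uz; rewrite -subr_eq0; move: (u +i* v)%C u0 uz' => U u0 uz' uz.
    have -> : U^-1 - z^-1 = (z - U) * (U^-1 * z^-1).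
      by rewrite mulrBl [U * _]mulrA divff // mul1r mulrCA divff // mulr1.
    have zu : z - U != 0 by rewrite -opprB oppr_eq0.
    by field; rewrite uz' zu u0 z0.
  rewrite IH big_ord_recr /= -addrA; congr (_ + _).
  have c1 := kc0 n; have c2 := kc n.+1 _ iz.
  have -> : rint (- r) r (- r) r (ker n z^-1) = rint (- r) r (- r) r (fun u => f u * u ^+ n + z^-1 * ker n.+1 z^-1 u).
    apply: (eq_rint rr rr) => u v ur vr bd; rewrite /ker.
    have u0 := nzr u v bd; have uz : (u +i* v)%C^-1 - z^-1 != 0 by rewrite subr_eq0 sep.
    move: (u +i* v)%C u0 uz => U u0; rewrite exprS.
    move: (z^-1) => W uw; have uw1 : 1 - W * U != 0.
      have -> : 1 - W * U = (U^-1 - W) * U by rewrite mulrBl mulVf.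
      by rewrite mulf_neq0.
    have -> : U^-1 - W = (1 - W * U) * U^-1 by rewrite mulrBl mul1r mulfK.
    by field; rewrite uw1 u0.
  rewrite (rintD rr rr c1 (bcontZ c2)) (rintZ _ rr rr c2) [z^-1 ^+ n.+2]exprSr.
  by rewrite mulrDr mulrA [_ * rint _ _ _ _ (fun u => f u * u ^+ n)]mulrC.
exists (fun z => (tau R)^-1 * rint (- T) T (- T) T (fun w => f w * (w - z)^-1)).
exists (fun w => (tau R)^-1 * rint (- r) r (- r) r (ker N w)).
exists (fun j => (tau R)^-1 * rint (- r) r (- r) r (fun u => f u * u ^+ j)); split.
- move=> z z2; apply: holZ; apply: rint_kernel_diff; [rewrite /T; lra|rewrite /T; lra|exact: fcT|exact: bcont_id|].
  move=> x y xT yT bd; apply: contraTneq z2 => <-; rewrite -leNgt.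
  have : 2 <= `|x| \/ 2 <= `|y|.
    have nT : `|T| = 3 by rewrite gtr0_norm /T; lra.
    by case/or4P: bd => /eqP ->; rewrite ?normrN nT; [left|left|right|right]; lra.
  by case=> h; apply: le_trans h _.
- move=> w w2; apply: holZ; rewrite /ker.
  apply: (@rint_kernel_diff (- r) r (- r) r (fun u => f u * u ^+ N * u^-1) (fun u => u^-1) w rr rr); [|exact: invr|].
    by apply: bcontM; [exact: kc0|exact: invr].
  by move=> x y xr yr bd; exact: sep.
move=> z z1 z2; apply: (mulfI (tau_neq0 R)).
case: z z1 z2 => x y z1 z2.
have hn : ~~ ((- r <= x <= r) && (- r <= y <= r)).
  by apply/negP => /andP[h1 h2]; have := small x y h1 h2; lra.
have hx : - T < x < T by rewrite -ltr_norml; apply: le_lt_trans (ReM x y) _; rewrite /T; lra.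
have hy : - T < y < T by rewrite -ltr_norml; apply: le_lt_trans (ImM x y) _; rewrite /T; lra.
rewrite -(cauchy_annulus r0 rT hx hy hn fd').
have tk (u : C) : tau R * ((tau R)^-1 * u) = u by rewrite mulrA divff ?mul1r ?tau_neq0.
have := expand (x +i* y)%C N z1; rewrite /smallI; move: (rint (- r) r _ _ _) => S E.
move: (rint (- T) T _ _ _) => B; rewrite (mulrDr (tau R)) (mulrDr (tau R)) tk mulr_sumr.
rewrite [tau R * (_ ^+ _ * _)]mulrCA tk E addrA; congr (_ + _ + _); apply: eq_bigr => j _.
by rewrite -[_^-1 * _ * _]mulrA tk.
Qed.

(** Cauchy's formula on growing squares. The decay of f is assumed in the form in which it arises
    for sections of O(-1). *)
Lemma liouville0 (f : C -> C) (M : R) : (forall z, differentiable f z) ->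
  (forall z, 1 <= modc z -> modc (f z) * modc z <= M) -> forall z, f z = 0.
Proof.
move=> fd fM z; apply: (mulfI (tau_neq0 R)); rewrite mulr0; apply/eqP.
rewrite -modc_eq0; apply/negPn/negP => q0.
have {q0} : 0 < modc (tau R * f z) by rewrite lt0r q0 modc_ge0.
set q := modc _ => q0.
have M0 : 0 <= M by apply: le_trans (fM 1 _); rewrite ?modc1 // mulr1 modc_ge0.
have zz := modc_ge0 z.
(* On the square of half side |z| + S the integrand is at most M / (T S), so [rint_bound] yields q S
   <= 16 M, while this choice makes q S = q + 32 M. *)
pose S := 1 + 32 * M / q.
have S1 : 1 <= S by rewrite lerDl divr_ge0 ?mulr_ge0 // ltW.
pose T := modc z + S.
have T0 : 0 < T by rewrite /T; lra.
have bd x y : [|| x == - T, x == T, y == - T | y == T] -> T <= modc (x +i* y)%C.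
  move=> h; suff : T <= `|x| \/ T <= `|y|.
    by case=> k; apply: le_trans k _; [exact: (Re_le_modc (x +i* y)%C)|exact: (Im_le_modc (x +i* y)%C)].
  by case/or4P: h => /eqP ->; rewrite ?normrN ?(gtr0_norm T0); [left|left|right|right].
have far x y : [|| x == - T, x == T, y == - T | y == T] -> S <= modc ((x +i* y)%C - z).
  by move=> /bd; have := modcD ((x +i* y)%C - z) z; rewrite subrK /T; lra.
have fc : bcont (- T) T (- T) T f by move=> u v _ _ _; exact: differentiable_continuous.
have kc : bcont (- T) T (- T) T (fun w => f w * (w - z)^-1).
  apply: bcont_div; first exact: fc.
  move=> x y _ _ /far; rewrite -subr_eq0 -modc_gt0; lra.
have TT : - T <= T by lra.
have kb : forall x y, - T <= x <= T -> - T <= y <= T -> [|| x == - T, x == T, y == - T | y == T] ->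
    modc (f (x +i* y)%C * ((x +i* y)%C - z)^-1) <= M / T / S.
  move=> x y xT yT bdy; rewrite modcM modcV.
  have h1 := bd _ _ bdy; have h2 := far _ _ bdy.
  have n0 : 0 < modc ((x +i* y)%C - z) by lra.
  have nT : 0 < modc (x +i* y)%C by lra.
  have h3 : modc (f (x +i* y)%C) <= M / T.
    rewrite ler_pdivlMr //; apply: le_trans (fM (x +i* y)%C _); last by rewrite /T in h1; lra.
    by rewrite ler_wpM2l ?modc_ge0.
  apply: ler_pM; rewrite ?invr_ge0 ?modc_ge0 //.
  by rewrite lef_pV2 ?posrE //; lra.
have := rint_bound TT TT kc kb.
have -> : rint (- T) T (- T) T (fun w => f w * (w - z)^-1) = tau R * f z.
  have hx : `|complex.Re z| < T by apply: le_lt_trans (Re_le_modc z) _; rewrite /T; lra.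
  have hy : `|complex.Im z| < T by apply: le_lt_trans (Im_le_modc z) _; rewrite /T; lra.
  have zE : z = (complex.Re z +i* complex.Im z)%C by case: (z).
  rewrite zE; apply: cauchy_formula; rewrite -?ltr_norml //.
rewrite -/q => h; have : q * S <= 16 * M.
  have -> : 16 * M = 4 * (M / T / S) * (T - - T + (T - - T)) * S.
    have T1 : T != 0 by rewrite gt_eqF.
    by field; rewrite T1 gt_eqF //; lra.
  by apply: ler_wpM2r => //; lra.
have -> : q * S = q + 32 * M by rewrite /S; field; rewrite gt_eqF.
by lra.
Qed.

(** Away from 0 the quotient is holomorphic by construction; near 0 it equals the Cauchy integral of
    f(w)/w, which is holomorphic there. *)
Lemma divided_difference (f : C -> C) : (forall z, differentiable f z) ->
  exists2 g : C -> C, (forall z, differentiable g z) & forall z, f z = f 0 + z * g z.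
Proof.
move=> fd; have h : (-1 < 0 :> R) && (0 < 1 :> R) by apply/andP; split; lra.
have l11 : -1 <= 1 :> R by lra.
have fc : bcont (-1) 1 (-1) 1 f by move=> u v _ _ _; apply: differentiable_continuous; exact: fd.
have fic : bcont (-1) 1 (-1) 1 (fun u => f u * u^-1).
  by apply: bcontM; [exact: fc|exact: bcont_inv].
pose G (z : C) := (tau R)^-1 * rint (-1) 1 (-1) 1 (fun w => f w * w^-1 * (w - z)^-1).
have G0 : differentiable G 0.
  apply: holZ; apply: (@rint_kernel_diff (-1) 1 (-1) 1 (fun u => f u * u^-1) (fun u => u));
    [exact: l11|exact: l11|exact: fic|exact: bcont_id|].
  by move=> x y _ _; exact: bnd_neq.
have GE (z : C) : modc z < 1 -> f z - f 0 = z * G z.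
  move=> z1; apply: (mulfI (tau_neq0 R)).
  have hx : -1 < complex.Re z < 1 by rewrite -ltr_norml; apply: le_lt_trans (Re_le_modc z) _.
  have hy : -1 < complex.Im z < 1 by rewrite -ltr_norml; apply: le_lt_trans (Im_le_modc z) _.
  have zE : (complex.Re z +i* complex.Im z)%C = z by case: (z).
  have nz x y : -1 <= x <= 1 -> -1 <= y <= 1 -> [|| x == -1, x == 1, y == -1 | y == 1] ->
      (x +i* y)%C != z.
    by move=> _ _ bd; rewrite -zE; exact: bnd_neq bd.
  have Ez := @cauchy_formula R (-1) 1 (-1) 1 _ _ f hx hy (fun u v _ _ => fd _).
  have E0 := @cauchy_formula R (-1) 1 (-1) 1 _ _ f h h (fun u v _ _ => fd _).
  rewrite zE in Ez; rewrite mulrBr -Ez -E0 /G.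
  have zc : bcont (-1) 1 (-1) 1 (fun w => f w * (w - z)^-1) by exact: bcont_div.
  have kc : bcont (-1) 1 (-1) 1 (fun w => f w * w^-1 * (w - z)^-1) by exact: bcont_div.
  have oc : bcont (-1) 1 (-1) 1 (fun w => f w * (w - (0 +i* 0)%C)^-1).
    by apply: bcont_div; [exact: fc|move=> x y _ _; exact: bnd_neq].
  rewrite -[- rint _ _ _ _ (fun w => f w * (w - (0 +i* 0)%C)^-1)]mulN1r -(rintZ _ l11 l11 oc) -(rintD l11 l11 zc (bcontZ oc)).
  rewrite mulrCA [tau R * (_ * _)]mulrA divff ?tau_neq0 // mul1r -(rintZ _ l11 l11 kc).
  apply: (eq_rint l11 l11) => x y xb yb bd.
  have n1 := nz x y xb yb bd; have n0 : (x +i* y)%C != (0 +i* 0)%C by exact: bnd_neq bd.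
  move: n1 n0; rewrite -subr_eq0 -[(0 +i* 0)%C]/(0 : C) subr0; move: (x +i* y)%C => U n1 n0.
  by field; rewrite n1 n0.
have [g [gE gd _]] := difference_quotient (fd 0).
pose k z := if z == 0 then G 0 else g z.
exists k => z; last first.
  rewrite /k; case: eqP => [->|/eqP z0]; first by rewrite mul0r addr0.
  by rewrite gE // subr0 mulrC mulfVK // addrC subrK.
have [->|z0] := eqVneq z 0.
  apply: (@modc_near_eq _ G _ _ 1 ltr01 _ G0) => w; rewrite subr0 => w1.
  rewrite /k; case: eqP => [->//|/eqP w0].
  by rewrite gE // subr0 GE // [w * _]mulrC mulfK.
have e0 : 0 < modc (z - 0) by rewrite subr0 modc_gt0.
apply: (@modc_near_eq _ g _ _ (modc (z - 0)) e0); last by apply: gd; [exact: z0|exact: fd].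
move=> w; rewrite /k; case: eqP => // ->.
by rewrite modcB ltxx.
Qed.

End EntireLaurent.

(** * Affine charts, discs and the locality of sections of O(k) *)

Lemma p1_openI (C : numClosedFieldType) (U V : set 'rV[C]_2) :
  p1_open U -> p1_open V -> p1_open (U `&` V).
Proof.
move=> [oU nU sU] [oV nV sV]; split; [exact: openI|by case|].
by move=> x k [Ux Vx] k0; split; [exact: sU|exact: sV].
Qed.

Section Charts.
Variable R : realType.
Local Notation C := R[i].
Local Notation X := 'rV[C]_2.
Implicit Types (b : 'I_2) (x : X) (z w : C) (k : int) (U : set X).

Lemma row2P b (x y : X) : x 0 b = y 0 b -> x 0 (rev_ord b) = y 0 (rev_ord b) -> x = y.
Proof.
move=> h1 h2; apply/rowP => i; have [->//|ib] := eqVneq i b.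
suff -> : i = rev_ord b by [].
by apply/val_inj => /=; move: ib; case: i => [[|[|i]] // ?]; case: b {h1 h2} => [[|[|b]] // ?].
Qed.

Lemma rev_ord2_neq b : (rev_ord b == b) = false.
Proof. by case: b => [[|[|b]] // ?]. Qed.

(** For b in ['I_2], [rev_ord b] is the other index. [pt b] parametrises the chart x_b = 1, and
    [slope b] is its coordinate, invariant under scaling. *)
Definition pt b z : X := \row_i (if i == b then 1 else z).

Lemma pt_b b z : pt b z 0 b = 1. Proof. by rewrite mxE eqxx. Qed.
Lemma pt_r b z : pt b z 0 (rev_ord b) = z. Proof. by rewrite mxE rev_ord2_neq. Qed.

Definition slope b x : C := x 0 (rev_ord b) / x 0 b.

Lemma slopeV b x : slope (rev_ord b) x = (slope b x)^-1.
Proof. by rewrite /slope rev_ordK invf_div. Qed.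

Lemma slopeZ b x (a : C) : a != 0 -> slope b (a *: x) = slope b x.
Proof.
move=> a0; rewrite /slope !mxE; have [->|x0] := eqVneq (x 0 b) 0; first by rewrite mulr0 invr0 !mulr0.
by rewrite invfM mulrACA divff // mul1r.
Qed.

Lemma scale_pt b x : x 0 b != 0 -> x = x 0 b *: pt b (slope b x).
Proof.
move=> x0; apply: (@row2P b); rewrite [RHS]mxE ?pt_b ?pt_r ?mulr1 //.
by rewrite /slope mulrCA divff // mulr1.
Qed.

Lemma pt_rev b z : z != 0 -> pt (rev_ord b) z^-1 = z^-1 *: pt b z.
Proof.
move=> z0; apply: (@row2P b); rewrite [RHS]mxE ?pt_b ?pt_r ?mulVf //.
  by rewrite -[b in pt _ _ 0 b](rev_ordK b) pt_r mulr1.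
Qed.

Lemma pt_neq0 b z : pt b z != 0.
Proof. by apply/eqP => e; have /eqP := pt_b b z; rewrite e mxE eq_sym oner_eq0. Qed.

Lemma pt_diff b z : differentiable (pt b) z.
Proof.
have -> : pt b = (fun z : C => pt b 0 + z *: delta_mx 0 (rev_ord b)).
  apply/funext => w; apply: (@row2P b); rewrite [RHS]mxE [X in _ + X]mxE ?pt_b ?pt_r mxE eqxx /=.
    by rewrite eq_sym rev_ord2_neq mulr0 addr0.
  by rewrite eqxx mulr1 add0r.
apply: differentiableD; first exact: differentiable_cst.
by apply: differentiableZl; exact: hol_id.
Qed.

Lemma coord_diff b x : differentiable (fun x : X => x 0 b : C) x.
Proof. exact: differentiable_coord. Qed.

Lemma near_coord b x (d : R) : 0 < d -> nbhs x [set y : X | modc (y 0 b - x 0 b) < d].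
Proof.
move=> d0; have c : {for x, continuous (fun x : X => x 0 b : C)}.
  exact: differentiable_continuous (coord_diff b x).
have N : nbhs (x 0 b) [set w : C | modc (w - x 0 b) < d] by apply/nearC; exists d.
exact: c _ N.
Qed.

Lemma coord_neq0_open b : p1_open [set x : X | x 0 b != 0].
Proof.
split.
- rewrite openE => x /= x0; have m0 : 0 < modc (x 0 b) by rewrite modc_gt0.
  apply: filterS (near_coord b x m0) => y; apply: contraTneq => ->.
  by rewrite sub0r modcN ltxx.
- by rewrite /= mxE eqxx.
- by move=> x k /= x0 k0; rewrite mxE mulf_neq0.
Qed.

Lemma p1_open_neq0 U x : p1_open U -> U x -> x != 0.
Proof. by move=> [_ n _]; apply: contraPneq => ->. Qed.

(** The form without a quotient forces x_b != 0 by itself and is visibly stable under scaling. *)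
Definition disc b (r : R) : set X := [set x | modc (x 0 (rev_ord b)) < r * modc (x 0 b)].

Lemma disc_neq0 b r x : disc b r x -> x 0 b != 0.
Proof. by apply: contraPneq => e; rewrite /disc /= e modc0 mulr0 => /(le_lt_trans (modc_ge0 _)); rewrite ltxx. Qed.

Lemma discP b r x : disc b r x <-> x 0 b != 0 /\ modc (slope b x) < r.
Proof.
split=> [h|[x0 h]].
  have x0 := disc_neq0 h; split=> //.
  by rewrite /slope modcM modcV ltr_pdivrMr // modc_gt0.
by move: h; rewrite /slope modcM modcV ltr_pdivrMr // modc_gt0.
Qed.

Lemma disc_open b r : 0 < r -> p1_open (disc b r).
Proof.
move=> r0; split.
- rewrite openE => x; rewrite /disc /= => h.
  pose d := (r * modc (x 0 b) - modc (x 0 (rev_ord b))) / (r + 1).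
  have d0 : 0 < d by rewrite divr_gt0 ?subr_gt0 ?addr_gt0.
  have dE : d * r + d = r * modc (x 0 b) - modc (x 0 (rev_ord b)).
    by rewrite /d; field; rewrite gt_eqF ?addr_gt0.
  apply: filterS2 (near_coord b x d0) (near_coord (rev_ord b) x d0) => y h1 h2 /=.
  have := modcD (y 0 (rev_ord b) - x 0 (rev_ord b)) (x 0 (rev_ord b)).
  have h3 := modcD (x 0 b - y 0 b) (y 0 b); rewrite !subrK (modcB (x 0 b)) in h3 *.
  have h4 : modc (x 0 b) <= d + modc (y 0 b) by move: h1 => /=; lra.
  have := ler_wpM2l (ltW r0) h4; rewrite mulrDr; move: h2 => /=; lra.
- by rewrite /disc /= !mxE modc0 mulr0 ltxx.
- move=> x k; rewrite /disc /= => h k0; rewrite !mxE !modcM mulrCA ltr_pM2l //.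
  by rewrite modc_gt0.
Qed.

Lemma disc_cover b x : x != 0 -> disc b 2 x \/ disc (rev_ord b) 2 x.
Proof.
move=> x0; rewrite /disc /= rev_ordK.
have [h|h] := ltP (modc (x 0 (rev_ord b))) (2 * modc (x 0 b)); [by left|right].
suff : 0 < modc (x 0 (rev_ord b)) by have := modc_ge0 (x 0 b); lra.
rewrite modc_gt0; apply: contraNneq x0 => e; move: h; rewrite e modc0 => h.
have /eqP : modc (x 0 b) = 0 by have := modc_ge0 (x 0 b); lra.
rewrite modc_eq0 => /eqP e2; apply/eqP; apply: (@row2P b); by rewrite ?e ?e2 mxE.
Qed.

(* the section of O(k) given by f in the chart x_b != 0 with coordinate [slope b] *)
Definition hlift b k (f : C -> C) : X -> C := fun x => x 0 b ^ k * f (slope b x).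

Lemma slope_diff b x : x 0 b != 0 -> differentiable (slope b) x.
Proof.
move=> x0; apply: differentiableM; first exact: coord_diff.
by apply: differentiableV; [exact: coord_diff|exact: x0].
Qed.

Lemma expn_diff (V : normedModType C) (f : V -> C) n (x : V) : differentiable f x -> differentiable (fun y => f y ^+ n) x.
Proof.
move=> fd; elim: n => [|n IH]; first exact: (differentiable_cst (1 : C)).
rewrite (_ : (fun y => _) = (fun y => f y * f y ^+ n)); last by apply/funext => y; rewrite exprS.
by apply: differentiableM; [exact: fd|exact: IH].
Qed.

Lemma coordX_diff b k x : x 0 b != 0 -> differentiable (fun x : X => x 0 b ^ k) x.
Proof.
case: k => n x0; first by apply: expn_diff; exact: coord_diff.
apply: differentiableV; last by rewrite expf_neq0.
by apply: expn_diff; exact: coord_diff.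
Qed.

Lemma lift_section b k f U : (forall x, U x -> x 0 b != 0 /\ differentiable f (slope b x)) ->
  O_sections k U (hlift b k f).
Proof.
move=> h; split => [x /h[x0 fd]|x a /h[x0 _] a0].
  apply: differentiableM; first exact: coordX_diff.
  by apply: differentiable_comp; [exact: slope_diff|exact: fd].
by rewrite /hlift slopeZ // mxE exprMz_comm ?unitfE //; [rewrite mulrA|exact: mulrC].
Qed.

Lemma section_pt_diff b k U (F : X -> C) z : O_sections k U F -> U (pt b z) ->
  differentiable (fun z : C => F (pt b z)) z.
Proof.
move=> [Fd _] Uz; apply: (@differentiable_comp _ _ _ _ (pt b) F); first exact: pt_diff.
exact: Fd.
Qed.

Lemma section_lift b k U (F : X -> C) x : O_sections k U F -> p1_open U -> U x -> x 0 b != 0 ->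
  F x = hlift b k (fun z => F (pt b z)) x /\ U (pt b (slope b x)).
Proof.
move=> [_ Fh] [_ _ sU] Ux x0.
have Up : U (pt b (slope b x)).
  have -> : pt b (slope b x) = (x 0 b)^-1 *: x.
    by rewrite -[LHS]scale1r -(mulVf x0) -scalerA -scale_pt.
  by apply: sU => //; rewrite invr_eq0.
by split=> //; rewrite {1}(scale_pt x0) Fh.
Qed.

Lemma pt_open b U z : p1_open U -> U (pt b z) ->
  exists2 e : R, 0 < e & forall w, modc (w - z) < e -> U (pt b w).
Proof.
move=> [oU _ _] Uz; apply/nearC.
apply: (differentiable_continuous (pt_diff b z)); exact: open_nbhs_nbhs.
Qed.

(** Differentiability is local on the cone; homogeneity is local too because the open sets V are
    stable under scaling. *)
Lemma O_local k U (F : X -> C) :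
  (forall x, U x -> exists V G, [/\ p1_open V, V x, O_sections k V G & forall y, V y -> F y = G y]) ->
  O_sections k U F.
Proof.
move=> loc; split=> [x /loc[V [G [[oV _ _] Vx [Gd _] FG]]]|x a /loc[V [G [[_ _ sV] Vx [_ Gh] FG]]] a0].
  apply: near_eq_differentiable (Gd _ Vx).
  by apply: filterS (open_nbhs_nbhs (conj oV Vx)) => y Vy; rewrite FG.
by rewrite !FG ?Gh //; exact: sV.
Qed.

Lemma O_sectionsM k l U (F G : X -> C) : O_sections k U F -> O_sections l U G ->
  (forall x, U x -> x != 0) -> O_sections (k + l) U (fun x => F x * G x).
Proof.
move=> [Fd Fh] [Gd Gh] _; split=> [x Ux|x a Ux a0].
  by apply: differentiableM; [exact: Fd|exact: Gd].
by rewrite Fh // Gh // mulrACA expfzDr.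
Qed.

Lemma O_sectionsB k U (F G : X -> C) : O_sections k U F -> O_sections k U G ->
  O_sections k U (fun x => F x - G x).
Proof.
move=> [Fd Fh] [Gd Gh]; split=> [x Ux|x a Ux a0].
  by apply: differentiableB; [exact: Fd|exact: Gd].
by rewrite Fh // Gh // mulrBr.
Qed.

Lemma O_sectionsD k U (F G : X -> C) : O_sections k U F -> O_sections k U G ->
  O_sections k U (fun x => F x + G x).
Proof.
move=> [Fd Fh] [Gd Gh]; split=> [x Ux|x a Ux a0].
  by apply: differentiableD; [exact: Fd|exact: Gd].
by rewrite Fh // Gh // mulrDr.
Qed.

Lemma coordX_section b k U : (forall x, U x -> x 0 b != 0) -> O_sections k U (fun x : X => x 0 b ^ k).
Proof.
move=> h; split=> [x /h|x a /h x0 a0]; first exact: coordX_diff.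
by rewrite mxE exprMz_comm ?unitfE //; exact: mulrC.
Qed.

End Charts.

(** * Homogeneous polynomials *)

Section HomogeneousPolynomials.
Variable C : numClosedFieldType.
Local Notation X := 'rV[C]_2.
Local Notation poly2 := (mpoly 2 C).
Implicit Types (k l : int) (p q : poly2) (x : X) (m : multinom 2).

(** Treats all integers k alike: for k < 0 no monomial has degree k, so the condition forces p =
    0. *)
Lemma is_homogP k p : is_homog k p <-> forall m, mcoeff m p != 0 -> (mdeg m)%:Z = k.
Proof.
case: k => d; split.
- move=> [v ->] m; rewrite -mcoeff_msupp => mv; have /dhomogP h := dhomog_is_dhomog v.
  by rewrite (h _ mv).
- move=> h; have hp : p \in ishomog1 d mdeg.
    by apply/dhomogP => m; rewrite mcoeff_msupp => /h[].
  by exists (DHomog hp).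
- by move=> [v ->] m; rewrite mcoeff0 eqxx.
- move=> h; exists 0; apply/mpolyP => m; rewrite /= mcoeff0.
  by apply/eqP/negPn/negP => /h.
Qed.

Lemma is_homog0 k : is_homog k (0 : poly2).
Proof. by apply/is_homogP => m; rewrite mcoeff0 eqxx. Qed.

Lemma is_homogD k p q : is_homog k p -> is_homog k q -> is_homog k (p + q).
Proof.
move=> /is_homogP hp /is_homogP hq; apply/is_homogP => m; rewrite mcoeffD => h.
have [p0|/hp//] := eqVneq (mcoeff m p) 0; apply: hq.
by move: h; rewrite p0 add0r.
Qed.

Lemma is_homogZ k (a : C) p : is_homog k p -> is_homog k (a *: p).
Proof.
move=> /is_homogP hp; apply/is_homogP => m; rewrite mcoeffZ mulf_eq0 negb_or => /andP[_].
exact: hp.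
Qed.

Lemma is_homogN k p : is_homog k p -> is_homog k (- p).
Proof. by rewrite -scaleN1r; exact: is_homogZ. Qed.

Lemma is_homogB k p q : is_homog k p -> is_homog k q -> is_homog k (p - q).
Proof. by move=> hp hq; apply: is_homogD => //; exact: is_homogN. Qed.

Lemma is_homogM k l p q : is_homog k p -> is_homog l q -> is_homog (k + l) (p * q).
Proof.
move=> /is_homogP hp /is_homogP hq; apply/is_homogP => m; rewrite -mcoeff_msupp.
move=> /msuppM_le/allpairsP[[m1 m2] /=]; rewrite !mcoeff_msupp => -[/hp <- /hq <- ->].
by rewrite mdegD.
Qed.

Lemma is_homog1 : is_homog 0 (1 : poly2).
Proof.
apply/is_homogP => m; rewrite mcoeff1; have [->|_] := eqVneq m mnm0; first by rewrite mdeg0.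
by rewrite eqxx.
Qed.

Lemma is_homog_sum k (I : Type) (r : seq I) (P : pred I) (F : I -> poly2) :
  (forall i, P i -> is_homog k (F i)) -> is_homog k (\sum_(i <- r | P i) F i).
Proof. by move=> h; elim/big_ind: _ => //; [exact: is_homog0|exact: is_homogD]. Qed.

Lemma is_homog_prod (I : Type) (r : seq I) (d : I -> int) (F : I -> poly2) :
  (forall i, is_homog (d i) (F i)) -> is_homog (\sum_(i <- r) d i) (\prod_(i <- r) F i).
Proof.
move=> h; elim: r => [|i r IH]; first by rewrite !big_nil; exact: is_homog1.
by rewrite !big_cons; exact: is_homogM.
Qed.

Lemma homog_polyP k (v : homog C k) : is_homog k (homog_poly v).
Proof. by exists v. Qed.

Lemma homog_poly_inj k : injective (@homog_poly C k).
Proof.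
case: k => d /= u v; first exact: val_inj.
by move=> _; apply/rowP => -[].
Qed.

Lemma to_homogK k p : is_homog k p -> homog_poly (to_homog k p) = p.
Proof.
case: k => d [v ->] /=; last by [].
by rewrite /indhomog insubdK //; exact: dhomog_is_dhomog.
Qed.

Lemma homog_poly_linear k (a : C) (u v : homog C k) :
  homog_poly (a *: u + v) = a *: homog_poly u + homog_poly v.
Proof. by case: k u v => d u v //=; rewrite scaler0 addr0. Qed.

Lemma homog_polyD k (u v : homog C k) : homog_poly (u + v) = homog_poly u + homog_poly v.
Proof. by have := homog_poly_linear 1 u v; rewrite !scale1r. Qed.

Lemma homog_poly0 k : homog_poly (0 : homog C k) = 0.
Proof. by case: k. Qed.

Lemma homog_polyZ k (a : C) (u : homog C k) : homog_poly (a *: u) = a *: homog_poly u.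
Proof. by have := homog_poly_linear a u 0; rewrite addr0 homog_poly0 addr0. Qed.

(** Homogeneity matters: [to_homog] is not additive, since two polynomials sent to 0 may have a
    homogeneous sum. *)
Lemma to_homog_linear k (a : C) p q : is_homog k p -> is_homog k q ->
  to_homog k (a *: p + q) = a *: to_homog k p + to_homog k q.
Proof.
move=> hp hq; apply: homog_poly_inj; rewrite homog_poly_linear !to_homogK //.
by apply: is_homogD => //; exact: is_homogZ.
Qed.

Lemma eval_atD x p q : eval_at x (p + q) = eval_at x p + eval_at x q.
Proof. exact: mevalD. Qed.
Lemma eval_atM x p q : eval_at x (p * q) = eval_at x p * eval_at x q.
Proof. exact: mevalM. Qed.
Lemma eval_atZ x (a : C) p : eval_at x (a *: p) = a * eval_at x p.
Proof. exact: mevalZ. Qed.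
Lemma eval_at0 x : eval_at x (0 : poly2) = 0. Proof. exact: meval0. Qed.
Lemma eval_at1 x : eval_at x (1 : poly2) = 1. Proof. exact: meval1. Qed.
Lemma eval_at_sum x (I : Type) (r : seq I) (P : pred I) (F : I -> poly2) :
  eval_at x (\sum_(i <- r | P i) F i) = \sum_(i <- r | P i) eval_at x (F i).
Proof. by apply: (big_morph (eval_at x)); [exact: eval_atD|exact: eval_at0]. Qed.

Definition mm (i j : nat) : multinom 2 := Multinom [tuple i; j].

Lemma mm0 i j : mm i j 0 = i. Proof. by []. Qed.
Lemma mm1 i j : mm i j 1 = j. Proof. by []. Qed.

Lemma mmE m : m = mm (m 0) (m 1).
Proof.
apply/mnmP => i; have : i = 0 \/ i = 1 by case: i => [[|[|i]] // ?]; [left|right]; exact/val_inj.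
by case=> ->; rewrite ?mm0 ?mm1.
Qed.

Lemma mdeg_mm m : mdeg m = (m 0%R + m 1%R)%N.
Proof. by rewrite mdegE big_ord_recl big_ord1; congr (_ + m _)%N; exact/val_inj. Qed.

Lemma eval_at_mm x i j : eval_at x (mpolyX C (mm i j)) = x 0 0 ^+ i * x 0 1 ^+ j.
Proof.
have e : fintype.lift ord0 (ord0 : 'I_1) = 1 :> 'I_2 by exact/val_inj.
by rewrite /eval_at mevalX big_ord_recl big_ord1 e mm0 mm1.
Qed.

Lemma is_homog_mm i j : is_homog (i + j)%N (mpolyX C (mm i j)).
Proof.
apply/is_homogP => m; rewrite mcoeffX; have [<-|_] := eqVneq (mm i j) m; last by rewrite eqxx.
by rewrite mdeg_mm.
Qed.

Lemma homog_expand (d : nat) p : is_homog d p ->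
  p = \sum_(j < d.+1) mcoeff (mm (d - j) j) p *: mpolyX C (mm (d - j) j).
Proof.
move=> /is_homogP hp; apply/mpolyP => m; rewrite raddf_sum /=.
under eq_bigr do rewrite mcoeffZ mcoeffX.
have [md|md] := eqVneq (mdeg m) d; last first.
  rewrite big1 => [|j _].
    by apply/eqP/negPn/negP => /hp [] /eqP; exact/negP.
  case: eqP => [e|]; last by rewrite mulr0.
  by move: md; rewrite -e mdeg_mm mm0 mm1 subnK ?eqxx // -ltnS.
have m1 : (m 1%R < d.+1)%N by rewrite ltnS -md mdeg_mm leq_addl.
have mE : mm (d - m 1) (m 1) = m by rewrite [RHS]mmE -md mdeg_mm addnK.
rewrite (bigD1 (Ordinal m1)) //= mE eqxx mulr1 big1 ?addr0 // => j jm.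
case: eqP => [e|]; last by rewrite mulr0.
by case/eqP: jm; apply/val_inj; rewrite /= -e.
Qed.

(** On the line x_0 = 1 the difference becomes a polynomial in one variable that vanishes
    everywhere; by homogeneity its coefficients are those of the difference. *)
Lemma eval_at_inj k p q : is_homog k p -> is_homog k q ->
  (forall x, x != 0 -> eval_at x p = eval_at x q) -> p = q.
Proof.
move=> hp hq pq; apply/eqP; rewrite -subr_eq0; apply/eqP.
have hr := is_homogB hp hq.
have {pq} r0 x : x != 0 -> eval_at x (p - q) = 0.
  by move=> x0; rewrite -scaleN1r eval_atD eval_atZ mulN1r pq // subrr.
move: (p - q) hr r0 => r; case: k {hp hq} => d hr r0; last by case: hr => v ->.
pose P : {poly C} := \poly_(j < d.+1) mcoeff (mm (d - j) j) r.
have P0 : P = 0.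
  apply/eqP/negPn/negP => nP; have Ps z : root P z.
    pose x : X := \row_i (if i == 0 then 1 else z).
    have x0 : x != 0 by apply/eqP => /rowP/(_ 0); rewrite !mxE eqxx => /eqP; rewrite oner_eq0.
    apply/rootP; rewrite -[RHS](r0 x x0) (homog_expand hr) eval_at_sum horner_poly.
    apply: eq_bigr => j _; rewrite eval_atZ eval_at_mm; congr (_ * _).
    by rewrite !mxE eqxx expr1n mul1r.
  (* The integers below [size P] are already too many distinct roots. *)
  pose rs : seq C := map (fun i : nat => i%:R) (iota 0 (size P)).
  have ra : all (root P) rs by apply/allP => z _.
  have ru : uniq rs by rewrite map_inj_uniq ?iota_uniq //; apply: mulrIn; exact: oner_neq0.
  by have := max_poly_roots nP ra ru; rewrite size_map size_iota ltnn.
rewrite (homog_expand hr) big1 // => j _.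
have := coef_poly d.+1 (fun j => mcoeff (mm (d - j) j) r) j.
by rewrite -/P P0 coef0 ltn_ord => <-; rewrite scale0r.
Qed.

End HomogeneousPolynomials.

(** * Sections and cohomology of O(k) *)

Section GlobalSections.
Variable R : realType.
Local Notation C := R[i].
Local Notation X := 'rV[C]_2.
Implicit Types (b : 'I_2) (x : X) (z w : C) (k : int) (U : set X).

Lemma eval_section k U (p : mpoly 2 C) : is_homog k p -> O_sections k U (fun x => eval_at x p).
Proof.
move=> hp; case: k hp => d hp; last first.
  case: hp => v -> /=; rewrite (_ : (fun x => _) = 0); first exact: O_sections0.
  by apply/funext => x; rewrite eval_at0.
rewrite (homog_expand hp).
have -> : (fun x => eval_at x (\sum_(j < d.+1) mcoeff (mm (d - j) j) p *: mpolyX C (mm (d - j) j))) =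
   (fun x : X => \sum_(j < d.+1) mcoeff (mm (d - j) j) p * (x 0 0 ^+ (d - j) * x 0 1 ^+ j)).
  by apply/funext => x; rewrite eval_at_sum; apply: eq_bigr => j _; rewrite eval_atZ eval_at_mm.
elim: (index_enum _) => [|j r IH].
  rewrite (_ : (fun x => _) = 0); first exact: O_sections0.
  by apply/funext => x; rewrite big_nil.
rewrite (_ : (fun x => _) = mcoeff (mm (d - j) j) p *: (fun x : X => x 0 0 ^+ (d - j) * x 0 1 ^+ j : C^o)
    + (fun x : X => \sum_(j <- r) mcoeff (mm (d - j) j) p * (x 0 0 ^+ (d - j) * x 0 1 ^+ j) : C^o)); last first.
  by apply/funext => x; rewrite big_cons.
apply: O_sections_lin; last exact: IH.
split=> [x _|x a _ a0].
  by apply: differentiableM; apply: expn_diff; exact: coord_diff.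
have jd : (j <= d)%N by rewrite -ltnS.
by rewrite !mxE !exprMn mulrACA -exprD subnK.
Qed.

(** Bisection replaces compactness: a bound exists near each point, and the larger of two bounds
    serves for a union. *)
Lemma bounded_rect (g : C -> C) (a b c d : R) : a < b -> c < d -> (forall z, {for z, continuous g}) ->
  exists M : R, forall x y : R, a <= x <= b -> c <= y <= d -> modc (g (x +i* y)%C) <= M.
Proof.
move=> ab cd gc.
apply: (rect_cousin (P := fun a b c d : R => exists M : R, forall x y : R, a <= x <= b -> c <= y <= d ->
  modc (g (x +i* y)%C) <= M) ab cd).
- move=> x y z c' d' _ _ _ _ _ _ _ [M1 h1] [M2 h2]; exists (Num.max M1 M2) => u v uxz vcd.
  rewrite le_max; have [uy|yu] := leP u y; first by rewrite h1 //; lra.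
  by rewrite (h2 u v) ?orbT //; lra.
- move=> a' b' x y z _ _ _ _ _ _ _ [M1 h1] [M2 h2]; exists (Num.max M1 M2) => u v uxz vcd.
  rewrite le_max; have [uy|yu] := leP v y; first by rewrite h1 //; lra.
  by rewrite (h2 u v) ?orbT //; lra.
move=> x y xab ycd; have [e e0 eP] := (contCP g (x +i* y)%C).1 (gc _) 1 ltr01.
have D0 : 0 < (b - a) + (d - c) by lra.
exists (e / ((b - a) + (d - c))); first by rewrite divr_gt0.
move=> l a' c' l0; rewrite ltr_pdivlMr // mulrDr => l1 _ _ _ _ xa yc.
exists (modc (g (x +i* y)%C) + 1) => u v ua vc.
have : modc ((u +i* v)%C - (x +i* y)%C) < e.
  apply: le_lt_trans (modc_le _) _; apply: le_lt_trans l1 => /=.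
  by apply: lerD; rewrite ler_norml; lra.
move=> /eP; have := modcD (g (u +i* v)%C - g (x +i* y)%C) (g (x +i* y)%C); rewrite subrK; lra.
Qed.

Lemma open_neq0 : p1_open [set x : X | x != 0].
Proof. by have [/(_ 0)] := p1_coverT R[i]. Qed.

(** For a section of O(-1), z times its value at z in one chart is its value at z^-1 in the other,
    which is bounded for |z| >= 1. So [liouville0] applies to each chart. *)
Lemma global_sectionN1 (F : X -> C) : O_sections (-1) [set x : X | x != 0] F ->
  forall x, x != 0 -> F x = 0.
Proof.
move=> Fs; have fd b z : differentiable (fun z : C => F (pt b z)) z.
  by apply: section_pt_diff Fs _; exact: pt_neq0.
have f0 b z : F (pt b z) = 0.
  have l22 : (-2 : R) < 2 by lra.
  have [M MP] := bounded_rect l22 l22 (fun z => differentiable_continuous (fd (rev_ord b) z)).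
  apply: (@liouville0 _ (fun z => F (pt b z)) M (fd b)) => w w1.
  have w0 : w != 0 by rewrite -modc_gt0; lra.
  have -> : pt b w = w *: pt (rev_ord b) w^-1 by rewrite pt_rev // scalerA divff // scale1r.
  have [_ Fh] := Fs; rewrite Fh //=; last exact: pt_neq0.
  have -> : w ^ (-1) = w^-1 by [].
  rewrite modcM modcV mulrC mulrA divff ?modc_eq0 // mul1r.
  have V1 : modc w^-1 <= 1 by rewrite modcV invf_le1 //; lra.
  case: (w^-1) V1 => u v V1; have := Re_le_modc (u +i* v)%C; have := Im_le_modc (u +i* v)%C.
  by move=> /=; rewrite !ler_norml => h1 h2; apply: MP; lra.
move=> x x0; have [b xb] : exists b, x 0 b != 0.
  have [x00|] := eqVneq (x 0 0) 0; last by exists 0.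
  exists (rev_ord 0); apply: contraNneq x0 => x01; apply/eqP.
  by apply: (@row2P _ 0); rewrite mxE.
by have [-> _] := section_lift Fs open_neq0 x0 xb; rewrite /hlift /= f0 mulr0.
Qed.

(** Multiplication by x_b^n turns the section into one of O(-1), and some x_b is nonzero at each
    point. *)
Lemma global_section_neg (n : nat) (F : X -> C) : O_sections (- (n.+1)%:Z) [set x : X | x != 0] F ->
  forall x, x != 0 -> F x = 0.
Proof.
move=> Fs x x0.
have h b : x 0 b ^+ n * F x = 0.
  apply: (global_sectionN1 (F := fun x => x 0 b ^+ n * F x)); last exact: x0.
  have [Fd Fh] := Fs; split=> [y y0|y a y0 a0].
    by apply: differentiableM; [exact/expn_diff/coord_diff|exact: Fd].
  rewrite mxE Fh // exprMn mulrACA; congr (_ * _).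
  have -> : a ^+ n * a ^ (- n.+1%:Z) = a ^ (n%:Z - n.+1%:Z) by rewrite expfzDr.
  by congr (a ^ _); rewrite intS opprD addrCA subrr addr0.
have [b xb] : exists b, x 0 b != 0.
  have [x00|] := eqVneq (x 0 0) 0; last by exists 0.
  exists (rev_ord 0); apply: contraNneq x0 => x01; apply/eqP.
  by apply: (@row2P _ 0); rewrite mxE.
by move/eqP: (h b); rewrite mulf_eq0 expf_eq0 (negPf xb) andbF => /eqP.
Qed.

Lemma rev_ord0 : rev_ord 0 = 1 :> 'I_2. Proof. exact/val_inj. Qed.

(* F - F(1,0) X_0^d is divisible by X_1, with a quotient of degree d - 1. *)
Lemma global_section (k : int) (F : X -> C) : O_sections k [set x : X | x != 0] F ->
  exists2 p : mpoly 2 C, is_homog k p & forall x, x != 0 -> F x = eval_at x p.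
Proof.
(* The degree is shifted by one so that the induction starts from O(-1). *)
suff H1 : forall (d : nat) F, O_sections (d%:Z - 1) [set x : X | x != 0] F ->
    exists2 p : mpoly 2 C, is_homog (d%:Z - 1) p & forall x, x != 0 -> F x = eval_at x p.
  case: k => n Fs; first by have := H1 n.+1 F; rewrite intS [1 + _]addrC addrK; exact.
  exists 0; first exact: is_homog0.
  by move=> x x0; rewrite eval_at0 (global_section_neg (n := n)).
elim=> [|d IH] {}F Fs.
  exists 0; first exact: is_homog0.
  by move=> x x0; rewrite eval_at0 global_sectionN1.
rewrite intS addrAC subrr add0r in Fs *.
have fd z : differentiable (fun z : C => F (pt 0 z)) z.
  by apply: section_pt_diff Fs _; exact: pt_neq0.
have [g gd gE] := divided_difference fd.
set f0 := F (pt 0 0) in gE.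
(* On x_1 = 0 the quotient by x_1 is supplied by the divided difference in the chart x_0 != 0. *)
pose G x := if x 0 1 == 0 then hlift 0 (d%:Z - 1) g x else (F x - f0 * x 0 0 ^+ d) / x 0 1.
have hE x : x 0 0 != 0 -> F x - f0 * x 0 0 ^+ d = x 0 1 * hlift 0 (d%:Z - 1) g x.
  move=> x00; have x0 : x != 0 by apply: contraNneq x00 => ->; rewrite mxE.
  have [-> _] := section_lift Fs open_neq0 x0 x00.
  have eD : x 0 0 ^ (d%:Z - 1) = x 0 0 ^+ d * (x 0 0)^-1 by rewrite expfzDr.
  rewrite /hlift /= gE eD -[x 0 0 ^ d]/(x 0 0 ^+ d) /slope rev_ord0.
  move: (g _) => T; move: (x 0 0 ^+ d) ((x 0 0)^-1) (x 0 1) => A B D; ring.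
have Gs : O_sections (d%:Z - 1) [set x : X | x != 0] G.
  apply: O_local => x x0; have [x1|x1] := eqVneq (x 0 1) 0.
    have x00 : x 0 0 != 0.
      apply: contraNneq x0 => x00; apply/eqP.
      by apply: (@row2P _ 0); rewrite mxE // rev_ord0.
    exists [set x : X | x 0 0 != 0], (hlift 0 (d%:Z - 1) g); split.
    - exact: coord_neq0_open.
    - exact: x00.
    - by apply: lift_section => y y0; split => //; exact: gd.
    - move=> y /= y0; rewrite /G; case: eqP => // /eqP y1.
      by rewrite hE // mulrAC divff // mul1r.
  exists [set x : X | x 0 1 != 0], (fun x => (F x - f0 * x 0 0 ^+ d) / x 0 1); split.
  - exact: coord_neq0_open.
  - exact: x1.
  - apply: O_sectionsM; last by move=> y /= y1; apply: contraNneq y1 => ->; rewrite mxE.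
      apply: O_sectionsB.
        by apply: (@O_sections_sub _ _ [set x : X | x != 0]) => // y /= y1; apply: contraNneq y1 => ->; rewrite mxE.
      split=> [y _|y a _ a0].
        by apply: differentiableM; [exact: differentiable_cst|exact/expn_diff/coord_diff].
      by rewrite mxE exprMn mulrCA.
    by apply: (coordX_section (-1)).
  - by move=> y /= y1; rewrite /G (negPf y1).
have [p hp pE] := IH _ Gs.
exists (f0 *: mpolyX C (mm d 0) + mpolyX C (mm 0 1) * p).
  apply: is_homogD; first by apply: is_homogZ; have := is_homog_mm C d 0; rewrite addn0.
  have := is_homogM (is_homog_mm C 0 1) hp.
  by rewrite addrC subrK.
move=> x x0; rewrite eval_atD eval_atZ eval_atM !eval_at_mm -pE // !expr0 mulr1 mul1r expr1.
apply/eqP; rewrite addrC -subr_eq; apply/eqP; rewrite /G; case: eqP => [x1|/eqP x1].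
  by rewrite -hE // ; apply: contraNneq x0 => x00; apply/eqP; apply: (@row2P _ 0); rewrite mxE // rev_ord0.
by rewrite [RHS]mulrC mulfVK.
Qed.

End GlobalSections.

(** * Reduction of cocycles of O(k) to finite Laurent tails *)

Section CechLine.
Variable R : realType.
Local Notation C := R[i].
Local Notation X := 'rV[C]_2.
Implicit Types (b : 'I_2) (x y p : X) (z w : C) (k : int) (U : set X).

(** The chart x_b = 1 turns the cover into one of the plane, and [cousin_plane] applies on the
    square around the disc; [hlift] restores homogeneity. *)
Lemma chart_primitive b k (U : X -> set X) (c : X -> X -> X -> C) (r : R) : 0 < r -> p1_cover U ->
  (forall x y, O_sections k (U x `&` U y) (c x y)) ->
  (forall x y z p : X, (U x `&` U y `&` U z) p -> c y z p - c x z p + c x y p = 0) ->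
  exists h : X -> X -> C, (forall x, O_sections k (U x `&` disc b r) (h x)) /\
    forall x y p, U x p -> U y p -> disc b r p -> c x y p = h y p - h x p.
Proof.
move=> r0 [oU cU] cs cz.
have Vo x (z : C) : U x (pt b z) -> exists2 e : R, 0 < e & forall w, modc (w - z) < e -> U x (pt b w).
  exact: pt_open.
have Vc z : exists x, U x (pt b z) by exists (pt b z); apply: cU; exact: pt_neq0.
have cd x y (z : C) : U x (pt b z) -> U y (pt b z) -> differentiable (fun z => c x y (pt b z)) z.
  by move=> Ux Uy; apply: section_pt_diff (cs x y) _.
have cc x y (w : X) (z : C) : U x (pt b z) -> U y (pt b z) -> U w (pt b z) ->
    c y w (pt b z) - c x w (pt b z) + c x y (pt b z) = 0.
  by move=> *; apply: cz.
have [h [hd hE]] := @cousin_plane R X (fun x z => U x (pt b z)) (fun x y z => c x y (pt b z))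
  Vo Vc cd cc (- r) r (- r) r ltac:(lra) ltac:(lra).
have inR p : disc b r p -> orect (- r) r (- r) r (slope b p).
  move=> /discP[_ pr]; have := Re_le_modc (slope b p); have := Im_le_modc (slope b p).
  rewrite !ler_norml => h1 h2; split; lra.
have onU x p : U x p -> disc b r p -> U x (pt b (slope b p)).
  move=> Uxp dp; have p0 := disc_neq0 dp.
  have -> : pt b (slope b p) = (p 0 b)^-1 *: p.
    by rewrite -[LHS]scale1r -(mulVf p0) -scalerA -scale_pt.
  by have [_ _ sU] := oU x; apply: sU; [exact: Uxp|rewrite invr_eq0].
exists (fun x => hlift b k (h x)); split=> [x|x y p Ux Uy dp].
  apply: lift_section => p [Uxp dp]; split; first exact: disc_neq0 dp.
  by apply: hd; [exact: onU|exact: inR].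
have p0 := disc_neq0 dp.
have Uxy : p1_open (U x `&` U y) by apply: p1_openI.
have [-> _] := section_lift (cs x y) Uxy (conj Ux Uy) p0.
by rewrite /hlift (hE x y) ?mulrBr //; [exact: onU|exact: onU|exact: inR].
Qed.

Definition mon (i j : int) : X -> C := fun p => p 0 0 ^ i * p 0 1 ^ j.

Definition coord_ne (e : bool) : set X := [set p : X | (if e then p 0 0 else p 0 1) != 0].

Lemma coord_ne_open e : p1_open (coord_ne e).
Proof. by case: e; exact: coord_neq0_open. Qed.

Lemma mon_section i j (U : set X) : (i < 0 -> U `<=` coord_ne true) -> (j < 0 -> U `<=` coord_ne false) ->
  O_sections (i + j) U (mon i j).
Proof.
have one b i' : (i' < 0 -> forall x, U x -> x 0 b != 0) -> O_sections i' U (fun x : X => x 0 b ^ i').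
  move=> h; case: i' h => n h; last by apply: coordX_section; exact: h.
  split=> [x Ux|x a Ux a0]; last by rewrite mxE; exact: exprMn.
  by apply: expn_diff; exact: coord_diff.
move=> h1 h2; have [d1 e1] := one 0 i h1; have [d2 e2] := one 1 j h2.
split=> [x Ux|x a Ux a0]; first by apply: differentiableM; [exact: d1|exact: d2].
by rewrite /mon e1 // e2 // mulrACA expfzDr.
Qed.

(* the cocycle of L for the two standard charts, written on the same cover as
   standard_cocycle *)
Definition std (L : X -> C) : cochain C^o := fun x y p => ((x 0 0 != 0)%:R - (y 0 0 != 0)%:R) * L p.

Definition std_cover (x : X) : set X := coord_ne (x 0 0 != 0).

Lemma std_coverP : p1_cover std_cover.
Proof.
split=> [x|x x0]; first exact: coord_ne_open.
rewrite /std_cover /coord_ne /=; case: ifP => // /negbFE/eqP x00; apply: contraNneq x0 => x01.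
by apply/eqP; apply: (@row2P _ 0); rewrite ?rev_ord0 mxE.
Qed.

Lemma std_cocycle k L : O_sections k (coord_ne true `&` coord_ne false) L -> is_cocycle (OP1 C k) (std L).
Proof.
move=> Ls; exists std_cover; split; first exact: std_coverP.
  move=> x y; rewrite /std_cover /std /=.
  case: (x 0 0 != 0); case: (y 0 0 != 0).
  - rewrite (_ : (fun p => _) = 0); first exact: O_sections0.
    by apply/funext => p; rewrite subrr mul0r.
  - rewrite (_ : (fun p => _) = L) //; by apply/funext => p; rewrite subr0 mul1r.
  - rewrite (_ : (fun p => _) = -1 *: (L : X -> C^o) + 0); last first.
      by apply/funext => p; rewrite addr0 sub0r.
    by apply: O_sections_lin; [rewrite setIC; exact: Ls|exact: O_sections0].
  - rewrite (_ : (fun p => _) = 0); first exact: O_sections0.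
    by apply/funext => p; rewrite subrr mul0r.
by move=> x y w p _; rewrite /std; ring.
Qed.

(** The primitive is L up to sign on the chart over which L extends, and 0 on the other chart. *)
Lemma std_coboundary k L e : O_sections k (coord_ne e) L -> is_coboundary (OP1 C k) (std L).
Proof.
move=> Ls; exists std_cover, (fun x p => ((~~ e)%:R - (x 0 0 != 0)%:R) * L p); split.
- exact: std_coverP.
- move=> x; rewrite /std_cover.
  have zero : O_sections k (coord_ne (~~ e)) (fun p => ((~~ e)%:R - (~~ e)%:R) * L p).
    rewrite (_ : (fun p => _) = 0); first exact: O_sections0.
    by apply/funext => p; rewrite subrr mul0r.
  case: (x 0 0 != 0); case: e Ls zero => Ls zero; [|exact: zero|exact: zero|].
    rewrite (_ : (fun p => _) = -1 *: (L : X -> C^o) + 0); last first.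
      by apply/funext => p; rewrite addr0 sub0r.
    by apply: O_sections_lin; [exact: Ls|exact: O_sections0].
  by rewrite (_ : (fun p => _) = L) //; apply/funext => p; rewrite subr0 mul1r.
- by move=> x y p _; rewrite /std; ring.
Qed.

(** This is max(0, -k-1), the dimension of H^1(O(k)): the number of monomials X_0^a X_1^b with a, b
    < 0 and a + b = k. *)
Definition tail_length k : nat := if k is Negz n then n else 0%N.

(** With N = [tail_length k] and w = z^-1, the remainder x_0^k z^-(N+1) g(z^-1) reads x_1^k
    w^(k+N+1) g(w) in the other chart. The exponent being nonnegative, it is holomorphic at w =
    0. *)
Lemma tail_lengthE k : exists n : nat, k + (tail_length k)%:Z + 1 = n.
Proof.
case: k => n; first by exists n.+1; rewrite addr0 intS addrC.
by exists 0%N; rewrite NegzE /= intS; ring.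
Qed.

Definition laurent_tail k (s : nat -> C) : X -> C :=
  fun p => \sum_(j < tail_length k) s j * mon (k + j.+1) (- (j.+1)%:Z) p.

Lemma laurent_tail_section k s (U : set X) : U `<=` coord_ne true -> U `<=` coord_ne false ->
  O_sections k U (laurent_tail k s).
Proof.
move=> U0 U1; rewrite /laurent_tail; elim: (index_enum _) => [|j r IH].
  rewrite (_ : (fun x => _) = 0); first exact: O_sections0.
  by apply/funext => x; rewrite big_nil.
rewrite (_ : (fun x => _) = s j *: (mon (k + j.+1) (- (j.+1)%:Z) : X -> C^o)
    + (fun p => \sum_(j <- r) s j * mon (k + j.+1) (- (j.+1)%:Z) p : C^o)); last first.
  by apply/funext => x; rewrite big_cons.
apply: O_sections_lin; last exact: IH.
have := @mon_section (k + j.+1) (- (j.+1)%:Z) U (fun _ => U0) (fun _ => U1).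
by rewrite addrK.
Qed.

(** The primitives on the two discs differ by F = F1 + L + F2 on the annulus. F1 extends over one
    disc and F2 over the other, so correcting the primitives by them leaves only the tail L. *)
Lemma cocycle_laurent_tail k (c : cochain C^o) : is_cocycle (OP1 C k) c ->
  exists s : nat -> C, is_coboundary (OP1 C k) (c - std (laurent_tail k s)).
Proof.
move=> [U [cU cs cz]]; have [oU UU] := cU.
have e80 : (0 : R) < 8 by lra.
have [h0 [h0s h0E]] := chart_primitive 0 e80 cU cs cz.
have [h1 [h1s h1E]] := chart_primitive 1 e80 cU cs cz.
(* The index p is available because [U p] contains p; by [FE] any other admissible index gives the
   same value. *)
pose F p := h0 p p - h1 p p.
have rv1 : rev_ord 1 = 0 :> 'I_2 by exact/val_inj.
have FE x p : U x p -> disc 0 8 p -> disc 1 8 p -> F p = h0 x p - h1 x p.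
  move=> Ux d0 d1; have p0 : p != 0 by exact: p1_open_neq0 (oU x) Ux.
  have := h0E x p p Ux (UU p p0) d0; rewrite (h1E x p p Ux (UU p p0) d1).
  by move=> e; exact: subr_swap (esym e).
pose A := disc 0 8 `&` disc 1 8 : set X.
have Fs : O_sections k A F.
  apply: O_local => p [d0 d1].
  have p0 : p != 0 by exact: p1_open_neq0 (disc_open 0 e80) d0.
  exists (U p `&` A), (fun q => h0 p q - h1 p q); split.
  - by do 2?apply: p1_openI => //; exact: disc_open.
  - by split; [exact: UU|split].
  - apply: O_sectionsB; [apply: O_sections_sub (h0s p)|apply: O_sections_sub (h1s p)].
      by move=> q [Uq [q0 q1]]; split.
    by move=> q [Uq [q0 q1]]; split.
  - by move=> q [Uq [q0 q1]]; exact: FE.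
have inA z : 8^-1 < modc z -> modc z < 8 -> A (pt 0 z).
  have q0 : pt 0 z 0 0 = 1 by exact: pt_b.
  have q1 : pt 0 z 0 1 = z by rewrite -{1}rev_ord0 pt_r.
  by move=> z1 z2; split; rewrite /disc /= ?rv1 ?rev_ord0 q0 q1 modc1; lra.
have fd z : 8^-1 < modc z -> modc z < 8 -> differentiable (fun z => F (pt 0 z)) z.
  by move=> z1 z2; apply: section_pt_diff Fs _; exact: inA.
have [f1 [g [s [f1d gd fE]]]] := laurent_split (tail_length k) fd.
have [n nE] := tail_lengthE k.
have r2 : (0 : R) < 2 by lra.
pose F1 := hlift 0 k f1; pose F2 := hlift 1 k (fun w => w ^+ n * g w).
have F1s : O_sections k (disc 0 2) F1.
  apply: lift_section => p /discP[p0 p2]; split; [exact: p0|exact: f1d].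
have F2s : O_sections k (disc 1 2) F2.
  apply: lift_section => p /discP[p0 p2]; split; first exact: p0.
  by apply: holM; [apply: expn_diff; exact: hol_id|exact: gd].
pose L := laurent_tail k s.
have FL p : disc 0 2 p -> disc 1 2 p -> F p = F1 p + L p + F2 p.
  move=> /[dup] dp0 /discP[p0 b1] /[dup] dp1 /discP[p1].
  rewrite -rev_ord0 slopeV modcV => b2.
  have z0 : slope 0 p != 0 by rewrite /slope rev_ord0 mulf_neq0 // invr_eq0.
  have {}b2 : 2^-1 < modc (slope 0 p).
    by rewrite -[ltRHS]invrK ltf_pV2 ?posrE ?invr_gt0 ?modc_gt0.
  have Ap : p1_open A by apply: p1_openI; exact: disc_open.
  have pA : A p.
    by split; rewrite /disc /= in dp0 dp1 *; have := modc_ge0 (p 0 0); have := modc_ge0 (p 0 1);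
      rewrite ?rev_ord0 ?rv1 in dp0 dp1 *; lra.
  have [-> _] := section_lift Fs Ap pA p0.
  rewrite /hlift fE // !mulrDr; congr (_ + _ + _).
    rewrite /L /laurent_tail mulr_sumr; apply: eq_bigr => j _.
    rewrite mulrCA; congr (_ * _); rewrite /mon /slope rev_ord0.
    rewrite invf_div expr_div_n expfzDr // -mulrA; congr (_ * _).
  have s10 : slope 1 p = (slope 0 p)^-1 by rewrite -slopeV rev_ord0.
  rewrite /F2 /hlift s10.
  rewrite [_ * (_ * g _)]mulrA [RHS]mulrA; congr (_ * g _).
  have -> : p 0 1 = p 0 0 * slope 0 p by rewrite /slope rev_ord0 mulrCA divff // mulr1.
  move: (slope 0 p) z0 => z z0.
  rewrite exprMz_comm ?unitfE //; last exact: mulrC.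
  rewrite -mulrA; congr (_ * _).
  have -> : z^-1 ^+ n = z ^ (- n%:Z) by rewrite -exprz_inv.
  have -> : z^-1 ^+ (tail_length k).+1 = z ^ (- (tail_length k).+1%:Z) by rewrite -exprz_inv.
  by rewrite -expfzDr //; congr (_ ^ _); rewrite -nE intS; ring.
have L_sec : O_sections k (coord_ne true `&` coord_ne false) L.
  by apply: laurent_tail_section => p [].
pose G0 x p := h0 x p - F1 p; pose G1 x p := h1 x p + F2 p.
have G01 x p : U x p -> disc 0 2 p -> disc 1 2 p -> G0 x p = G1 x p + L p.
  move=> Ux d0 d1; rewrite /G0 /G1.
  have := FE x p Ux; rewrite FL // => /(_ _ _)/esym.
  have d08 : disc 0 8 p.
    by move: d0; rewrite /disc /=; have := modc_ge0 (p 0 0); lra.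
  have d18 : disc 1 8 p.
    by move: d1; rewrite /disc /=; have := modc_ge0 (p 0 1); lra.
  by move=> /(_ d08 d18) /eqP; rewrite subr_eq => /eqP ->; ring.
exists s.
(* The corrected primitives are extended from the discs of radius 2 to the full charts. A point of
   the chart x_0 != 0 outside the first disc lies in the second, where both coordinates are nonzero
   and L is holomorphic; symmetrically for [g1]. *)
pose g0 x p := if `[< disc 0 2 p >] then G0 x p else G1 x p + L p.
pose g1 x p := if `[< disc 1 2 p >] then G1 x p else G0 x p - L p.
have disc28 b' p : disc b' 2 p -> disc b' 8 p.
  by rewrite /disc /=; have := modc_ge0 (p 0 b'); lra.
have G0s x : O_sections k (U x `&` disc 0 2) (G0 x).
  apply: O_sectionsB; last by apply: O_sections_sub F1s => q [].
  by apply: O_sections_sub (h0s x) => q [Uq q2]; split=> //; exact: disc28.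
have G1s x : O_sections k (U x `&` disc 1 2) (G1 x).
  apply: O_sectionsD; last by apply: O_sections_sub F2s => q [].
  by apply: O_sections_sub (h1s x) => q [Uq q2]; split=> //; exact: disc28.
have ne0 p : disc 0 2 p -> coord_ne true p by exact: disc_neq0.
have ne1 p : disc 1 2 p -> coord_ne false p by exact: disc_neq0.
have cov p : p != 0 -> disc 0 2 p \/ disc 1 2 p by rewrite -rev_ord0; exact: disc_cover.
have UD x b' : p1_open (U x `&` disc b' 2) by apply: p1_openI => //; exact: disc_open.
exists (fun x => U x `&` std_cover x), (fun x => if x 0 0 != 0 then g0 x else g1 x); split.
- exact: p1_coverI cU std_coverP.
- move=> x; rewrite /std_cover; case: (x 0 0 != 0).
    apply: O_local => p [Uxp p0].
    have [d0|/(_ _)] := pselect (disc 0 2 p).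
      exists (U x `&` disc 0 2), (G0 x); split; [exact: UD|by split|exact: G0s|].
      by move=> q [_ qd]; rewrite /g0 asboolT.
    have [//|d1 nd0] := cov p (p1_open_neq0 (oU x) Uxp).
    exists (U x `&` disc 1 2 `&` coord_ne true), (fun q => G1 x q + L q); split.
    + by apply: p1_openI; [exact: UD|exact: coord_ne_open].
    + by [].
    + apply: O_sectionsD; first by apply: O_sections_sub (G1s x) => q [].
      by apply: laurent_tail_section => q [[_ qd] q0] //; exact: ne1.
    + move=> q [[Uq q1] q0]; rewrite /g0; case: asboolP => // dq.
      by rewrite G01.
  apply: O_local => p [Uxp p0].
  have [d1|/(_ _)] := pselect (disc 1 2 p).
    exists (U x `&` disc 1 2), (G1 x); split; [exact: UD|by split|exact: G1s|].
    by move=> q [_ qd]; rewrite /g1 asboolT.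
  have [d0 nd1|//] := cov p (p1_open_neq0 (oU x) Uxp).
  exists (U x `&` disc 0 2 `&` coord_ne false), (fun q => G0 x q - L q); split.
  + by apply: p1_openI; [exact: UD|exact: coord_ne_open].
  + by [].
  + apply: O_sectionsB; first by apply: O_sections_sub (G0s x) => q [].
    by apply: laurent_tail_section => q [[_ qd] q0] //; exact: ne0.
  + move=> q [[Uq q1] q0]; rewrite /g1; case: asboolP => // dq.
    by rewrite G01 // addrK.
have cG0 x y p : U x p -> U y p -> disc 0 2 p -> c x y p = G0 y p - G0 x p.
  by move=> Ux Uy d0; rewrite (h0E x y) //; [rewrite /G0; ring|exact: disc28].
have cG1 x y p : U x p -> U y p -> disc 1 2 p -> c x y p = G1 y p - G1 x p.
  by move=> Ux Uy d1; rewrite (h1E x y) //; [rewrite /G1; ring|exact: disc28].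
have g01 x p : U x p -> g0 x p = g1 x p + L p.
  move=> Ux; rewrite /g0 /g1; case: asboolP => d0; case: asboolP => d1 //.
  - exact: G01.
  - by rewrite subrK.
  - by case: (cov p (p1_open_neq0 (oU x) Ux)).
have cg1 x y p : U x p -> U y p -> c x y p = g1 y p - g1 x p.
  move=> Ux Uy; rewrite /g1; case: asboolP => d1; first exact: cG1.
  have [d0|//] := cov p (p1_open_neq0 (oU x) Ux).
  by rewrite (cG0 x y) //; ring.
move=> x y p [[Ux px] [Uy py]]; rewrite -[LHS]/(c x y p - std L x y p) (cg1 x y) // /std.
case: (x 0 0 != 0); case: (y 0 0 != 0); rewrite /= ?(g01 x _ Ux) ?(g01 y _ Uy); ring.
Qed.

(* A primitive of the standard cocycle would be x_0 x_1 h on one chart and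
   x_0 x_1 h - 1 on the other, that is, a function on P^1 taking the values 0 and -1. *)
Lemma std_not_coboundary : ~ is_coboundary (OP1 C (-2)) (standard_cocycle (C := C)).
Proof.
move=> [U [h [[oU UU] hs hE]]].
pose L : X -> C := fun p => (p 0 0 * p 0 1)^-1.
have hE' x y p : U x p -> U y p -> ((x 0 0 != 0)%:R - (y 0 0 != 0)%:R) * L p = h y p - h x p.
  by move=> Ux Uy; rewrite -hE.
pose F p := if p 0 0 != 0 then p 0 0 * p 0 1 * h p p else -1.
have Fs : O_sections 0 [set x : X | x != 0] F.
  apply: O_local => p /= p0.
  have mul (V : set X) (G : X -> C) : O_sections (-2) V G -> O_sections 0 V (fun q : X => q 0 0 * q 0 1 * G q).
    move=> [Gd Gh]; split=> [x Vx|x a Vx a0].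
      apply: differentiableM; last exact: Gd.
      by apply: differentiableM; exact: coord_diff.
    rewrite Gh // !mxE; have -> : a ^ (-2) = (a * a)^-1 by rewrite -expr2.
    by field; rewrite a0.
  have [p00|p00] := eqVneq (p 0 0) 0.
    have p01 : p 0 1 != 0.
      by apply: contraNneq p0 => p01; apply/eqP; apply: (@row2P _ 0); rewrite ?rev_ord0 mxE.
    exists (U p `&` coord_ne false), (fun q : X => q 0 0 * q 0 1 * h p q - 1); split.
    - by apply: p1_openI => //; exact: coord_ne_open.
    - by split; [exact: UU|].
    - apply: O_sectionsB; first by apply: mul; apply: O_sections_sub (hs p) => q [].
      split=> [q _|q a _ _]; first exact: differentiable_cst.
      by rewrite mul1r.
    - move=> q [Uq q1]; rewrite /F; case: ifP => [q0|/negbFE/eqP ->]; last by rewrite !mul0r sub0r.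
      have qn : q != 0 by exact: p1_open_neq0 (oU p) Uq.
      have := hE' p q q Uq (UU q qn); rewrite p00 eqxx q0 sub0r mulN1r => /eqP.
      rewrite eq_sym subr_eq => /eqP ->; rewrite mulrDr mulrN /L divff ?mulf_neq0 // addrC //.
  exists (U p `&` coord_ne true), (fun q : X => q 0 0 * q 0 1 * h p q); split.
  - by apply: p1_openI => //; exact: coord_ne_open.
  - by split; [exact: UU|].
  - by apply: mul; apply: O_sections_sub (hs p) => q [].
  move=> q [Uq q0]; rewrite /F q0.
  have qn : q != 0 by exact: p1_open_neq0 (oU p) Uq.
  have := hE' p q q Uq (UU q qn); rewrite p00 q0 subrr mul0r => /eqP.
  by rewrite eq_sym subr_eq0 => /eqP ->.
have [P hP FP] := global_section Fs.
have ev0 x : eval_at x P = mcoeff (mm 0 0) P.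
  rewrite (homog_expand (d := 0) hP) big_ord1 eval_atZ eval_at_mm !expr0 !mulr1 mcoeffZ mcoeffX.
  by rewrite eqxx mulr1.
have e0 := FP _ (pt_neq0 0 0); have e1 := FP _ (pt_neq0 1 0).
have q01 : pt 1 0 0 0 = 0 :> C by have := pt_r 1 (0 : C); rewrite (_ : rev_ord 1 = 0) //; exact/val_inj.
have q10 : pt 0 0 0 1 = 0 :> C by rewrite -{1}rev_ord0 pt_r.
have q00 : pt 0 0 0 0 = 1 :> C by exact: pt_b.
move: e1; rewrite ev0 -(ev0 (pt 0 0)) -e0 /F q01 q10 q00 eqxx oner_eq0 mulr0 mul0r => /eqP.
by rewrite oppr_eq0 oner_eq0.
Qed.

End CechLine.

(** * Functoriality of cohomology *)

Section Functoriality.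
Local Open Scope quotient_scope.
Variable C : numClosedFieldType.
Local Notation X := 'rV[C]_2.

Section Classes.
Variables (W : lmodType C) (F : fun_sheaf W).
Implicit Types (c d : cochain W) (h : H1 F).

Lemma H1_class_cocycle c (cP : c \in cocycle_pred F) : H1_class F c = \pi_(H1 F) (Cocycle cP).
Proof. by rewrite /H1_class; congr (\pi_(H1 F)); apply/val_inj; rewrite insubdK. Qed.

Lemma cocycleP c : reflect (is_cocycle F c) (c \in cocycle_pred F).
Proof. exact: asboolP. Qed.

Lemma H1_repr_cocycle h : is_cocycle F (H1_repr h).
Proof. by apply/cocycleP; exact: cocycle_valP. Qed.

Lemma H1_reprK h : H1_class F (H1_repr h) = h.
Proof.
rewrite (H1_class_cocycle (cocycle_valP (repr h))) -[RHS]reprK.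
by congr (\pi_(H1 F)); exact: val_inj.
Qed.

Lemma is_cocycle_lin (k : C) c d : is_cocycle F c -> is_cocycle F d -> is_cocycle F (k *: c + d).
Proof.
move=> /cocycleP hc /cocycleP hd; apply/cocycleP.
by have [_] := cocycle_submod F; apply.
Qed.

Lemma is_cocycle0 : is_cocycle F 0.
Proof. by apply/cocycleP; have [] := cocycle_submod F. Qed.

Lemma is_coboundary0 : is_coboundary F 0.
Proof.
exists (fun=> [set x | x != 0]), (fun=> 0); split; [exact: p1_coverT|by move=> x; exact: sections0|].
by move=> x y p _; rewrite subrr.
Qed.

Lemma H1_class_lin (k : C) c d : is_cocycle F c -> is_cocycle F d ->
  H1_class F (k *: c + d) = k *: H1_class F c + H1_class F d.
Proof.
move=> hc hd; have /cocycleP hcd := is_cocycle_lin k hc hd.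
move/cocycleP: hc => hc; move/cocycleP: hd => hd.
rewrite (H1_class_cocycle hc) (H1_class_cocycle hd) (H1_class_cocycle hcd).
transitivity (H1_scale k (\pi_(H1 F) (Cocycle hc)) + \pi_(H1 F) (Cocycle hd)); last by [].
rewrite H1_scale_pi -H1_pi_add.
by congr (\pi_(H1 F)); exact: val_inj.
Qed.

Lemma H1_class_eq c d : is_cocycle F c -> is_cocycle F d ->
  H1_class F c = H1_class F d <-> is_coboundary F (c - d).
Proof.
move=> /cocycleP hc /cocycleP hd; rewrite (H1_class_cocycle hc) (H1_class_cocycle hd).
have e : is_coboundary F (c - d) <-> Cocycle hc - Cocycle hd \in coboundary_pred (F := F).
  by split=> [h|/asboolP//]; exact/asboolP.
rewrite e; split=> [/eqP|] h; first by rewrite Quotient.idealrBE.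
by apply/eqP; rewrite -Quotient.idealrBE.
Qed.

Lemma H1_class_eq0 c : is_coboundary F c -> is_cocycle F c -> H1_class F c = 0.
Proof.
move=> hb hc; have /H1_class_eq := hc => /(_ _ is_cocycle0) [_].
rewrite subr0 => /(_ hb) ->; have /eqP := H1_class_lin 1 is_cocycle0 is_cocycle0.
by rewrite !scale1r addr0 -subr_eq subrr eq_sym => /eqP.
Qed.

Lemma H1_class_ext c d : is_cocycle F c -> is_cocycle F d ->
  (forall x y p, p != 0 -> c x y p = d x y p) -> H1_class F c = H1_class F d.
Proof.
move=> hc hd cd; apply/H1_class_eq => //.
exists (fun=> [set x | x != 0]), (fun=> 0); split; [exact: p1_coverT|by move=> x; exact: sections0|].
by move=> x y p [p0 _]; rewrite -[LHS]/(c x y p - d x y p) cd // !subrr.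
Qed.

End Classes.

(** A morphism of vector bundles in the encoding by functions on the cone. Multiplication by a
    polynomial or a matrix and the projections and inclusions of a direct sum are instances. *)
Definition fibrewise (W W' : lmodType C) (F : fun_sheaf W) (F' : fun_sheaf W') (T : X -> W -> W') :=
  (forall p (k : C) u v, T p (k *: u + v) = k *: T p u + T p v) /\
  (forall U f, p1_open U -> F U f -> F' U (fun p => T p (f p))).

Section Map.
Variables (W W' : lmodType C) (F : fun_sheaf W) (F' : fun_sheaf W').
Implicit Types (T : X -> W -> W').

Definition cochain_map T (c : cochain W) : cochain W' := fun x y p => T p (c x y p).

Lemma fibrewise0 T p : fibrewise F F' T -> T p 0 = 0.
Proof.
by move=> [Tl _]; have := Tl p 1 0 0; rewrite !scale1r addr0 => /eqP; rewrite -subr_eq subrr eq_sym => /eqP.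
Qed.

Lemma fibrewiseB T p u v : fibrewise F F' T -> T p (u - v) = T p u - T p v.
Proof. by move=> [Tl _]; rewrite addrC -scaleN1r Tl scaleN1r addrC. Qed.

Lemma fibrewiseD T p u v : fibrewise F F' T -> T p (u + v) = T p u + T p v.
Proof. by move=> [Tl _]; rewrite -[u]scale1r Tl !scale1r. Qed.

Lemma cocycle_map T c : fibrewise F F' T -> is_cocycle F c -> is_cocycle F' (cochain_map T c).
Proof.
move=> TF [U [[oU cU] cs cz]]; exists U; split; first by [].
  by move=> x y; apply: (proj2 TF); [exact: p1_openI|exact: cs].
move=> x y z p Up; rewrite /cochain_map -(fibrewiseB _ _ _ TF) -(fibrewiseD _ _ _ TF).
by rewrite (cz _ _ _ _ Up) (fibrewise0 _ TF).
Qed.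

Lemma coboundary_map T c : fibrewise F F' T -> is_coboundary F c -> is_coboundary F' (cochain_map T c).
Proof.
move=> TF [U [h [[oU cU] hs hE]]]; exists U, (fun x p => T p (h x p)); split; first by [].
  by move=> x; apply: (proj2 TF); [exact: oU|exact: hs].
by move=> x y p Up; rewrite /cochain_map (hE _ _ _ Up) (fibrewiseB _ _ _ TF).
Qed.

Definition H1map T (h : H1 F) : H1 F' := H1_class F' (cochain_map T (H1_repr h)).

Lemma H1map_class T c : fibrewise F F' T -> is_cocycle F c ->
  H1map T (H1_class F c) = H1_class F' (cochain_map T c).
Proof.
move=> TF hc; have hr := H1_repr_cocycle (H1_class F c).
apply/H1_class_eq; [exact: cocycle_map|exact: cocycle_map|].
have /H1_class_eq : H1_class F (H1_repr (H1_class F c)) = H1_class F c by rewrite H1_reprK.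
move=> /(_ hr hc)/(coboundary_map TF) [U [h [cU hs hE]]]; exists U, h; split=> //.
by move=> x y p /hE <-; rewrite /cochain_map (fibrewiseB _ _ _ TF).
Qed.

Lemma H1map_lin T (k : C) g h : fibrewise F F' T -> H1map T (k *: g + h) = k *: H1map T g + H1map T h.
Proof.
move=> TF; have gc := H1_repr_cocycle g; have hc := H1_repr_cocycle h.
rewrite -{1}[g]H1_reprK -{1}[h]H1_reprK -H1_class_lin // H1map_class //; last exact: is_cocycle_lin.
rewrite -H1_class_lin; [|exact: cocycle_map|exact: cocycle_map]; congr (H1_class F' _).
by apply/funext => x; apply/funext => y; apply/funext => p; rewrite /cochain_map (proj1 TF).
Qed.

Lemma H1map_ext T T' h : fibrewise F F' T -> fibrewise F F' T' ->
  (forall p w, p != 0 -> T p w = T' p w) -> H1map T h = H1map T' h.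
Proof.
move=> TF TF' TT; have hc := H1_repr_cocycle h.
apply: H1_class_ext; [exact: cocycle_map|exact: cocycle_map|].
by move=> x y p p0; exact: TT.
Qed.

Lemma fibrewise_zero : fibrewise F F' (fun _ _ => 0).
Proof. by split=> [p k u v|U f _ _]; [rewrite scaler0 addr0|exact: sections0]. Qed.

Lemma fibrewise_add T T' : fibrewise F F' T -> fibrewise F F' T' ->
  fibrewise F F' (fun p w => T p w + T' p w).
Proof.
move=> [Tl Ts] [Tl' Ts']; split=> [p k u v|U f oU Ff].
  by rewrite Tl Tl' scalerDr addrACA.
rewrite (_ : (fun p => _) = 1 *: (fun p => T p (f p)) + (fun p => T' p (f p))).
  by apply: sections_lin; [exact: Ts|exact: Ts'].
by apply/funext => p; rewrite scale1r.
Qed.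

Lemma fibrewise_sum (I : Type) (r : seq I) (T : I -> X -> W -> W') :
  (forall i, fibrewise F F' (T i)) -> fibrewise F F' (fun p w => \sum_(i <- r) T i p w).
Proof.
move=> TF; elim: r => [|i r IH].
  rewrite (_ : (fun p w => _) = (fun _ _ => 0)); first exact: fibrewise_zero.
  by apply/funext => p; apply/funext => w; rewrite big_nil.
rewrite (_ : (fun p w => _) = (fun p w => T i p w + \sum_(j <- r) T j p w)).
  exact: fibrewise_add.
by apply/funext => p; apply/funext => w; rewrite big_cons.
Qed.

Lemma H1map_sum (I : Type) (r : seq I) (T : I -> X -> W -> W') h :
  (forall i, fibrewise F F' (T i)) ->
  H1map (fun p w => \sum_(i <- r) T i p w) h = \sum_(i <- r) H1map (T i) h.
Proof.
move=> TF; have hc := H1_repr_cocycle h; elim: r => [|i r IH].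
  rewrite big_nil -(_ : H1_class F' 0 = 0); last first.
    by apply: H1_class_eq0; [exact: is_coboundary0|exact: is_cocycle0].
  congr (H1_class F' _); apply/funext => x; apply/funext => y; apply/funext => p.
  by rewrite /cochain_map big_nil.
rewrite big_cons -IH -[X in _ = X + _]scale1r -H1_class_lin.
- congr (H1_class F' _); apply/funext => x; apply/funext => y; apply/funext => p.
  by rewrite /cochain_map big_cons scale1r.
- exact: cocycle_map.
- by apply: cocycle_map hc; exact: fibrewise_sum.
Qed.

End Map.

Lemma fibrewise_comp (W W' W'' : lmodType C) (F : fun_sheaf W) (F' : fun_sheaf W') (F'' : fun_sheaf W'')
    (T : X -> W -> W') (T' : X -> W' -> W'') :
  fibrewise F F' T -> fibrewise F' F'' T' -> fibrewise F F'' (fun p w => T' p (T p w)).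
Proof.
move=> [Tl Ts] [Tl' Ts']; split=> [p k u v|U f oU Ff]; first by rewrite Tl Tl'.
by apply: (Ts' U (fun p => T p (f p))) => //; exact: Ts.
Qed.

Lemma H1map_comp (W W' W'' : lmodType C) (F : fun_sheaf W) (F' : fun_sheaf W') (F'' : fun_sheaf W'')
    (T : X -> W -> W') (T' : X -> W' -> W'') (h : H1 F) :
  fibrewise F F' T -> fibrewise F' F'' T' ->
  H1map F'' T' (H1map F' T h) = H1map F'' (fun p w => T' p (T p w)) h.
Proof. by move=> TF TF'; rewrite H1map_class //; apply: cocycle_map TF (H1_repr_cocycle h). Qed.

Lemma H1map_id (W : lmodType C) (F : fun_sheaf W) (h : H1 F) : H1map F (fun _ w => w) h = h.
Proof. exact: H1_reprK. Qed.

End Functoriality.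

(** * Serre duality for O(k) *)

Section SerreLine.
Variable R : realType.
Local Notation C := R[i].
Local Notation X := 'rV[C]_2.
Implicit Types (x y p : X) (k K : int) (U : set X).

Lemma std_lin k (a : C) (L L' : X -> C) : std (fun p => a * L p + L' p) = a *: std L + std L'.
Proof.
apply/funext => x; apply/funext => y; apply/funext => p.
by rewrite /std mulrDr mulrCA.
Qed.

Lemma O_sections_linear k U (a : C) (f g : X -> C) : O_sections k U f -> O_sections k U g ->
  O_sections k U (fun p => a * f p + g p).
Proof. exact: O_sections_lin. Qed.

Lemma H1_class_std_sum k (I : Type) (r : seq I) (s : I -> C) (L : I -> X -> C) :
  (forall i, O_sections k (coord_ne true `&` coord_ne false) (L i)) ->
  H1_class (OP1 C k) (std (fun p => \sum_(i <- r) s i * L i p)) =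
  \sum_(i <- r) s i *: H1_class (OP1 C k) (std (L i)).
Proof.
move=> Ls; elim: r => [|i r IH].
  rewrite big_nil -[RHS](@H1_class_eq0 _ _ (OP1 C k) 0); [|exact: is_coboundary0|exact: is_cocycle0].
  by congr H1_class; apply/funext => x; apply/funext => y; apply/funext => p; rewrite /std big_nil mulr0.
rewrite big_cons -IH -H1_class_lin; last 2 first.
- exact/std_cocycle/Ls.
- apply: std_cocycle; elim: r {IH} => [|j r IH].
    rewrite (_ : (fun p => _) = 0); first exact: O_sections0.
    by apply/funext => p; rewrite big_nil.
  rewrite (_ : (fun p => _) = (fun p => s j * L j p + \sum_(i <- r) s i * L i p)).
    by apply: O_sections_linear.
  by apply/funext => p; rewrite big_cons.
rewrite -(std_lin k); congr (H1_class _ (std _)).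
by apply/funext => p; rewrite big_cons.
Qed.

(** The coefficient of L is nonzero only between different charts, so only the values on their
    overlap count. *)
Lemma H1_class_std_ext k (L L' : X -> C) :
  O_sections k (coord_ne true `&` coord_ne false) L -> O_sections k (coord_ne true `&` coord_ne false) L' ->
  (forall p : X, p 0 0 != 0 -> p 0 1 != 0 -> L p = L' p) ->
  H1_class (OP1 C k) (std L) = H1_class (OP1 C k) (std L').
Proof.
move=> Ls Ls' LL; apply/H1_class_eq; [exact: std_cocycle|exact: std_cocycle|].
exists (@std_cover R), (fun=> 0); split; [exact: std_coverP|by move=> x; exact: O_sections0|].
move=> x y p []; rewrite -[_ x y p]/(std L x y p - std L' x y p) /std /std_cover /coord_ne /=.
case: (x 0 0 != 0); case: (y 0 0 != 0) => h1 h2; rewrite ?subrr ?mul0r ?subrr //.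
  by rewrite LL // subrr.
by rewrite LL // subrr.
Qed.

Definition mon_class k (j : nat) : H1 (OP1 C k) := H1_class (OP1 C k) (std (mon (k + j.+1) (- (j.+1)%:Z))).

Lemma mon_open_section i j k : i + j = k ->
  O_sections k (coord_ne true `&` coord_ne false) (mon i j : X -> C).
Proof. by move=> <-; apply: mon_section => _ x []. Qed.

Lemma H1_span k (h : H1 (OP1 C k)) : exists s : nat -> C, h = \sum_(j < tail_length k) s j *: mon_class k j.
Proof.
have hc := H1_repr_cocycle h; have [s sP] := cocycle_laurent_tail hc.
exists s; rewrite -[LHS]H1_reprK /mon_class.
have ms (j : 'I_(tail_length k)) : O_sections k (coord_ne true `&` coord_ne false)
    (mon (k + j.+1) (- (j.+1)%:Z) : X -> C) by apply: mon_open_section; rewrite addrK.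
rewrite -(H1_class_std_sum _ _ ms); apply/H1_class_eq => //.
apply: std_cocycle; apply: laurent_tail_section => x [] //.
Qed.

Let O2 := OP1 C (-2).
Let sigma := H1_class O2 (standard_cocycle (C := C)).

Let sigmaE : sigma = mon_class (-2) 0.
Proof.
rewrite /sigma /mon_class; congr H1_class; apply/funext => x; apply/funext => y; apply/funext => p.
rewrite /standard_cocycle /std; congr (_ * _).
by rewrite invfM.
Qed.

Let sigma_cocycle : is_cocycle O2 (standard_cocycle (C := C)).
Proof.
apply: (std_cocycle (L := fun p => (p 0 0 * p 0 1)^-1)).
have -> : (fun p : X => (p 0 0 * p 0 1)^-1) = mon (-1) (-1) by apply/funext => p; rewrite invfM.
exact: mon_open_section.
Qed.

Let sigma_neq0 : sigma != 0.
Proof.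
apply/eqP => s0; apply: (@std_not_coboundary R).
have : H1_class O2 (standard_cocycle (C := C)) = H1_class O2 0.
  rewrite -/sigma s0; apply/esym/H1_class_eq0; [exact: is_coboundary0|exact: is_cocycle0].
by move=> /(H1_class_eq sigma_cocycle (is_cocycle0 O2)); rewrite subr0.
Qed.

Let sigma_span (h : H1 O2) : exists a : C, h = a *: sigma.
Proof. by have [s ->] := H1_span h; exists (s 0%N); rewrite big_ord1 sigmaE. Qed.

(** H^1(O(-2)) is a line, spanned by the nonzero class [sigma]; the trace is the coordinate with
    respect to it. *)
Lemma trace_exists : exists t : {linear H1 (OP1 C (-2)) -> C^o}, is_trace t.
Proof.
have [t0 tE] := choice sigma_span.
have inj (a b : C) : a *: sigma = b *: sigma -> a = b.
  move=> /eqP; rewrite -subr_eq0 -scalerBl scaler_eq0 (negPf sigma_neq0) orbF subr_eq0.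
  by move=> /eqP.
have tl : linear (t0 : H1 O2 -> C^o).
  move=> a g h; apply: inj; rewrite -tE {1}[g]tE {1}[h]tE scalerA -scalerDl //.
pose tm := GRing.isLinear.Build C (H1 O2) C^o _ (t0 : H1 O2 -> C^o) tl.
pose t : {linear H1 O2 -> C^o} := HB.pack (t0 : H1 O2 -> C^o) tm.
exists t; split.
  exists (fun a : C^o => (a : C) *: sigma) => [h|a]; first by rewrite -tE.
  by apply: inj; rewrite -tE.
by apply: inj; rewrite -tE scale1r.
Qed.

Variable t : {linear H1 (OP1 C (-2)) -> C^o}.
Hypothesis tP : is_trace t.

Definition mulT K (v : homog C K) : X -> C^o -> C^o := fun p w => eval_at p (homog_poly v) * w.

Lemma mulT_fibrewise K k (v : homog C K) : K + k = -2 -> fibrewise (OP1 C k) (OP1 C (-2)) (mulT v).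
Proof.
move=> e; split=> [p a u w|U f oU Ff].
  by rewrite /mulT mulrDr; congr (_ + _); rewrite /GRing.scale /= mulrCA.
rewrite -e; apply: O_sectionsM; [exact/eval_section/homog_polyP|exact: Ff|].
by move=> x; exact: p1_open_neq0.
Qed.

(** For functions such as those in [serre_map], which are linear but do not come with that
    structure. *)
Lemma linfunE (aT : vectType C) (f : aT -> C^o) v : linear f -> linfun f v = f v.
Proof.
move=> fl; pose fm := GRing.isLinear.Build C aT C^o _ f fl.
by pose L : {linear aT -> C^o} := HB.pack f fm; exact: (lfunE L v).
Qed.

Definition serre_dual K k (h : H1 (OP1 C k)) : homog_dual C K :=
  linfun (fun v : homog C K => t (H1map (OP1 C (-2)) (mulT v) h) : C^o).

Lemma serre_dualE K k (h : H1 (OP1 C k)) v : K + k = -2 ->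
  serre_dual K h v = t (H1map (OP1 C (-2)) (mulT v) h).
Proof.
move=> e; apply: linfunE => a u w; rewrite -linearP; congr (t _).
have hc := H1_repr_cocycle h.
rewrite /H1map -H1_class_lin; [|exact: cocycle_map (mulT_fibrewise _ e) hc|exact: cocycle_map (mulT_fibrewise _ e) hc].
congr H1_class; apply/funext => x; apply/funext => y; apply/funext => p.
by rewrite /cochain_map /mulT homog_poly_linear eval_atD eval_atZ mulrDl -mulrA.
Qed.

Lemma serre_dual_linear K k : K + k = -2 -> linear (@serre_dual K k).
Proof.
move=> e a g h; apply/lfunP => v; rewrite lfunE /= lfunE /= !serre_dualE //.
by rewrite (H1map_lin _ _ _ (mulT_fibrewise v e)) linearP.
Qed.

Definition mon_homog (d b : nat) : homog C d := to_homog d (mpolyX C (mm (d - b) b)).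

Lemma mon_homogE d b : (b <= d)%N -> homog_poly (mon_homog d b) = mpolyX C (mm (d - b) b).
Proof.
by move=> bd; rewrite to_homogK //; have := is_homog_mm C (d - b) b; rewrite subnK.
Qed.

Lemma mon_homog_span (d : nat) (v : homog C d) :
  v = \sum_(j < d.+1) mcoeff (mm (d - j) j) (homog_poly v) *: mon_homog d j.
Proof.
apply: homog_poly_inj; rewrite {1}(homog_expand (homog_polyP v)).
elim/big_ind2: _ => [|p q u w -> ->|j _]; first by rewrite homog_poly0.
  by rewrite homog_polyD.
by rewrite homog_polyZ mon_homogE // -ltnS.
Qed.

(** The product of the two monomials is X_0^(j-b-1) X_1^(b-j-1). For b != j one exponent is
    nonnegative, so the product extends over a chart and its class is 0; for b = j it is 1/(X_0
    X_1), of trace 1. *)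
Lemma serre_dual_mon (d : nat) k (j b : nat) : d%:Z + k = -2 -> (b <= d)%N -> (j <= d)%N ->
  serre_dual d (mon_class k j) (mon_homog d b) = (b == j)%:R.
Proof.
move=> e bd jd; rewrite serre_dualE // /mon_class.
have ke : k = - d%:Z - 2 by lia.
have kj : k + j.+1 + - (j.+1)%:Z = k by rewrite addrK.
have mc : is_cocycle (OP1 C k) (std (mon (k + j.+1) (- (j.+1)%:Z))).
  by apply: std_cocycle; exact: mon_open_section.
rewrite (H1map_class (mulT_fibrewise _ e) mc).
(* The exponents of the product: u = (d - b) + (k + j + 1) and w = b - (j + 1), where k = -d - 2. *)
pose u : int := j%:Z - b%:Z - 1; pose w : int := b%:Z - j%:Z - 1.
have uw : u + w = -2 by rewrite /u /w; ring.
have sc : is_cocycle O2 (std (mon u w)) by apply: std_cocycle; exact: mon_open_section.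
have us := @mon_open_section u w (-2) uw.
have -> : cochain_map (mulT (mon_homog d b)) (std (mon (k + j.+1) (- (j.+1)%:Z))) =
    std (fun p => eval_at p (homog_poly (mon_homog d b)) * mon (k + j.+1) (- (j.+1)%:Z) p).
  by apply/funext => x; apply/funext => y; apply/funext => p; rewrite /cochain_map /mulT /std mulrCA.
rewrite (@H1_class_std_ext _ _ (mon u w)) //; last 2 first.
- rewrite -e; apply: O_sectionsM; [exact/eval_section/homog_polyP|exact: mon_open_section|].
  by move=> x [x0 _]; exact: p1_open_neq0 (coord_ne_open R true) x0.
- move=> p p0 p1; rewrite mon_homogE // eval_at_mm /mon.
  have e1 : p 0 0 ^ u = p 0 0 ^+ (d - b) * p 0 0 ^ (k + j.+1).
    by have -> : u = (d - b)%N%:Z + (k + j.+1) by [lia]; rewrite expfzDr.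
  have e2 : p 0 1 ^ w = p 0 1 ^+ b * p 0 1 ^ (- (j.+1)%:Z).
    by have -> : w = b%:Z + (- (j.+1)%:Z) by [lia]; rewrite expfzDr.
  by rewrite e1 e2 mulrACA.
have [bj|bj|bj] := ltngtP b j.
- rewrite H1_class_eq0 ?linear0 //; apply: (@std_coboundary R (-2) _ false).
  by rewrite -uw; apply: mon_section => [|_] //; rewrite /u => h; exfalso; lia.
- rewrite H1_class_eq0 ?linear0 //; apply: (@std_coboundary R (-2) _ true).
  by rewrite -uw; apply: mon_section => [_|] //; rewrite /w => h; exfalso; lia.
have [_ <-] := tP; congr (t _); rewrite -[RHS]/sigma sigmaE /mon_class.
by congr (H1_class _ (std (mon _ _))); rewrite /u /w bj; lia.
Qed.

Lemma serre_dual_sum K k n (s : nat -> C) (h : nat -> H1 (OP1 C k)) v : K + k = -2 ->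
  serre_dual K (\sum_(j < n) s j *: h j) v = \sum_(j < n) s j * serre_dual K (h j) v.
Proof.
move=> e; have Sl := serre_dual_linear e.
have S0 : serre_dual K (0 : H1 (OP1 C k)) = 0.
  by have := Sl (-1) 0 0; rewrite scaler0 addr0 scaleN1r addNr.
elim: n => [|n IH]; first by rewrite !big_ord0 S0 lfunE.
by rewrite !big_ord_recr /= addrC Sl lfunE /= lfunE /= IH addrC.
Qed.

Lemma sum_delta (n : nat) (s : nat -> C) (b : 'I_n) : \sum_(j < n) s j * ((b : nat) == j)%:R = s b.
Proof.
rewrite (bigD1 b) //= eqxx mulr1 big1 ?addr0 // => j jb.
by rewrite eq_sym (negPf (jb : (val j != val b))) mulr0.
Qed.

(** Pairing with the monomials reads off the coefficients of h in the spanning classes. If K < 0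
    then k >= -1 and there are no such classes. *)
Lemma serre_dual_inj0 K k (h : H1 (OP1 C k)) : K + k = -2 -> serre_dual K h = 0 -> h = 0.
Proof.
move=> e; have [s ->] := H1_span h; case: K e => d e Sh0; last first.
  have -> : tail_length k = 0%N by case: (k) e => n //; rewrite !NegzE => e; rewrite /=; lia.
  by rewrite big_ord0.
have kd : tail_length k = d.+1 by case: (k) e => n; rewrite ?NegzE /=; lia.
rewrite kd in Sh0 *; rewrite big1 // => b _.
have bd : (b <= d)%N by rewrite -ltnS.
suff -> : s b = 0 by rewrite scale0r.
rewrite -(sum_delta s b); have := congr1 (fun f : homog_dual C d => f (mon_homog d b)) Sh0.
rewrite /= lfunE /= (serre_dual_sum d.+1 s (mon_class k) _ e) => S0; rewrite -[RHS]S0; apply: eq_bigr => j _.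
by rewrite serre_dual_mon // -ltnS.
Qed.

(** The values of Phi on the monomials are the coefficients of a preimage, because the monomial
    classes are dual to them. *)
Lemma serre_dual_surj K k (Phi : homog_dual C K) : K + k = -2 ->
  exists h : H1 (OP1 C k), serre_dual K h = Phi.
Proof.
case: K Phi => d Phi e; last by exists 0; apply/lfunP => v; rewrite (_ : v = 0) ?linear0 //; apply/rowP => -[].
exists (\sum_(j < d.+1) Phi (mon_homog d j) *: mon_class k j).
apply/lfunP => v; rewrite [v](mon_homog_span v) !linear_sum /=.
apply: eq_bigr => b _; rewrite !linearZ /=; congr (_ *: _).
have bd : (b <= d)%N by rewrite -ltnS.
rewrite (serre_dual_sum d.+1 (fun j => Phi (mon_homog d j)) (mon_class k) _ e) -[RHS](sum_delta (fun j => Phi (mon_homog d j)) b).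
by apply: eq_bigr => j _; rewrite serre_dual_mon // -ltnS.
Qed.

End SerreLine.

(** * The automorphism group *)

Section AutomorphismGroup.
Variables (C : numClosedFieldType) (m : nat) (n : 'I_m -> int) (s : 'I_m -> nat).
Hypothesis n_decreasing : forall i j : 'I_m, (i < j)%N -> n j < n i.
Local Notation X := 'rV[C]_2.
Local Notation poly2 := (mpoly 2 C).
Local Notation r := (\sum_i s i)%N.
Implicit Types (A B : 'M[poly2]_r) (u v : 'I_r).

(** The degree attached to the block containing row u. It lets a block matrix of [G_E] be treated as
    a flat one whose (u, v) entry has degree N u - N v. *)
Definition row_degree u : int := n (tagnat.sig1 u).
Local Notation N := row_degree.

Definition const_part A : 'M[C]_r := map_mx (mcoeff (mnm0 : multinom 2)) A.

Lemma n_inj : injective n.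
Proof.
move=> i j nij; apply/val_inj; case: (ltngtP i j) => // /n_decreasing; by rewrite nij ltxx.
Qed.

Lemma is_homog0_const (p : poly2) : is_homog 0 p -> p = mpolyC 2 (mcoeff (mnm0 : multinom 2) p).
Proof.
move=> /is_homogP hp; apply/mpolyP => mu; rewrite mcoeffC.
have [->|mu0] := eqVneq mu mnm0; first by rewrite mulr1.
rewrite mulr0; apply/eqP/negPn/negP => /hp [] /eqP; rewrite mdeg_eq0; exact/negP.
Qed.

(** Distinct blocks have distinct degrees, so an entry off the diagonal blocks has nonzero degree
    and no constant term. *)
Lemma const_part_block A : (forall u v, is_homog (N u - N v) (A u v)) ->
  const_part A = \mxdiag_i submxblock (const_part A) i i.
Proof.
move=> hA; apply/mxblockP => i j; rewrite /mxdiag mxblockK; have [->|ij] := eqVneq i j.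
  by rewrite conform_mx_id.
apply/matrixP => a b; rewrite !mxE.
apply/eqP/negPn/negP; have /is_homogP h := hA (tagnat.Rank i a) (tagnat.Rank j b).
move=> /h; rewrite mdeg0 /row_degree !tagnat.Rank1K => /esym/eqP.
by rewrite subr_eq0 => /eqP/n_inj/eqP; exact/negP.
Qed.

(** Ranks add up over the diagonal blocks, so one deficient block makes the total rank deficient. *)
Lemma mxdiag_unit (D : forall i, 'M[C]_(s i)) :
  (\mxdiag_i D i \in unitmx) <-> forall i, D i \in unitmx.
Proof.
rewrite -row_free_unit /row_free rank_mxdiag; split=> [/eqP e i|h]; last first.
  by apply/eqP/eq_bigr => i _; apply/eqP; rewrite -[_ == _]/(row_free (D i)) row_free_unit.
rewrite -row_free_unit /row_free eqn_leq rank_leq_row /= leqNgt; apply/negP => lt.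
have : (\sum_i \rank (D i) < \sum_i s i)%N.
  rewrite (bigD1 i) //= [X in (_ < X)%N](bigD1 i) //= -addSn leq_add //.
  by apply: leq_sum => j _; exact: rank_leq_row.
by rewrite e ltnn.
Qed.

Lemma G_EP A : G_E C n s A <->
  (forall u v, is_homog (N u - N v) (A u v)) /\ const_part A \in unitmx.
Proof.
split=> [[hA cA]|[hA cA]].
  have hA' u v : is_homog (N u - N v) (A u v).
    by have := hA (tagnat.sig1 u) (tagnat.sig1 v) (tagnat.sig2 u) (tagnat.sig2 v); rewrite mxE !tagnat.sig2K.
  split=> //; rewrite const_part_block // mxdiag_unit => i; have [B Bu BE] := cA i.
  suff -> : submxblock (const_part A) i i = B by [].
  apply/matrixP => a b; have := congr1 (fun Q : 'M[poly2]_(s i) => mcoeff (mnm0 : multinom 2) (Q a b)) BE.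
  by rewrite !mxE mcoeffC eqxx mulr1.
split=> [i j a b|i].
  by have := hA (tagnat.Rank i a) (tagnat.Rank j b); rewrite /row_degree !tagnat.Rank1K mxE.
exists (submxblock (const_part A) i i); first by move: i; apply/mxdiag_unit; rewrite -const_part_block.
apply/matrixP => a b; rewrite !mxE; apply: is_homog0_const.
by have := hA (tagnat.Rank i a) (tagnat.Rank i b); rewrite /row_degree !tagnat.Rank1K subrr.
Qed.

Lemma is_homog_sign k (b : nat) (p : poly2) : is_homog k p -> is_homog k ((-1) ^+ b * p).
Proof.
move=> hp; elim: b => [|b IH]; first by rewrite expr0 mul1r.
by rewrite exprS -mulrA mulN1r; exact: is_homogN.
Qed.

Lemma is_homog_det l (f g : 'I_l -> int) (M : 'M[poly2]_l) :
  (forall a b, is_homog (f a - g b) (M a b)) -> is_homog (\sum_a f a - \sum_a g a) (\det M).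
Proof.
move=> hM; apply: is_homog_sum => sg _; apply: is_homog_sign.
have -> : \sum_a f a - \sum_a g a = \sum_a (f a - g (perm.fun_of_perm sg a)).
  by rewrite big_split /= sumrN; congr (_ - _); rewrite (reindex_inj (@perm.perm_inj _ sg)).
exact: is_homog_prod.
Qed.

Lemma det_const A : (forall u v, is_homog (N u - N v) (A u v)) ->
  \det A = mpolyC 2 (\det (const_part A)).
Proof.
move=> hA; rewrite det_map_mx; apply: is_homog0_const.
by have := is_homog_det hA; rewrite subrr.
Qed.

Lemma adj_homog A : (forall u v, is_homog (N u - N v) (A u v)) ->
  forall u v, is_homog (N u - N v) ((\adj A) u v).
Proof.
move=> hA u v; rewrite mxE /cofactor; apply: is_homog_sign.
(* The (u, v) entry of the adjugate comes from deleting row v and column u, which removes N v from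
   the row degrees and N u from the column degrees. *)
have -> : N u - N v = \sum_a N (fintype.lift v a) - \sum_a N (fintype.lift u a).
  have eN w : \sum_u N u = N w + \sum_a N (fintype.lift w a) by rewrite (bigD1_ord w).
  by apply/eqP; rewrite -(inj_eq (addrI (N v))) addrCA subrr addr0 addrA -eN (eN u) addrK.
by apply: is_homog_det => a b; rewrite !mxE; exact: hA.
Qed.

Definition G_inverse A : 'M[poly2]_r := mpolyC 2 (\det (const_part A))^-1 *: \adj A.

Lemma G_mulV A : G_E C n s A -> A *m G_inverse A = 1%:M /\ G_inverse A *m A = 1%:M.
Proof.
move=> /G_EP[hA cA].
have e : mpolyC 2 (\det (const_part A))^-1 * \det A = 1.
  by rewrite det_const // -mpolyCM mulVf // -unitfE.
by rewrite -scalemxAr mul_mx_adj -scalemxAl mul_adj_mx -mul_scalar_mx -scalar_mxM e.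
Qed.

Lemma G_homogM A B : (forall u v, is_homog (N u - N v) (A u v)) ->
  (forall u v, is_homog (N u - N v) (B u v)) -> forall u v, is_homog (N u - N v) ((A *m B) u v).
Proof.
move=> hA hB u v; rewrite mxE; apply: is_homog_sum => w _.
by have := is_homogM (hA u w) (hB w v); rewrite addrA subrK.
Qed.

Lemma const_partM A B : const_part (A *m B) = const_part A *m const_part B.
Proof. exact: map_mxM. Qed.

Lemma G_one : G_E C n s 1%:M.
Proof.
apply/G_EP; split=> [u v|]; last by rewrite /const_part map_mx1 unitmx1.
rewrite mxE; case: eqVneq => [->|_]; first by rewrite subrr; exact: is_homog1.
exact: is_homog0.
Qed.

Lemma G_mul A B : G_E C n s A -> G_E C n s B -> G_E C n s (A *m B).
Proof.
move=> /G_EP[hA cA] /G_EP[hB cB]; apply/G_EP; split; first exact: G_homogM.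
by rewrite const_partM unitmx_mul cA.
Qed.

Lemma G_inverseP A : G_E C n s A -> G_E C n s (G_inverse A).
Proof.
move=> GA; have [hA cA] := (G_EP A).1 GA; apply/G_EP; split=> [u v|].
  by rewrite mxE mul_mpolyC; apply: is_homogZ; exact: adj_homog.
have [AV _] := G_mulV GA.
have : const_part (A *m G_inverse A) \in unitmx by rewrite AV /const_part map_mx1 unitmx1.
by rewrite const_partM unitmx_mul => /andP[].
Qed.

Lemma G_group : is_group (G_E C n s) mulmx 1%:M G_inverse.
Proof.
split; [exact: G_one|exact: G_mul|exact: G_inverseP|by move=> *; rewrite mulmxA|].
move=> A GA; have [h1 h2] := G_mulV GA.
by split; rewrite ?mul1mx ?mulmx1.
Qed.

(** Entries of a matrix in G have degree at most max |N u - N v|, and [bmultinom 2 b] collects the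
    monomials of degree strictly below b. Hence [T] indexes every coefficient that can be
    nonzero. *)
Let b : nat := (\max_(u < r) \max_(v < r) `|N u - N v|%N).+1.
Let T : finType := ('I_r * 'I_r * bmultinom 2 b)%type.
Let e (k : 'I_#|T|) : 'I_r * 'I_r * multinom 2 :=
  let x := enum_val k in (x.1, bmnm x.2).

Let degree_bound u v (mu : multinom 2) : (mdeg mu)%:Z = N u - N v -> (mdeg mu < b)%N.
Proof.
move=> h; rewrite ltnS -[mdeg mu]/(`|(mdeg mu)%:Z|%N) h.
by apply: leq_trans (leq_bigmax u); exact: (leq_bigmax v).
Qed.

Section Generic.
Variables (M : nat) (w : 'I_M -> C) (x : 'I_#|T| -> 'I_M).

(** A matrix whose coefficients are independent variables: computing with it and then specialising
    yields the polynomials for the group operations. The renaming [x] allows two such matrices, in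
    disjoint variables, to be multiplied. *)
Definition generic : 'M[mpoly 2 (mpoly M C)]_r := \matrix_(u, v)
  \sum_(mu : bmultinom 2 b) mpolyX C (mnm1 (x (enum_rank (u, v, mu)))) *: mpolyX (mpoly M C) (bmnm mu).

Definition specialise : 'M[poly2]_r := map_mx (map_mpoly (meval w)) generic.

Lemma mcoeff_specialise u v mu : mcoeff mu (specialise u v) =
  if insub mu is Some mu' then w (x (enum_rank (u, v, mu' : bmultinom 2 b))) else 0.
Proof.
rewrite !mxE mcoeff_map_mpoly raddf_sum /=; case: insubP => [mu' lt mu'E|ge].
  rewrite (bigD1 mu') //= mcoeffZ mcoeffX -mu'E eqxx mulr1 [X in _ + X]big1 => [|nu ne].
    by rewrite addr0 mevalXU.
  by rewrite mcoeffZ mcoeffX -[_ == _]/(nu == mu') (negPf ne) mulr0.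
rewrite big1 ?meval0 // => nu _; rewrite mcoeffZ mcoeffX; case: eqP => [nuE|]; last by rewrite mulr0.
by case/negP: ge; rewrite -nuE; exact: bmdeg.
Qed.

Lemma specialiseE A : (forall k, w (x k) = G_coord C s (e k) A) ->
  (forall u v mu, mcoeff mu (A u v) != 0 -> (mdeg mu < b)%N) -> specialise = A.
Proof.
move=> wA bA; apply/matrixP => u v; apply/mpolyP => mu; rewrite mcoeff_specialise.
case: insubP => [mu' lt mu'E|ge].
  by rewrite wA /e enum_rankK /G_coord /= mu'E.
by apply/esym/eqP/negPn/negP => /bA; exact/negP.
Qed.

Lemma meval_mcoeff_generic (Q : 'M[mpoly 2 (mpoly M C)]_r) u v mu :
  meval w (mcoeff mu (Q u v)) = mcoeff mu (map_mx (map_mpoly (meval w)) Q u v).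
Proof. by rewrite mxE mcoeff_map_mpoly. Qed.

End Generic.

Lemma G_algebraic : affine_algebraic_group (G_coord C s) (G_E C n s) mulmx 1%:M.
Proof.
have bA A : G_E C n s A -> forall u v mu, mcoeff mu (A u v) != 0 -> (mdeg mu < b)%N.
  by move=> /G_EP[hA _] u v mu h; apply: (@degree_bound u v); move/is_homogP: (hA u v); apply.
exists G_inverse, #|T|, e.
(* The equations annihilate the coefficients of the wrong degree. The function delta below is the
   constant term of the generic determinant, that is, the determinant of the constant part. *)
exists [set f | exists k, (mdeg (e k).2)%:Z != N (e k).1.1 - N (e k).1.2 /\ f = mpolyX C (mnm1 k)].
exists (mcoeff (mnm0 : multinom 2) (\det (generic id))).
pose phi A : 'I_#|T| -> C := fun k => G_coord C s (e k) A.
have deltaE w : meval w (mcoeff (mnm0 : multinom 2) (\det (generic id))) =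
    \det (const_part (specialise w id)).
  by rewrite -mcoeff_map_mpoly -det_map_mx -det_map_mx.
have spec A : G_E C n s A -> specialise (phi A) id = A.
  by move=> GA; apply: specialiseE => //; exact: bA.
rewrite /= -/(phi _); split.
- exact: G_group.
- split=> [A u GA nu|A B GA GB AB]; last by rewrite -(spec A GA) -(spec B GB) -[phi A]/(fun k => _) AB.
  apply/eqP/negPn/negP => h; have lt := bA A GA _ _ _ h.
  by apply: (nu (enum_rank (u.1, BMultinom lt))); rewrite /e enum_rankK /=; case: u {nu h lt} => -[].
- apply/seteqP; split=> [_ [A GA <-]|w [wZ wd]] /=.
    split=> [_ [k [nk ->]]|].
      rewrite mevalXU; apply/eqP/negPn/negP => h.
      move/G_EP: GA => [hA _]; have /is_homogP h' := hA (e k).1.1 (e k).1.2.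
      by rewrite (h' _ h) eqxx in nk.
    by rewrite deltaE spec // -unitfE; move/G_EP: GA => [].
  have sp k : G_coord C s (e k) (specialise w id) = w k.
    rewrite /G_coord mcoeff_specialise /e /=; set y := enum_val k.
    have -> : insub (bmnm y.2) = Some y.2 by rewrite insubT ?bmdeg // => lt; congr Some; exact/val_inj.
    by rewrite -!surjective_pairing enum_valK.
  exists (specialise w id); last by apply/funext => k; exact: sp.
  apply/G_EP; split=> [u v|]; last by rewrite unitmxE unitfE -deltaE.
  apply/is_homogP => mu; rewrite mcoeff_specialise; case: insubP => [mu' lt mu'E|_]; last by rewrite eqxx.
  apply: contraNeq => h; apply/eqP; pose k := enum_rank (u, v, mu').
  rewrite -[LHS](mevalXU w); apply: wZ; exists k.
  by rewrite /e enum_rankK /= mu'E.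
- move=> k; exists 0%N.
  exists (mcoeff (e k).2 ((generic (@lshift #|T| #|T|) *m generic (@rshift #|T| #|T|)) (e k).1.1 (e k).1.2)).
  move=> A B GA GB; rewrite expr0 mul1r meval_mcoeff_generic map_mxM.
  rewrite -/(specialise _ _) -/(specialise _ _) (@specialiseE _ _ _ A) ?(@specialiseE _ _ _ B) //.
  + by move=> j; rewrite (unsplitK (inr j)).
  + exact: bA.
  + by move=> j; rewrite (unsplitK (inl j)).
  + exact: bA.
(* By Cramer's rule the inverse is the adjugate divided by the determinant, which on G is constant
   and equal to delta. *)
- move=> k; exists 1%N, (mcoeff (e k).2 ((\adj (generic id)) (e k).1.1 (e k).1.2)).
  move=> A GA; rewrite expr1 deltaE spec // meval_mcoeff_generic map_mx_adj.
  rewrite -/(specialise _ _) spec // /G_coord mxE mul_mpolyC mcoeffZ mulrA divff ?mul1r //.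
  by rewrite -unitfE; move/G_EP: GA => [].
Qed.

End AutomorphismGroup.

(** * Orbit spaces *)

Section OrbitHomeomorphism.
Variables (C : numClosedFieldType) (V V' : lmodType C) (G G' : Type).
Variables (D : set G) (act : G -> V -> V) (D' : set G') (act' : G' -> V' -> V').
Local Open Scope quotient_scope.

Lemma orbit_projE (v w : V) : orbit_proj D act v = orbit_proj D act w <-> orbit_of D act v = orbit_of D act w.
Proof.
have e := eqmodE (orbit_equiv D act) v w; split=> h.
  suff : orbit_rel D act v w by move=> /asboolP.
  by have <- : _ = orbit_rel D act v w := e; apply/eqP; exact: h.
have /eqP h' : v == w %[mod {eq_quot orbit_equiv D act}] by rewrite e; exact/asboolP.
exact: h'.
Qed.

Lemma orbit_proj_repr (x : orbit_space D act) : orbit_proj D act (repr x) = x.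
Proof. exact: reprK. Qed.

(** Composing a test map C^k -> V with f gives a test map into V', so preimages of open sets are
    open. *)
Lemma fintop_continuous (f : V -> V') : linear f -> continuous (f : fintop V -> fintop V').
Proof.
move=> fl; apply/continuousP => U oU.
suff : fintop_open (f @^-1` U : set (fintop V)) by [].
have {}oU : fintop_open U := oU; move=> k g.
pose fm := GRing.isLinear.Build C V V' _ f fl.
pose L : {linear V -> V'} := HB.pack f fm.
exact: (oU k (L \o g)).
Qed.

Lemma orbit_proj_continuous : continuous (orbit_proj D act : fintop V -> orbit_space D act).
Proof. exact: pi_continuous. Qed.

Lemma orbit_map_continuous (f : fintop V -> orbit_space D' act') : continuous f ->
  (forall v w, orbit_of D act v = orbit_of D act w -> f v = f w) ->
  continuous (fun x : orbit_space D act => f (repr x)).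
Proof.
move=> fc fE; apply: (repr_comp_continuous fc) => v w /eqP vw; apply/eqP; apply: fE.
exact/orbit_projE.
Qed.

End OrbitHomeomorphism.

(** The inverse of f is linear as well, so both are continuous for [fintop]; as they match orbits,
    they descend to the quotients through representatives. *)
Lemma orbit_homeomorphism (C : numClosedFieldType) (V V' : lmodType C) (G G' : Type)
  (D : set G) (act : G -> V -> V) (D' : set G') (act' : G' -> V' -> V') (f : V -> V') :
  linear f -> bijective f ->
  (forall v, f @` orbit_of D act v = orbit_of D' act' (f v)) ->
  exists (psi : orbit_space D act -> orbit_space D' act') (psi' : orbit_space D' act' -> orbit_space D act),
    [/\ cancel psi psi', cancel psi' psi, continuous psi, continuous psi' &
        forall v, psi (orbit_proj D act v) = orbit_proj D' act' (f v)].
Proof.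
move=> fl [g gf fg] fo.
have gl : linear g by move=> a u v; apply: (can_inj gf); rewrite fg fl !fg.
have go v : g @` orbit_of D' act' v = orbit_of D act (g v).
  rewrite -{1}(fg v) -fo; apply/seteqP; split=> [_ [_ [w ow <-] <-]|w ow]; first by rewrite gf.
  by exists (f w); [exists w|rewrite gf].
have fE v w : orbit_of D act v = orbit_of D act w -> orbit_proj D' act' (f v) = orbit_proj D' act' (f w).
  by move=> e; apply/orbit_projE; rewrite -!fo e.
have gE v w : orbit_of D' act' v = orbit_of D' act' w -> orbit_proj D act (g v) = orbit_proj D act (g w).
  by move=> e; apply/orbit_projE; rewrite -!go e.
have rE v : orbit_of D act (repr (orbit_proj D act v)) = orbit_of D act v.
  by apply/orbit_projE; rewrite orbit_proj_repr.
have rE' v : orbit_of D' act' (repr (orbit_proj D' act' v)) = orbit_of D' act' v.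
  by apply/orbit_projE; rewrite orbit_proj_repr.
exists (fun x => orbit_proj D' act' (f (repr x))), (fun x => orbit_proj D act (g (repr x))); split.
- move=> x; rewrite -[RHS]orbit_proj_repr -[in RHS](gf (repr x)); apply: gE.
  exact: rE'.
- move=> x; rewrite -[RHS]orbit_proj_repr -[in RHS](fg (repr x)); apply: fE.
  exact: rE.
- apply: (@orbit_map_continuous _ _ _ _ _ _ _ _ _ (fun v => orbit_proj D' act' (f v))); last exact: fE.
  move=> v; apply: (@continuous_comp _ _ _ (f : fintop V -> fintop V') (orbit_proj D' act')).
    exact: fintop_continuous.
  exact: orbit_proj_continuous.
- apply: (@orbit_map_continuous _ _ _ _ _ _ _ _ _ (fun v => orbit_proj D act (g v))); last exact: gE.
  move=> v; apply: (@continuous_comp _ _ _ (g : fintop V' -> fintop V) (orbit_proj D act)).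
    exact: fintop_continuous.
  exact: orbit_proj_continuous.
by move=> v; apply: fE; exact: rE.
Qed.

(** * Direct sums *)

Section SumSheaf.
Variables (C : numClosedFieldType) (m : nat) (n : 'I_m -> int) (s : 'I_m -> nat).
Local Notation X := 'rV[C]_2.
Local Notation poly2 := (mpoly 2 C).
Local Notation r := (\sum_i s i)%N.
Local Notation N := (row_degree n).
Implicit Types (u v : 'I_r) (U : set X).

Lemma linear_fun_sum (W W' : lmodType C) (f : W -> W') (I : Type) (l : seq I) (F : I -> W) :
  linear f -> f (\sum_(i <- l) F i) = \sum_(i <- l) f (F i).
Proof.
move=> fl; pose fm := GRing.isLinear.Build C W W' _ f fl.
by pose L : {linear W -> W'} := HB.pack f fm; exact: (linear_sum L).
Qed.

Lemma linear_fun0 (W W' : lmodType C) (f : W -> W') : linear f -> f 0 = 0.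
Proof. by move=> fl; have := linear_fun_sum [::] (fun _ : nat => 0) fl; rewrite !big_nil. Qed.

Lemma linear_inj0 (W W' : lmodType C) (f : W -> W') :
  linear f -> (forall w, f w = 0 -> w = 0) -> injective f.
Proof.
move=> fl f0 v w e; apply/eqP; rewrite -subr_eq0; apply/eqP/f0.
by rewrite -scaleN1r addrC fl e scaleN1r addNr.
Qed.

Lemma row_degree_Rank i (a : 'I_(s i)) : N (tagnat.Rank i a : 'I_r) = n i.
Proof. by rewrite /row_degree tagnat.Rank1K. Qed.

Lemma sum_OP U (f : X -> 'cV[C]_r) :
  sum_O C n s U f <-> forall u, O_sections (N u) U (fun x => f x u 0 : C^o).
Proof.
split=> h; last first.
  move=> i a; rewrite (_ : (fun x => _) = (fun x => f x (tagnat.Rank i a) 0)).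
    by have := h (tagnat.Rank i a); rewrite row_degree_Rank.
  by apply/funext => x; rewrite mxE.
move=> u; rewrite (_ : (fun x => _) = (fun x => submxcol (f x) (tagnat.sig1 u) (tagnat.sig2 u) 0)).
  exact: h.
by apply/funext => x; rewrite mxE tagnat.sig2K.
Qed.

(** [entry u] and [axis u] are the projection onto and the inclusion of the u-th line bundle of E,
    which is O(N u). *)
Definition entry u : X -> 'cV[C]_r -> C^o := fun _ w => w u 0.
Definition axis u : X -> C^o -> 'cV[C]_r := fun _ z => (z : C) *: delta_mx u 0.

Lemma entry_fibrewise k u : N u = k -> fibrewise (sum_O C n s) (OP1 C k) (entry u).
Proof.
by move=> <-; split=> [p a w w'|U f _ /sum_OP h]; [rewrite /entry !mxE|exact: h].
Qed.

Lemma axis_fibrewise k u : N u = k -> fibrewise (OP1 C k) (sum_O C n s) (axis u).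
Proof.
move=> <-; split=> [p a w w'|U f _ h]; first by rewrite /axis scalerDl scalerA.
apply/sum_OP => v; have [->|vu] := eqVneq v u.
  rewrite (_ : (fun x => _) = f); first exact: h.
  by apply/funext => x; rewrite !mxE !eqxx mulr1.
rewrite (_ : (fun x => _) = 0); first exact: O_sections0.
by apply/funext => x; rewrite !mxE (negPf vu) mulr0.
Qed.

Lemma sum_axis_entry (w : 'cV[C]_r) p : \sum_u axis u p (entry u p w) = w.
Proof.
apply/matrixP => v j; rewrite summxE (bigD1 v) //= !mxE ord1 !eqxx mulr1 big1 ?addr0 // => u uv.
by rewrite !mxE eq_sym (negPf uv) mulr0.
Qed.

Definition matT (g : X -> 'M[C]_r) : X -> 'cV[C]_r -> 'cV[C]_r := fun p w => g p *m w.

Lemma matT_fibrewise g : (forall U f, p1_open U -> sum_O C n s U f -> sum_O C n s U (fun x => g x *m f x)) ->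
  fibrewise (sum_O C n s) (sum_O C n s) (matT g).
Proof. by move=> h; split=> // p k v w; rewrite /matT mulmxDr scalemxAr. Qed.

Lemma Aut_fibrewise g : Aut_E C n s g -> fibrewise (sum_O C n s) (sum_O C n s) (matT g).
Proof. by case=> _ _ h; apply: matT_fibrewise => U f oU /h[]. Qed.

Lemma G_to_AutM (A B : 'M[poly2]_r) x : G_to_Aut C s (A *m B) x = G_to_Aut C s A x *m G_to_Aut C s B x.
Proof.
rewrite /G_to_Aut; case: ifP => _; first by rewrite mulmx1.
apply/matrixP => u v; rewrite !mxE eval_at_sum; apply: eq_bigr => w _.
by rewrite eval_atM !mxE.
Qed.

Lemma G_to_Aut1 x : G_to_Aut C s 1%:M x = 1%:M.
Proof.
rewrite /G_to_Aut; case: ifP => // _; apply/matrixP => u v; rewrite !mxE.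
by case: (u == v); rewrite ?eval_at1 ?eval_at0.
Qed.

Lemma invmx_unique (l : nat) (P Q : 'M[C]_l) : P *m Q = 1%:M -> invmx P = Q.
Proof.
by move=> PQ; have [uP _] := mulmx1_unit PQ; rewrite -[LHS]mulmx1 -PQ mulKmx.
Qed.

Lemma G_to_Aut_inverse (A : 'M[poly2]_r) x : (forall i j : 'I_m, (i < j)%N -> n j < n i) -> G_E C n s A ->
  G_to_Aut C s A x \in unitmx /\ invmx (G_to_Aut C s A x) = G_to_Aut C s (G_inverse A) x.
Proof.
move=> nd GA; have [AV _] := G_mulV nd GA.
have e : G_to_Aut C s A x *m G_to_Aut C s (G_inverse A) x = 1%:M by rewrite -G_to_AutM AV G_to_Aut1.
by split; [have [] := mulmx1_unit e|exact: invmx_unique].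
Qed.

Lemma G_to_Aut_inj (A B : 'M[poly2]_r) : G_E C n s A -> G_E C n s B -> (forall i j : 'I_m, (i < j)%N -> n j < n i) ->
  G_to_Aut C s A = G_to_Aut C s B -> A = B.
Proof.
move=> GA GB nd e; have [hA _] := (G_EP nd A).1 GA; have [hB _] := (G_EP nd B).1 GB.
apply/matrixP => u v; apply: (eval_at_inj (hA u v) (hB u v)) => x x0.
have := congr1 (fun g : X -> 'M[C]_r => g x u v) e.
by rewrite /G_to_Aut (negPf x0) !mxE.
Qed.

End SumSheaf.

(** * Automorphisms and the Serre map of the direct sum *)

Section SerreSum.
Variables (R : realType) (m : nat) (n : 'I_m -> int) (s : 'I_m -> nat).
Hypothesis n_decreasing : forall i j : 'I_m, (i < j)%N -> n j < n i.
Local Notation C := R[i].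
Local Notation X := 'rV[C]_2.
Local Notation poly2 := (mpoly 2 C).
Local Notation r := (\sum_i s i)%N.
Local Notation N := (row_degree n).
Local Notation E := (sum_O C n s).
Implicit Types (u v : 'I_r) (U : set X) (A B : 'M[poly2]_r).

Lemma O_ext k U (F G : X -> C) : p1_open U -> O_sections k U F -> (forall x, U x -> F x = G x) ->
  O_sections k U G.
Proof. by move=> oU Fs FG; apply: O_local => x Ux; exists U, F; split=> // y /FG. Qed.

Lemma O_sections_sum k U (I : Type) (l : seq I) (F : I -> X -> C) : (forall i, O_sections k U (F i)) ->
  O_sections k U (fun x => \sum_(i <- l) F i x).
Proof.
move=> Fs; elim: l => [|i l IH].
  by rewrite (_ : (fun x => _) = 0); [exact: O_sections0|apply/funext => x; rewrite big_nil].
rewrite (_ : (fun x => _) = (fun x => F i x + \sum_(j <- l) F j x)); first exact: O_sectionsD.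
by apply/funext => x; rewrite big_cons.
Qed.

Lemma G_to_Aut_sections A U (f : X -> 'cV[C]_r) : (forall u v, is_homog (N u - N v) (A u v)) ->
  p1_open U -> E U f -> E U (fun x => G_to_Aut C s A x *m f x).
Proof.
move=> hA oU /sum_OP hf; apply/sum_OP => u.
have U0 x : U x -> x != 0 by exact: p1_open_neq0.
apply: (@O_ext _ _ (fun x => \sum_v eval_at x (A u v) * f x v 0)) => // [|x /U0 x0].
  apply: O_sections_sum => v; rewrite -[N u](subrK (N v)).
  by apply: O_sectionsM; [exact: eval_section|exact: hf|exact: U0].
by rewrite /G_to_Aut (negPf x0) mxE; apply: eq_bigr => v _; rewrite mxE.
Qed.

Lemma G_to_Aut_Aut A : G_E C n s A -> Aut_E C n s (G_to_Aut C s A).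
Proof.
move=> GA; split=> [|x|U f oU Ef]; first by rewrite /G_to_Aut eqxx.
  by have [] := G_to_Aut_inverse x n_decreasing GA.
split; first by apply: G_to_Aut_sections => //; have [] := (G_EP n_decreasing A).1 GA.
rewrite (_ : (fun x => _) = (fun x => G_to_Aut C s (G_inverse A) x *m f x)); last first.
  by apply/funext => x; have [_ ->] := G_to_Aut_inverse x n_decreasing GA.
apply: G_to_Aut_sections => //.
by have [] := (G_EP n_decreasing (G_inverse A)).1 (G_inverseP n_decreasing GA).
Qed.

(** O(N v) may have no nonzero global sections, so the entry is isolated locally: g is applied to
    x_b^(N v) times a basis vector, and the result is divided by x_b^(N v). *)
Lemma entry_section (g : X -> 'M[C]_r) :
  (forall U f, p1_open U -> E U f -> E U (fun x => g x *m f x)) ->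
  forall u v, O_sections (N u - N v) [set x : X | x != 0] (fun x => g x u v).
Proof.
move=> gE u v; apply: O_local => x x0.
have [b xb] : exists b, x 0 b != 0.
  apply: contrapT => h; move/eqP: x0; apply; apply/rowP => b; rewrite mxE.
  by apply/eqP/negPn/negP => xb; apply: h; exists b.
pose V : set X := [set y : X | y 0 b != 0].
have oV : p1_open V by exact: coord_neq0_open.
have Vs k : O_sections k V (fun y : X => y 0 b ^ k) by exact: coordX_section.
have Ef : E V (fun y => (y 0 b ^ N v) *: delta_mx v 0 : 'cV[C]_r).
  have [_ h] := axis_fibrewise C (erefl (N v)).
  exact: (h V (fun y => y 0 b ^ N v : C) oV (Vs _)).
have /sum_OP/(_ u) h := gE V _ oV Ef.
exists V, (fun y => (g y *m ((y 0 b ^ N v) *: delta_mx v 0 : 'cV[C]_r)) u 0 * y 0 b ^ (- N v)); split=> //.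
  by apply: O_sectionsM => // y; exact: p1_open_neq0.
move=> y yb; rewrite -scalemxAr mxE -colE mxE mulrAC -expfzDr // subrr expr0z mul1r //.
Qed.

(** The entries of g and of its inverse are polynomials. Since evaluation is faithful, the two
    matrices A and B satisfy A B = 1, which makes the constant part of A invertible. *)
Lemma Aut_G_to_Aut g : Aut_E C n s g -> exists2 A, G_E C n s A & G_to_Aut C s A = g.
Proof.
move=> [g0 gU gE].
have poly (f : X -> 'M[C]_r) : (forall U h, p1_open U -> E U h -> E U (fun x => f x *m h x)) ->
    exists A : 'M[poly2]_r, (forall u v, is_homog (N u - N v) (A u v)) /\
      forall x, x != 0 -> f x = map_mx (eval_at x) A.
  move=> fE; have h u v := cid2 (global_section (entry_section fE u v)).
  exists (\matrix_(u, v) projT1 (h u v)); split=> [u v|x x0]; first by rewrite mxE; case: (h u v).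
  by apply/matrixP => u v; rewrite !mxE; case: (h u v) => p /= _; exact.
have [A [hA Ag]] := poly g (fun U h oU Eh => (gE U h oU Eh).1).
have [B [hB Bg]] := poly (fun x => invmx (g x)) (fun U h oU Eh => (gE U h oU Eh).2).
have Ag' : G_to_Aut C s A = g.
  by apply/funext => x; rewrite /G_to_Aut; case: eqP => [->|/eqP/Ag].
exists A => //; apply/G_EP => //; split=> //.
have AB : A *m B = 1%:M.
  apply/matrixP => u v; apply: (@eval_at_inj _ (N u - N v)).
  - exact: G_homogM.
  - by have [h _] := (G_EP n_decreasing _).1 (G_one C s n_decreasing); exact: h.
  - move=> x x0; have := congr1 (fun P : 'M[C]_r => P u v) (G_to_AutM A B x).
    rewrite Ag' [X in _ = X -> _](_ : _ = (1%:M : 'M[C]_r) u v).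
      by rewrite -(@G_to_Aut1 C m s x) /G_to_Aut (negPf x0) !mxE.
    by rewrite /G_to_Aut (negPf x0) -Bg // mulmxV.
have : const_part (A *m B) \in unitmx by rewrite AB /const_part map_mx1 unitmx1.
by rewrite const_partM unitmx_mul => /andP[].
Qed.

Lemma G_to_Aut_bij : set_bij (G_E C n s) (Aut_E C n s) (G_to_Aut C s).
Proof.
split=> [A|A B|g /Aut_G_to_Aut[A GA <-]]; first exact: G_to_Aut_Aut.
  by move=> /set_mem GA /set_mem GB; exact: (G_to_Aut_inj GA GB n_decreasing).
by exists A.
Qed.

Lemma H1map_entry_axis0 k l u v (h : H1 (OP1 C k)) : u != v ->
  H1map (OP1 C l) (fun p w => entry u p (axis v p w)) h = 0.
Proof.
move=> uv; rewrite (_ : (fun p w => _) = (fun _ _ => 0)).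
  by apply: H1_class_eq0; [exact: is_coboundary0|exact: is_cocycle0].
by apply/funext => p; apply/funext => w; rewrite /entry /axis !mxE (negPf uv) mulr0.
Qed.

Lemma sum_Rank (V : nmodType) (F : 'I_r -> V) : \sum_u F u = \sum_i \sum_(a < s i) F (tagnat.Rank i a).
Proof.
rewrite (sig_big_dep _ _ (fun i (a : 'I_(s i)) => F (tagnat.Rank i a))).
rewrite (reindex tagnat.sig); last exact/onW_bij/tagnat.sig_bij.
by apply: eq_bigr => u _; rewrite tagnat.sig2K.
Qed.

Variable t : {linear H1 (OP1 C (-2)) -> C^o}.
Hypothesis tP : is_trace t.
Local Notation S := (serre_map n s t).

Let deg i : -2 - n i + n i = -2. Proof. by rewrite subrK. Qed.

(** Factors each component of the Serre map through the projection to a line bundle, which makes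
    functoriality and the duality for O(k) applicable. *)
Lemma serre_mapE h i (a : 'I_(s i)) :
  S h i a = serre_dual t (-2 - n i) (H1map (OP1 C (n i)) (entry (tagnat.Rank i a)) h).
Proof.
rewrite ffunE; congr (linfun _); apply/funext => v; congr (t _).
rewrite (H1map_comp _ (entry_fibrewise C (row_degree_Rank n a)) (mulT_fibrewise v (deg i))).
congr H1_class; apply/funext => x; apply/funext => y; apply/funext => p.
by rewrite /cochain_map /mulT /entry mxE.
Qed.

Lemma ffun_linE (I : finType) (W : lmodType C) (k : C) (f g : {ffun I -> W}) a :
  (k *: f + g) a = k *: f a + g a.
Proof. by rewrite !ffunE. Qed.

Lemma serre_map_linear : linear S.
Proof.
move=> k g h; apply: functional_extensionality_dep => i; apply/ffunP => a.
rewrite serre_mapE.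
rewrite (H1map_lin _ _ _ (entry_fibrewise C (row_degree_Rank n a))).
rewrite (serre_dual_linear t (deg i)).
rewrite -!serre_mapE.
apply/esym.
exact: (ffun_linE k (S g i) (S h i) a).
Qed.

Lemma H1_sum_decomposition (h : H1 E) :
  h = \sum_u H1map E (axis u) (H1map (OP1 C (N u)) (entry u) h).
Proof.
rewrite -[LHS]H1map_id -(_ : (fun p w => \sum_u axis u p (entry u p w)) = fun _ w => w); last first.
  by apply/funext => p; apply/funext => w; exact: sum_axis_entry.
have cf u := entry_fibrewise C (erefl (N u)); have jf u := axis_fibrewise C (erefl (N u)).
rewrite H1map_sum => [|u]; last exact: fibrewise_comp (cf u) (jf u).
by apply: eq_bigr => u _; rewrite (H1map_comp h (cf u) (jf u)).
Qed.

(** By [H1_sum_decomposition] a class is determined by its components, and a preimage is the sum of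
    the included componentwise preimages; a component of an inclusion into another summand is 0. *)
Lemma serre_map_bij : bijective S.
Proof.
have Sinj : injective S.
  apply: (linear_inj0 serre_map_linear) => h Sh0; apply: (etrans (H1_sum_decomposition h)); apply: big1 => u _.
  rewrite (_ : H1map _ (entry u) h = 0).
    exact: linear_fun0 (fun k g h => H1map_lin k g h (axis_fibrewise C (erefl (N u)))).
  apply: (serre_dual_inj0 tP (deg (tagnat.sig1 u))).
  have := serre_mapE h (tagnat.sig2 u); rewrite Sh0 ffunE tagnat.sig2K; exact: esym.
suff Ssurj Phi : exists h, S h = Phi.
  have [T TK] := choice Ssurj; exists T => // h; apply: Sinj; exact: TK.
pose h i (a : 'I_(s i)) := projT1 (cid (serre_dual_surj tP (Phi i a) (deg i))).
have hE i (a : 'I_(s i)) : serre_dual t (-2 - n i) (h i a) = Phi i a by rewrite /h; case: (cid _).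
have jf i (a : 'I_(s i)) := axis_fibrewise C (row_degree_Rank n a).
have cf i (a : 'I_(s i)) := entry_fibrewise C (row_degree_Rank n a).
exists (\sum_i \sum_(a < s i) H1map E (axis (tagnat.Rank i a)) (h i a)).
apply: functional_extensionality_dep => i; apply/ffunP => a.
have evl : linear (fun h => S h i a).
  by move=> k g g'; rewrite serre_map_linear; exact: (ffun_linE k (S g i) (S g' i) a).
rewrite (linear_fun_sum _ _ evl) (bigD1 i) //= [X in _ + X = _]big1 => [|j ji].
  rewrite addr0 (linear_fun_sum _ _ evl) (bigD1 a) //= [X in _ + X = _]big1 => [|b ba].
    rewrite addr0 serre_mapE (H1map_comp _ (jf i a) (cf i a)) -[RHS]hE; congr serre_dual.
    rewrite -[RHS]H1map_id; congr (H1map _ _ _); apply/funext => p; apply/funext => w.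
    by rewrite /entry /axis !mxE !eqxx mulr1.
  rewrite serre_mapE (H1map_comp _ (jf i b) (cf i a)) H1map_entry_axis0; first exact: linear_fun0 (serre_dual_linear t (deg i)).
  by rewrite -val_eqE /= tagnat.eq_Rank eqxx eq_sym.
rewrite (linear_fun_sum _ _ evl) big1 // => b _.
rewrite serre_mapE (H1map_comp _ (jf j b) (cf i a)) H1map_entry_axis0; first exact: linear_fun0 (serre_dual_linear t (deg i)).
by rewrite -val_eqE /= tagnat.eq_Rank eq_sym (negPf ji).
Qed.

(** The row with the single entry p in position a is multiplied by B into p times row a of B. The
    degrees match, so [to_homog] is linear here and [linfun] returns the expected values. *)
Lemma tr_mulmapE i j (B : 'M[poly2]_(s i, s j)) (Phi : {ffun 'I_(s j) -> homog_dual C (-2 - n j)}) a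
    (v : homog C (-2 - n i)) :
  (forall a b, is_homog (n i - n j) (B a b)) ->
  tr_mulmap (-2 - n i) B Phi a v = \sum_b Phi b (to_homog (-2 - n j) (homog_poly v * B a b)).
Proof.
move=> hB; have hom p b : is_homog (-2 - n j) (homog_poly (p : homog C (-2 - n i)) * B a b).
  by have := is_homogM (homog_polyP p) (hB a b); rewrite addrA subrK.
pose f (p : homog C (-2 - n i)) : C^o := \sum_b Phi b (to_homog (-2 - n j) (homog_poly p * B a b)).
have fl : linear f.
  move=> k p q; rewrite scaler_sumr -big_split /=; apply: eq_bigr => b _.
  by rewrite homog_poly_linear mulrDl -scalerAl to_homog_linear // linearP.
rewrite ffunE -[RHS]/(f v) -(linfunE v fl); congr (linfun _ _); apply/funext => p.
apply: eq_bigr => b _; rewrite ffunE; congr (Phi b (to_homog _ _)).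
rewrite (bigD1 a) //= ffunE eqxx big1 ?addr0 // => a' a'a.
by rewrite ffunE (negPf a'a) homog_poly0 mul0r.
Qed.

Lemma serre_map_equivariant A h : G_E C n s A ->
  S (H1_act n s (G_to_Aut C s A) h) = G_act n s A (S h).
Proof.
move=> GA; have [hA _] := (G_EP n_decreasing A).1 GA.
have gf := Aut_fibrewise (G_to_Aut_Aut GA).
apply: functional_extensionality_dep => i; apply/ffunP => a; apply/lfunP => v.
have cf j (b : 'I_(s j)) := entry_fibrewise C (row_degree_Rank n b).
(* [q j b] is the (j, b) entry of the row v e_a A, where e_a is the basis row of position a in block
   i. *)
pose q j b := to_homog (-2 - n j) (homog_poly v * submxblock A i j a b).
have hB j a' b : is_homog (n i - n j) (submxblock A i j a' b) by case: GA => /(_ i j a' b).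
have qE j b : homog_poly (q j b) = homog_poly v * submxblock A i j a b.
  by rewrite to_homogK //; have := is_homogM (homog_polyP v) (hB j a b); rewrite addrA subrK.
have mf j b := fibrewise_comp (cf j b) (mulT_fibrewise (q j b) (deg j)).
transitivity (\sum_j \sum_b S h j b (q j b)).
  rewrite serre_mapE serre_dualE // (H1map_comp _ gf (cf i a)).
  rewrite (H1map_comp _ (fibrewise_comp gf (cf i a)) (mulT_fibrewise v (deg i))).
  rewrite (@H1map_ext _ _ _ _ _ _ (fun p w => \sum_j \sum_b mulT (q j b) p (entry (tagnat.Rank j b) p w))).
  - rewrite H1map_sum => [|j]; last exact: fibrewise_sum.
    rewrite linear_sum; apply: eq_bigr => j _; rewrite H1map_sum // linear_sum.
    by apply: eq_bigr => b _; rewrite serre_mapE serre_dualE // (H1map_comp _ (cf j b) (mulT_fibrewise _ (deg j))).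
  - exact: fibrewise_comp (fibrewise_comp gf (cf i a)) (mulT_fibrewise v (deg i)).
  - by apply: fibrewise_sum => j; exact: fibrewise_sum.
  move=> p w p0; rewrite /mulT /entry /matT /G_to_Aut (negPf p0) mxE mulr_sumr sum_Rank.
  apply: eq_bigr => j _; apply: eq_bigr => b _.
  by rewrite qE eval_atM !mxE mulrA.
rewrite /G_act sum_ffunE sum_lfunE; apply: eq_bigr => j _.
by rewrite tr_mulmapE.
Qed.

End SerreSum.

Theorem proposition3p1 (R : realType) (m : nat) (n : 'I_m -> int) (s : 'I_m -> nat)
    (n_decreasing : forall i j : 'I_m, (i < j)%N -> n j < n i)
    (s_gt0 : forall i, (0 < s i)%N) :
  [/\ affine_algebraic_group (G_coord R[i] s) (G_E R[i] n s) mulmx 1%:M,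
      set_bij (G_E R[i] n s) (Aut_E R[i] n s) (G_to_Aut R[i] s),
      forall A B, G_E R[i] n s A -> G_E R[i] n s B -> forall x,
        G_to_Aut R[i] s (A *m B) x = G_to_Aut R[i] s A x *m G_to_Aut R[i] s B x &
      exists t : {linear H1 (OP1 R[i] (-2)) -> R[i]^o},
        [/\ is_trace t,
            linear (serre_map n s t),
            bijective (serre_map n s t),
            forall A h, G_E R[i] n s A ->
              serre_map n s t (H1_act n s (G_to_Aut R[i] s A) h)
              = G_act n s A (serre_map n s t h) &
            exists (psi : moduli_space R[i] n s -> quotient_space R[i] n s)
                   (psi' : quotient_space R[i] n s -> moduli_space R[i] n s),
              [/\ cancel psi psi', cancel psi' psi,
                  continuous psi, continuous psi' &
                  forall h, psi (moduli_proj n s h)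
                            = quotient_proj n s (serre_map n s t h)]]].
Proof.
have [t tP] := trace_exists R.
split; [exact: G_algebraic|exact: G_to_Aut_bij|by move=> A B _ _ x; exact: G_to_AutM|].
exists t; split; [exact: tP|exact: serre_map_linear|exact: serre_map_bij|by move=> A h; exact: serre_map_equivariant|].
apply: orbit_homeomorphism; [exact: serre_map_linear|exact: serre_map_bij|].
(* Orbits match because every automorphism comes from G and the Serre map is equivariant. *)
move=> h; have [GA _ Asurj] := G_to_Aut_bij R s n_decreasing.
apply/seteqP; split=> [_ [_ [g /Asurj[A GEA <-] <-] <-]|_ [A GEA <-]].
  by exists A => //; rewrite serre_map_equivariant.
exists (H1_act n s (G_to_Aut R[i] s A) h); first by exists (G_to_Aut R[i] s A) => //; exact: GA.
exact: serre_map_equivariant.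
Qed.
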